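(* Let $1<p<\infty$. There is a constant $C_p$ depending only on $p$ such that the following holds. Let $T$ be a bounded linear operator on $\ell^\infty(L^p(\mathbb{T}))$ with $\|T\|\le1$. Then, for $H=T$ or for $H=\mathrm{Id}-T$, there exist an embedding $E:\ell^\infty(L^p(\mathbb{T}))\to\ell^\infty(L^p(\mathbb{T}))$ and a projection (bounded linear surjection) $P:\ell^\infty(L^p(\mathbb{T}))\to\ell^\infty(L^p(\mathbb{T}))$ such that $$\mathrm{Id}_{\ell^\infty(L^p(\mathbb{T}))}=P\,H\,E\qquad\text{and}\qquad\|E\|\cdot\|P\|\le C_p .$$
   Context: $\mathbb{T}=\{e^{i\theta}:\theta\in[-\pi,\pi]\}$. For a Banach space $Z$, $\ell^\infty(Z)$ is the space of bounded $Z$-valued sequences $(z_n)_{n\ge1}$ with norm $\sup_n\|z_n\|$. An embedding is a bounded linear operator that is an isomorphism onto its range. $\mathrm{Id}$ denotes the identity operator on the space in question. *)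

(* Defs.v *)
From HB Require Import structures.
From mathcomp Require Import all_boot all_order all_algebra.
From mathcomp Require Import complex.
From mathcomp Require Import all_classical all_reals all_analysis.
From mathcomp Require Import measurable_realfun.

Set Implicit Arguments.
Unset Strict Implicit.
Unset Printing Implicit Defensive.

Import Order.TTheory GRing.Theory Num.Theory.
Import Normc numFieldNormedType.Exports.

Local Open Scope classical_set_scope.
Local Open Scope complex_scope.
Local Open Scope ring_scope.

(* [hoelder.v] has only the real-valued [L^p] spaces, with neither a linear
   structure nor a norm on the quotient by almost-everywhere equality. *)

Section ComplexLnorm.
Context d (T : measurableType d) (R : realType).
Variable mu : {measure set T -> \bar R}.

(* The Borel sigma-algebra of [R[i]] is that of [R * R]. *)
Definition cmeasurable (f : T -> R[i]) :=
  measurable_fun setT (fun x => complex.Re (f x)) /\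
  measurable_fun setT (fun x => complex.Im (f x)).

Definition cabs (f : T -> R[i]) : T -> R := fun x => normc (f x).

Definition cLnorm (p : R) (f : T -> R[i]) : \bar R :=
  'N[mu]_(p%:E)[EFin \o cabs f].

Lemma cmeasurableD f g : cmeasurable f -> cmeasurable g ->
  cmeasurable (fun x => f x + g x).
Proof.
move=> [fr fi] [gr gi]; split.
- rewrite (_ : (fun x => _) =
    (fun x => complex.Re (f x)) \+ (fun x => complex.Re (g x)));
    first exact: measurable_funD.
  by apply/funext => x /=; case: (f x) (g x) => [? ?] [? ?].
- rewrite (_ : (fun x => _) =
    (fun x => complex.Im (f x)) \+ (fun x => complex.Im (g x)));
    first exact: measurable_funD.
  by apply/funext => x /=; case: (f x) (g x) => [? ?] [? ?].
Qed.

Lemma cmeasurableZ a f : cmeasurable f -> cmeasurable (fun x => a * f x).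
Proof.
case: a => a b [fr fi]; split.
- rewrite (_ : (fun x => _) =
    (cst a \* (fun x => complex.Re (f x))) \-
    (cst b \* (fun x => complex.Im (f x)))).
    by apply: measurable_funB; apply: measurable_funM => //;
      exact: measurable_cst.
  by apply/funext => x /=; case: (f x).
- rewrite (_ : (fun x => _) =
    (cst a \* (fun x => complex.Im (f x))) \+
    (cst b \* (fun x => complex.Re (f x)))).
    by apply: measurable_funD; apply: measurable_funM => //;
      exact: measurable_cst.
  by apply/funext => x /=; case: (f x).
Qed.

Lemma measurable_normc f : cmeasurable f ->
  measurable_fun setT (cabs f).
Proof.
move=> [fr fi].
rewrite /cabs (_ : (fun x => _) = (fun y => y `^ 2^-1) \o
  ((fun x => complex.Re (f x)) \* (fun x => complex.Re (f x)) \+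
   (fun x => complex.Im (f x)) \* (fun x => complex.Im (f x)))).
  apply: measurableT_comp; first exact: measurable_powR.
  by apply: measurable_funD; exact: measurable_funM.
apply/funext => x /=; case: (f x) => a b /=.
by rewrite powR12_sqrt -?expr2 // addr_ge0 ?sqr_ge0.
Qed.

Variables (p : R) (p1 : 1 <= p).

Let p1E : (1 <= p%:E)%E. Proof. by rewrite lee_fin. Qed.
Let p0 : 0 < p. Proof. exact: lt_le_trans p1. Qed.

Let Lnorm_le (f g : T -> R) : measurable_fun setT f -> measurable_fun setT g ->
  (forall x, 0 <= f x <= g x) ->
  ('N[mu]_(p%:E)[EFin \o f] <= 'N[mu]_(p%:E)[EFin \o g])%E.
Proof.
move=> mf mg fg; rewrite unlock /Lnorm.
have mp (h : T -> R) : measurable_fun setT h ->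
    measurable_fun setT (fun x => `|(h x)%:E| `^ p)%E.
  move=> mh.
  apply: (measurableT_comp (measurable_poweR _)).
  by apply: measurableT_comp => //; apply/measurable_EFinP.
apply: gt0_ler_poweR; rewrite ?invr_ge0 ?(ltW p0) //.
- by rewrite in_itv /= integral_ge0 ?leey// => x _; exact: poweR_ge0.
- by rewrite in_itv /= integral_ge0 ?leey// => x _; exact: poweR_ge0.
apply: ge0_le_integral => //.
- by move=> x _; exact: poweR_ge0.
- exact: mp.
- exact: mp.
- move=> x _; have /andP[f0 fgx] := fg x.
  apply: gt0_ler_poweR; rewrite ?(ltW p0) ?in_itv /= ?leey ?andbT ?lee_fin//.
  by rewrite !ger0_norm// (le_trans f0).
Qed.

Lemma cLnormD f g : cmeasurable f -> cmeasurable g ->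
  (cLnorm p (fun x => f x + g x)%R <= cLnorm p f + cLnorm p g)%E.
Proof.
move=> mf mg; rewrite /cLnorm.
apply: (@le_trans _ _ ('N[mu]_(p%:E)[EFin \o (cabs f \+ cabs g)%R])%E).
  apply: Lnorm_le.
  - exact/measurable_normc/cmeasurableD.
  - by apply: measurable_funD; exact: measurable_normc.
  - move=> x; rewrite /cabs /= le_normcD andbT.
    by case: (f x + g x) => ? ? /=; exact: sqrtr_ge0.
by apply: eminkowski => //; exact: measurable_normc.
Qed.

Lemma cLnormZ a f : cmeasurable f -> (cLnorm p f < +oo)%E ->
  (cLnorm p (fun x => a * f x)%R = (normc a)%:E * cLnorm p f)%E.
Proof.
move=> mf lf; rewrite /cLnorm.
have fP : cabs f \in (Lfun mu p%:E : {pred (T -> R)}).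
  rewrite inE; apply/andP; split; rewrite inE //=.
  exact: measurable_normc.
have na : 0 <= normc a by case: a => ? ? /=; exact: sqrtr_ge0.
have := LnormZ (Lfun_Sub p1E fP) (normc a).
rewrite ger0_norm // => <-; congr (Lnorm _ _ _).
by apply/funext => x /=; rewrite /cabs normcM.
Qed.

Lemma eq_cLnorm f g : cmeasurable f -> cmeasurable g ->
  f = g %[ae mu] -> cLnorm p f = cLnorm p g.
Proof.
move=> mf mg fg; rewrite /cLnorm unlock /Lnorm; congr (_ `^ _)%E.
have mp (h : T -> R) : measurable_fun setT h ->
    measurable_fun setT (fun x => `|(h x)%:E| `^ p)%E.
  move=> mh.
  apply: (measurableT_comp (measurable_poweR _)).
  by apply: measurableT_comp => //; apply/measurable_EFinP.
apply: ge0_ae_eq_integral => //.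
- exact/mp/measurable_normc.
- exact/mp/measurable_normc.
- by move=> x _; exact: poweR_ge0.
- by move=> x _; exact: poweR_ge0.
- by apply: filterS fg => x /= + _ => /(_ I) fgx; rewrite /cabs fgx.
Qed.

End ComplexLnorm.

Record cLfun d (T : measurableType d) (R : realType)
    (mu : {measure set T -> \bar R}) (p : R) (p1 : 1 <= p) := CLfun {
  cLfun_val :> T -> R[i];
  cLfun_measurable : cmeasurable cLfun_val;
  cLfun_finite : (cLnorm mu p cLfun_val < +oo)%E }.

Section ComplexLp.
Context d (T : measurableType d) (R : realType).
Variables (mu : {measure set T -> \bar R}) (p : R) (p1 : 1 <= p).

Local Notation cLfun := (cLfun mu p1).
Local Notation CLfun := (@CLfun _ _ _ mu p p1).
Local Notation cLnorm := (cLnorm mu).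

Let p0 : 0 < p. Proof. exact: lt_le_trans p1. Qed.

HB.instance Definition _ := gen_eqMixin cLfun.
HB.instance Definition _ := gen_choiceMixin cLfun.

Lemma cLfunD_finite (f g : cLfun) : (cLnorm p (fun x => f x + g x)%R < +oo)%E.
Proof.
apply: (le_lt_trans (cLnormD mu p1 (cLfun_measurable f) (cLfun_measurable g))).
by rewrite lte_add_pinfty //; exact: cLfun_finite.
Qed.

Lemma cLfunZ_finite a (f : cLfun) : (cLnorm p (fun x => a * f x)%R < +oo)%E.
Proof.
rewrite (cLnormZ p1 _ (cLfun_measurable f) (cLfun_finite f)).
rewrite lte_mul_pinfty ?lee_fin //; last exact: cLfun_finite.
by case: a => ? ? /=; exact: sqrtr_ge0.
Qed.

Lemma cLfun0_measurable : cmeasurable ((fun=> 0) : T -> R[i]).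
Proof. by split; exact: measurable_cst. Qed.

Lemma cLfun0_finite : (cLnorm p (fun=> 0%R : R[i]) < +oo)%E.
Proof.
rewrite /cLnorm (_ : _ \o _ = cst 0%E); last first.
  by apply/funext => x /=; rewrite /cabs normc0.
by rewrite Lnorm0 // gt_eqF.
Qed.

Definition cLfunD (f g : cLfun) : cLfun :=
  CLfun (cmeasurableD (cLfun_measurable f) (cLfun_measurable g))
        (cLfunD_finite f g).
Definition cLfunZ (a : R[i]) (f : cLfun) : cLfun :=
  CLfun (cmeasurableZ a (cLfun_measurable f)) (cLfunZ_finite a f).
Definition cLfun0 : cLfun := CLfun cLfun0_measurable cLfun0_finite.

Definition cLfun_ae_eq (f g : cLfun) := `[< (f : T -> R[i]) = g %[ae mu] >].

Let cLfun_ae_eq_refl : reflexive cLfun_ae_eq.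
Proof. by move=> f; apply/asboolP; exact: ae_eq_refl. Qed.

Let cLfun_ae_eq_sym : symmetric cLfun_ae_eq.
Proof.
by move=> f g; apply/idP/idP => /asboolP h; apply/asboolP/ae_eq_sym.
Qed.

Let cLfun_ae_eq_trans : transitive cLfun_ae_eq.
Proof.
move=> f g h /asboolP gf /asboolP fh; apply/asboolP; exact: ae_eq_trans gf fh.
Qed.

Canonical cLfun_ae_eq_equiv := EquivRel cLfun_ae_eq
  cLfun_ae_eq_refl cLfun_ae_eq_sym cLfun_ae_eq_trans.

Local Open Scope quotient_scope.

Definition cLp : Type := {eq_quot cLfun_ae_eq}.
HB.instance Definition _ := Choice.on cLp.
HB.instance Definition _ := EqQuotient.on cLp.

Lemma cLp_eqP (f g : cLfun) :
  (\pi_cLp f = \pi_cLp g) <-> ((f : T -> R[i]) = g %[ae mu]).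
Proof.
split=> [/eqP|fg]; first by rewrite eqmodE => /asboolP.
by apply/eqP; rewrite eqmodE; apply/asboolP.
Qed.

Lemma cLp_reprP (f : cLfun) :
  (repr (\pi_cLp f) : T -> R[i]) = (f : T -> R[i]) %[ae mu].
Proof. by apply/cLp_eqP; rewrite reprK. Qed.

Definition cLp_add (x y : cLp) : cLp := \pi_cLp (cLfunD (repr x) (repr y)).
Definition cLp_scale (a : R[i]) (x : cLp) : cLp := \pi_cLp (cLfunZ a (repr x)).
Definition cLp_opp (x : cLp) : cLp := cLp_scale (-1) x.
Definition cLp_zero : cLp := \pi_cLp cLfun0.

Lemma cLp_add_pi (f g : cLfun) :
  cLp_add (\pi_cLp f) (\pi_cLp g) = \pi_cLp (cLfunD f g).
Proof.
apply/cLp_eqP; apply: filterS2 (cLp_reprP f) (cLp_reprP g).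
by move=> x /= fx gx _; rewrite fx ?gx.
Qed.

Lemma cLp_scale_pi a (f : cLfun) :
  cLp_scale a (\pi_cLp f) = \pi_cLp (cLfunZ a f).
Proof.
apply/cLp_eqP; apply: filterS (cLp_reprP f).
by move=> x /= fx _; rewrite fx.
Qed.

Let pi_eq (f g : cLfun) : f =1 g -> \pi_cLp f = \pi_cLp g.
Proof. by move=> fg; apply/cLp_eqP; apply/nearW => x _; exact: fg. Qed.

Let cLp_addA : associative cLp_add.
Proof.
elim/quotW=> f; elim/quotW=> g; elim/quotW=> h.
rewrite (cLp_add_pi g h) (cLp_add_pi f g) 2!cLp_add_pi.
by apply: pi_eq => t /=; rewrite addrA.
Qed.

Let cLp_addC : commutative cLp_add.
Proof.
elim/quotW=> f; elim/quotW=> g; rewrite (cLp_add_pi f g) (cLp_add_pi g f).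
by apply: pi_eq => t /=; rewrite addrC.
Qed.

Let cLp_add0 : left_id cLp_zero cLp_add.
Proof.
elim/quotW=> f; rewrite (cLp_add_pi cLfun0 f).
by apply: pi_eq => t /=; rewrite add0r.
Qed.

Let cLp_addN : left_inverse cLp_zero cLp_opp cLp_add.
Proof.
elim/quotW=> f; rewrite /cLp_opp (cLp_scale_pi (-1) f) cLp_add_pi.
by apply: pi_eq => t /=; rewrite mulN1r addNr.
Qed.

HB.instance Definition _ :=
  GRing.isZmodule.Build cLp cLp_addA cLp_addC cLp_add0 cLp_addN.

Let cLp_scaleA a b x : cLp_scale a (cLp_scale b x) = cLp_scale (a * b) x.
Proof.
elim/quotW: x => f; rewrite (cLp_scale_pi b f) 2!cLp_scale_pi.
by apply: pi_eq => t /=; rewrite mulrA.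
Qed.

Let cLp_scale1 : left_id 1 cLp_scale.
Proof.
elim/quotW=> f; rewrite cLp_scale_pi.
by apply: pi_eq => t /=; rewrite mul1r.
Qed.

Let cLp_scaleDr : right_distributive cLp_scale +%R.
Proof.
move=> a; elim/quotW=> f; elim/quotW=> g; rewrite /GRing.add /=.
rewrite (cLp_add_pi f g) (cLp_scale_pi a f) (cLp_scale_pi a g).
rewrite cLp_scale_pi cLp_add_pi.
by apply: pi_eq => t /=; rewrite mulrDr.
Qed.

Let cLp_scaleDl x : {morph cLp_scale^~ x : a b / a + b}.
Proof.
elim/quotW: x => f a b.
rewrite (cLp_scale_pi (a + b) f) (cLp_scale_pi a f) (cLp_scale_pi b f).
rewrite [RHS]cLp_add_pi.
by apply: pi_eq => t /=; rewrite mulrDl.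
Qed.

HB.instance Definition _ := GRing.Zmodule_isLmodule.Build R[i] cLp
  cLp_scaleA cLp_scale1 cLp_scaleDr cLp_scaleDl.

Definition cLp_norm (x : cLp) : R[i] := (fine (cLnorm p (repr x)))%:C.

Lemma cLnorm_fine (f : cLfun) : (fine (cLnorm p f))%:E = cLnorm p f.
Proof.
rewrite fineK // ge0_fin_numE ?Lnorm_ge0 //; exact: cLfun_finite.
Qed.

Lemma cLp_norm_pi (f : cLfun) : cLp_norm (\pi_cLp f) = (fine (cLnorm p f))%:C.
Proof.
rewrite /cLp_norm (@eq_cLnorm _ _ _ mu p _ f) //; try exact: cLfun_measurable.
exact: cLp_reprP.
Qed.

Let cLp_normD x y : cLp_norm (x + y) <= cLp_norm x + cLp_norm y.
Proof.
elim/quotW: x => f; elim/quotW: y => g.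
rewrite [X in cLp_norm X <= _]cLp_add_pi !cLp_norm_pi.
rewrite -rmorphD lecR -lee_fin EFinD !cLnorm_fine.
exact: (cLnormD mu p1 (cLfun_measurable f) (cLfun_measurable g)).
Qed.

Let cLp_normZ a x : cLp_norm (a *: x) = `|a| * cLp_norm x.
Proof.
elim/quotW: x => f.
rewrite [X in cLp_norm X = _]cLp_scale_pi !cLp_norm_pi.
rewrite normc_def -rmorphM; congr (_%:C); apply: EFin_inj.
rewrite EFinM !cLnorm_fine.
rewrite (cLnormZ p1 _ (cLfun_measurable f) (cLfun_finite f)).
by case: a.
Qed.

Let cLp_norm0_eq0 x : cLp_norm x = 0 -> x = 0.
Proof.
elim/quotW: x => f; rewrite cLp_norm_pi.
move=> /complexI f0.
have {}f0 : cLnorm p f = 0%E by rewrite -cLnorm_fine f0.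
have h := Lnorm_eq0_eq0 _ _ f0.
apply/cLp_eqP; apply: filterS (h _ _) => [t /(_ I) [] /= /eq0_normc -> //||].
- by apply/measurable_EFinP/measurable_normc; exact: cLfun_measurable.
- by rewrite lte_fin.
Qed.

HB.instance Definition _ := Lmodule_isNormed.Build R[i] cLp
  cLp_normD cLp_normZ cLp_norm0_eq0.

End ComplexLp.

Arguments cLp {d T R} mu {p} p1.

Section Circle.
Variable R : realType.

Definition circle : Type := {z : R[i] | `|z| == 1}.
HB.instance Definition _ := Choice.on circle.
HB.instance Definition _ :=
  isPointed.Build circle (exist _ (1 : R[i]) (introT eqP (normr1 _))).

Definition circle_coord (z : circle) : R * R :=
  (complex.Re (val z), complex.Im (val z)).

(* The trace of the Borel sigma-algebra of the plane. *)
HB.instance Definition _ := Measurable.copy circle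
  (g_sigma_algebra_preimageType circle_coord).

Lemma expi_subproof (t : R) : `|cos t +i* sin t| == 1 :> R[i].
Proof. by rewrite normc_def /= cos2Dsin2 sqrtr1. Qed.

Definition expi (t : measurableTypeR R) : circle :=
  exist _ (cos t +i* sin t) (expi_subproof t).

Lemma measurable_expi : measurable_fun setT expi.
Proof.
move=> _ A [B mB <-]; rewrite !setTI -comp_preimage.
rewrite -[X in measurable X]setTI.
suff m : measurable_fun setT (circle_coord \o expi) by exact: m.
apply: measurable_fun_pair; apply: continuous_measurable_fun.
- exact: continuous_cos.
- exact: continuous_sin.
Qed.

HB.instance Definition _ :=
  isMeasurableFun.Build _ _ _ _ expi measurable_expi.

Lemma ltNpi_pi : - pi < pi :> R.
Proof. by rewrite (lt_trans _ (pi_gt0 R)) // oppr_lt0 pi_gt0. Qed.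

(* The image of [dt / 2pi] on [[-pi, pi]] under [t |-> e^{it}]. *)
Definition arc_length : {measure set circle -> \bar R} :=
  distribution (uniform_prob ltNpi_pi) expi.

End Circle.

Definition LpT (R : realType) (p : R) (p_gt1 : 1 < p) : normedModType R[i] :=
  cLp (arc_length R) (ltW p_gt1).

(* The norm of a normed module over [R[i]] is [R[i]]-valued. *)
Definition rnorm (R : realType) (V : normedModType R[i]) (x : V) : R :=
  complex.Re `|x|.

Section Rnorm.
Variables (R : realType) (V : normedModType R[i]).
Implicit Types x y : V.

Lemma rnormE x : `|x| = (rnorm x)%:C.
Proof. by rewrite RRe_real // normr_real. Qed.

Lemma rnorm_ge0 x : 0 <= rnorm x.
Proof. by rewrite -lecR -rnormE normr_ge0. Qed.

Lemma rnormD x y : rnorm (x + y) <= rnorm x + rnorm y.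
Proof. by rewrite -lecR rmorphD /= -!rnormE ler_normD. Qed.

Lemma rnormZ a x : rnorm (a *: x) = normc a * rnorm x.
Proof.
apply: complexI; rewrite rmorphM /= -!rnormE normrZ; congr (_ * _).
Qed.

Lemma rnorm_eq0 x : rnorm x = 0 -> x = 0.
Proof. by move=> x0; apply: normr0_eq0; rewrite rnormE x0. Qed.

End Rnorm.

Section Linfty.
Variables (R : realType) (Z : normedModType R[i]).

Definition bounded_seq : {pred (nat -> Z)} :=
  mem ([set z | bounded_fun z] : set (nat -> Z)).

Lemma bounded_seqP (z : nat -> Z) :
  reflect (exists M : R, forall n, `|z n| <= M%:C) (z \in bounded_seq).
Proof.
apply: (iffP idP) => [|[M zM]].
  rewrite inE => -[B [/complex_realP[b ->] zB]].
  exists (b + 1) => n; rewrite rmorphD /=.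
  by apply: (zB (b%:C + 1)); rewrite ?ltrDl.
rewrite inE; exists M%:C; split; first by apply/complex_realP; exists M.
by move=> N MN n _ /=; rewrite (le_trans (zM n)) // ltW.
Qed.

Lemma bounded_seq_submod_closed : submod_closed bounded_seq.
Proof.
split=> [|a x y /bounded_seqP[M xM] /bounded_seqP[N yN]].
  by apply/bounded_seqP; exists 0 => n; rewrite normr0.
apply/bounded_seqP; exists (normc a * M + N) => n.
rewrite rmorphD rmorphM (le_trans (ler_normD _ _)) // lerD //.
rewrite normrZ (_ : `|a| = (normc a)%:C); last by rewrite normc_def; case: (a).
by rewrite ler_wpM2l // lecR; case: (a) => ? ? /=; exact: sqrtr_ge0.
Qed.

HB.instance Definition _ :=
  GRing.isSubmodClosed.Build R[i] (nat -> Z) bounded_seq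
    bounded_seq_submod_closed.

(* Sequences start at index 0 rather than 1. *)
Definition linfty : Type := {z : nat -> Z | z \in bounded_seq}.
HB.instance Definition _ := [isSub of linfty for @sval _ _].
HB.instance Definition _ := [Choice of linfty by <:].
HB.instance Definition _ := [SubChoice_isSubLmodule of linfty by <:].

Lemma linfty_bounded (z : linfty) :
  has_sup [set rnorm (val z n) | n in [set: nat]].
Proof.
split; first by exists (rnorm (val z 0)); exists 0.
have /bounded_seqP[M zM] := valP z.
by exists M => _ [n _ <-]; rewrite -lecR -rnormE.
Qed.

Definition linfty_norm (z : linfty) : R[i] :=
  (sup [set rnorm (val z n) | n in [set: nat]])%:C.

Let linfty_norm_ge (z : linfty) n :
  rnorm (val z n) <= sup [set rnorm (val z n) | n in [set: nat]].
Proof. by apply: ub_le_sup; [exact: (linfty_bounded z).2|exists n]. Qed.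

Let linfty_norm_le (z : linfty) M : (forall n, rnorm (val z n) <= M) ->
  sup [set rnorm (val z n) | n in [set: nat]] <= M.
Proof.
by move=> zM; apply: ge_sup; [exact: (linfty_bounded z).1|move=> _ [n _ <-]].
Qed.

Let linfty_normD x y : linfty_norm (x + y) <= linfty_norm x + linfty_norm y.
Proof.
rewrite -rmorphD lecR; apply: linfty_norm_le => n /=.
by rewrite (le_trans (rnormD _ _)) // lerD ?linfty_norm_ge.
Qed.

Let linfty_normZ a x : linfty_norm (a *: x) = `|a| * linfty_norm x.
Proof.
have le b (y : linfty) : sup [set rnorm (val (b *: y) n) | n in [set: nat]] <=
    normc b * sup [set rnorm (val y n) | n in [set: nat]].
  apply: linfty_norm_le => n /=.
  rewrite rnormZ ler_wpM2l ?linfty_norm_ge //.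
  by case: (b) => ? ? /=; exact: sqrtr_ge0.
have -> : `|a| = (normc a)%:C by rewrite normc_def; case: (a).
rewrite -rmorphM; congr (_%:C); apply/eqP; rewrite eq_le le /=.
have [->|a0] := eqVneq a 0.
  rewrite normc0 mul0r; apply: le_trans (linfty_norm_ge (0 *: x) 0).
  exact: rnorm_ge0.
have na : 0 < normc a.
  rewrite lt_neqAle eq_sym; apply/andP; split.
    by apply: contra_neq a0 => /eq0_normc.
  by case: (a) => ? ? /=; exact: sqrtr_ge0.
have := le a^-1 (a *: x).
by rewrite scalerA mulVf // scale1r normcV ler_pdivlMl.
Qed.

Let linfty_norm0_eq0 x : linfty_norm x = 0 -> x = 0.
Proof.
move=> /complexI x0; apply/val_inj/funext => n /=; apply: rnorm_eq0.
by apply: le_anti; rewrite rnorm_ge0 andbT -[leRHS]x0; exact: linfty_norm_ge.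
Qed.

HB.instance Definition _ := Lmodule_isNormed.Build R[i] linfty
  linfty_normD linfty_normZ linfty_norm0_eq0.

End Linfty.

Section Operators.
Variables (R : realType) (V W : normedModType R[i]).
Implicit Types f : V -> W.

Definition bounded_op f := exists M : R, forall x, rnorm (f x) <= M * rnorm x.

(* Meaningful for bounded operators only, since [sup] is 0 on unbounded sets. *)
Definition opnorm f : R := sup [set rnorm (f x) | x in [set x | rnorm x <= 1]].

(* [g] is the inverse of [f] on the range of [f]; it is arbitrary elsewhere. *)
Definition embedding f := bounded_op f /\
  exists2 g : W -> V, cancel f g & {within range f, continuous g}.

Definition projection f := bounded_op f /\ range f = setT.

End Operators.

(* Main.v *)
(* An operator on [l^p] is, up to a small error, a multiple [c] of the identity
   on the span of some subsequence of the unit vectors, because these and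
   their biorthogonal functionals are weakly null ([1 < p]).  As [L^p] contains
   [l^p] on disjoint arcs, complemented by a norm-one projection, the same
   holds on every coordinate of [l^infty(L^p)]; one of [|c| >= 1/2] and
   [|1 - c| >= 1/2] occurs on infinitely many coordinates, which selects [H].
   A functional on [l^infty] that is bounded by [K] is bounded by [K / 2] on
   one of any two disjoint sets of coordinates, so thinning out the coordinates
   makes the interaction between different blocks negligible, and a Neumann
   series shows that the [l^infty]-sum of the spaces [l^p_(2^j)] factors
   through [H].

   The identity of [l^infty(L^p)] factors in turn through this sum: a function
   is sent to its dyadic conditional expectations, and is recovered as the
   limit of the bounded dyadic martingale formed by the ultralimits of the
   dyadic coefficients.  This martingale converges by uniform convexity:
   its norms increase, and the midpoint of two of its terms has norm at least
   that of the earlier one. *)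

From HB Require Import structures.
Require Import Defs.
From mathcomp Require Import all_boot all_order all_algebra.
From mathcomp Require Import complex.
From mathcomp Require Import all_classical all_reals all_analysis.
From mathcomp Require Import measurable_realfun.
From mathcomp Require Import ring lra.

Set Implicit Arguments.
Unset Strict Implicit.
Unset Printing Implicit Defensive.

Import Order.TTheory GRing.Theory Num.Theory.
Import Normc numFieldNormedType.Exports.

Local Open Scope classical_set_scope.
Local Open Scope ring_scope.

(** * Uniform convexity of the p-th power of the modulus *)

(** The bound obtained is 4 for every [p]: the embedding has norm at most 1, and the projection is a
    product of three operators of norms at most 1, 2 and 2. One 2 comes from dividing by diagonal
    values of modulus at least 1/2, the other from inverting the identity plus an operator of norm
    at most 1/2.

    The obstacle is that a bounded functional on [linfty V] is not determined by its values on
    finitely supported sequences. The influence of later coordinates can therefore not be tested on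
    unit vectors; it is reduced by discarding coordinates, for finitely many functionals at a time.
    This is why the blocks have finite dimension [2 ^ j]: each has finitely many coefficient
    functionals to be shielded from the later blocks, and spans finitely many vectors against which
    the later blocks are chosen.

    One free ultrafilter provides the diagonal values, the choice between [T] and its complement,
    and the weak limits. No subsequence is extracted to obtain a limit, and the weak limits depend
    linearly on the sequence. *)

Section PowerInequalities.
Context {R : realType}.
Implicit Types (p x y t u : R) (a b : R[i]).

Lemma ge0_normc a : 0 <= normc a.
Proof. by case: a => ? ? /=; exact: sqrtr_ge0. Qed.
Hint Resolve ge0_normc : core.

(** Young's inequality for the product [t * 1] with exponents [p] and [p / (p - 1)], solved for the
    [p]-th power of [t]. *)
Lemma bernoulli_powR p t : 1 < p -> 0 <= t -> 1 + p * (t - 1) <= t `^ p.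
Proof.
move=> p1 t0; have p0 : 0 < p by rewrite (lt_trans _ p1).
have q0 : 0 < p / (p - 1) by rewrite divr_gt0 // subr_gt0.
have pq : p^-1 + (p / (p - 1))^-1 = 1 by field; apply/andP; lra.
have := conjugate_powR t0 ler01 p0 q0 pq.
rewrite powR1 mulr1 mul1r => h.
have -> : 1 + p * (t - 1) = p * (t - (p / (p - 1))^-1).
  by field; apply/andP; lra.
by rewrite mulrC -ler_pdivlMr // lerBlDr.
Qed.

(* The gain comes from squaring Bernoulli's inequality for
   [Num.sqrt (1 + x)]. *)
Lemma powR_midpoint_gap p x : 1 < p -> 0 <= x <= 1 ->
  1 + p * (p - 1) / 18 * x ^+ 2 <= ((1 + x) `^ p + (1 - x) `^ p) / 2.
Proof.
move=> p1 /andP[x0 x1]; have p0 : 0 < p by rewrite (lt_trans _ p1).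
have h1 : 1 + p * (1 - x - 1) <= (1 - x) `^ p.
  by apply: bernoulli_powR => //; lra.
have x10 : 0 <= 1 + x by lra.
set s := Num.sqrt (1 + x).
have s2 : s ^+ 2 = 1 + x by rewrite sqr_sqrtr.
have s0 : 0 <= s by exact: sqrtr_ge0.
have s1 : 1 <= s by rewrite -sqrtr1 ler_wsqrtr //; lra.
have h2 : 1 + p * (s - 1) <= s `^ p by exact: bernoulli_powR.
have h3 : (1 + p * (s - 1)) ^+ 2 <= (1 + x) `^ p.
  have -> : (1 + x) `^ p = (s `^ p) ^+ 2.
    rewrite -s2 -(powR_mulrn 2 s0) -(powR_mulrn 2 (powR_ge0 s p)) -!powRrM.
    by rewrite [in RHS]mulrC.
  by rewrite lerXn2r ?nnegrE ?powR_ge0 // addr_ge0 // mulr_ge0 ?subr_ge0 // ltW.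
(* The 3 comes from [s + 1 <= 3]; squaring turns it into 9, and taking the mean of the two powers
   into the 18 of the statement. *)
have h4 : x / 3 <= s - 1.
  have x_eq : x = (s - 1) * (s + 1) by rewrite -subr_sqr s2 expr1n addrC addKr.
  have s_le2 : s <= 2 by rewrite -(ler_pXn2r (_ : 0 < 2)%N) ?nnegrE // s2; lra.
  rewrite ler_pdivrMr // x_eq ler_wpM2l ?subr_ge0 //; lra.
have h5 : x ^+ 2 / 9 <= (s - 1) ^+ 2.
  rewrite (_ : x ^+ 2 / 9 = (x / 3) ^+ 2); last by field.
  by rewrite lerXn2r ?nnegrE // ?subr_ge0 // divr_ge0.
have pp : 0 <= p * (p - 1) by rewrite mulr_ge0 ?subr_ge0 // ltW.
have h6 := ler_wpM2l pp h5.
have e : x = (s - 1) ^+ 2 + 2 * (s - 1) by rewrite -[x](addKr 1) -s2; ring.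
have e1 : p * (1 - x - 1) = - (p * (s - 1) ^+ 2 + 2 * p * (s - 1)).
  by rewrite [in LHS]e; ring.
have e2 : (1 + p * (s - 1)) ^+ 2 = p * (p - 1) * (s - 1) ^+ 2 +
  p * (s - 1) ^+ 2 + 2 * p * (s - 1) + 1 by ring.
rewrite e2 in h3; rewrite e1 in h1.
have -> : p * (p - 1) / 18 * x ^+ 2 = p * (p - 1) * (x ^+ 2 / 9) / 2 by field.
lra.
Qed.

(** Bernoulli's inequality at [x / s] and [y / s], with [s] the mean: the linear terms cancel
    because the two ratios add up to 2. *)
Lemma powR_mean x y p : 1 < p -> 0 <= x -> 0 <= y ->
  ((x + y) / 2) `^ p <= (x `^ p + y `^ p) / 2.
Proof.
move=> p1 x0 y0; have p0 : 0 < p by rewrite (lt_trans _ p1).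
set s := (x + y) / 2; have [s0|s0] := leP s 0.
  have -> : s = 0 by apply/le_anti; rewrite s0 /= /s; lra.
  by rewrite powR0 ?gt_eqF // divr_ge0 // addr_ge0 // powR_ge0.
have powRs z : 0 <= z -> z `^ p = s `^ p * (z / s) `^ p.
  move=> z0; have zs : 0 <= z / s by apply: divr_ge0 => //; exact: ltW.
  by rewrite -(powRM _ (ltW s0) zs) [s * _]mulrC divfK // gt_eqF.
rewrite (powRs x) // (powRs y) //.
have := bernoulli_powR p1 (divr_ge0 x0 (ltW s0)).
have := bernoulli_powR p1 (divr_ge0 y0 (ltW s0)).
have e : x / s + y / s = 2 by rewrite /s in s0 *; field; lra.
have := powR_gt0 p s0.
move: (s `^ p) ((x / s) `^ p) ((y / s) `^ p) => S X Y S0 hy hx.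
have XY : 2 <= X + Y.
  have : p * (x / s - 1) + p * (y / s - 1) = 0.
    have -> : p * (x / s - 1) + p * (y / s - 1) = p * (x / s + y / s - 2) by ring.
    by rewrite e subrr mulr0.
  lra.
rewrite -mulrDr -mulrA; apply: ler_peMr; [exact: ltW|lra].
Qed.

(** This is [powR_midpoint_gap] at [d / s], rescaled by [s]. The factor [s ^+ 2] on the right
    replaces a division on the left, so that [s = 0] is covered. *)
Lemma powR_mean_gap p x y : 1 < p -> 0 <= x -> 0 <= y ->
  let s := (x + y) / 2 in let d := (x - y) / 2 in
  p * (p - 1) / 18 * s `^ p * d ^+ 2 <=
  ((x `^ p + y `^ p) / 2 - s `^ p) * s ^+ 2.
Proof.
move=> p1 x0 y0; cbv zeta; set s := (x + y) / 2; set d := (x - y) / 2.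
have p0 : 0 < p by rewrite (lt_trans _ p1).
have [s0|s0] := leP s 0.
  have s_eq0 : s = 0 by apply/le_anti; rewrite s0 /= /s; lra.
  by rewrite s_eq0 powR0 ?gt_eqF // mulr0 mul0r expr0n /= mulr0.
have gap t : -1 <= t <= 1 ->
    1 + p * (p - 1) / 18 * t ^+ 2 <= ((1 + t) `^ p + (1 - t) `^ p) / 2.
  move=> /andP[tN1 t1]; have [t0|/ltW t0] := leP 0 t.
    by apply: powR_midpoint_gap => //; rewrite t0.
  have tN : 0 <= - t <= 1 by rewrite oppr_ge0 t0 lerNl.
  by have := powR_midpoint_gap p1 tN; rewrite sqrrN opprK [(1 - t) `^ p + _]addrC.
have ds : -1 <= d / s <= 1.
  by rewrite ler_pdivlMr // ler_pdivrMr // /d /s; apply/andP; lra.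
have := gap _ ds.
have [ds0 ds1] := andP ds.
have sd : s * (d / s) = d by rewrite mulrC divfK // gt_eqF.
have -> : x `^ p = s `^ p * (1 + d / s) `^ p.
  rewrite -powRM ?(ltW s0) //; last lra.
  by rewrite mulrDr sd mulr1; congr (_ `^ _); rewrite /s /d; lra.
have -> : y `^ p = s `^ p * (1 - d / s) `^ p.
  rewrite -powRM ?(ltW s0) //; last lra.
  by rewrite mulrBr sd mulr1; congr (_ `^ _); rewrite /s /d; lra.
have -> : d ^+ 2 = (d / s) ^+ 2 * s ^+ 2.
  by rewrite -exprMn divfK // gt_eqF.
have := powR_gt0 p s0; have := exprn_gt0 2 s0.
move: (s `^ p) ((1 + _) `^ p) ((1 - _) `^ p) (s ^+ 2) => S X Y Q Q0 S0 h.
rewrite mulrA ler_pM2r //.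
set c := p * (p - 1) / 18 in h *.
nra.
Qed.

Lemma normc_parallelogram a b :
  normc (a + b) ^+ 2 + normc (a - b) ^+ 2 = 2 * (normc a ^+ 2 + normc b ^+ 2).
Proof.
case: a => a1 a2; case: b => b1 b2 /=.
by rewrite !sqr_sqrtr ?addr_ge0 ?sqr_ge0 //; ring.
Qed.

(** By the parallelogram identity, the square of [normc (a - b) / 2] is the sum of [d ^+ 2], due to
    different moduli, and [s ^+ 2 - u ^+ 2], due to different arguments. The first part is paid for
    by [powR_mean_gap], the second by the bound [Su] on the [p]-th power of [u], with constant
    1/2. *)
Lemma powR_normc_gap p a b : 1 < p ->
  let s := (normc a + normc b) / 2 in
  Num.min 2^-1 (p * (p - 1) / 18) * s `^ p * (normc (a - b) / 2) ^+ 2 <=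
  ((normc a `^ p + normc b `^ p) / 2 - (normc (a + b) / 2) `^ p) * s ^+ 2.
Proof.
move=> p1; cbv zeta; set s := (normc a + normc b) / 2.
have p0 : 0 < p by rewrite (lt_trans _ p1).
have := powR_mean_gap p1 (ge0_normc a) (ge0_normc b).
rewrite /= -/s; set d := (_ - _) / 2 => h.
set u := normc (a + b) / 2; set v := normc (a - b) / 2.
have us : u <= s by rewrite /u /s ler_pM2r ?invr_gt0 // le_normcD.
have u0 : 0 <= u by rewrite divr_ge0.
have e : v ^+ 2 = d ^+ 2 + (s ^+ 2 - u ^+ 2).
  have := normc_parallelogram a b; rewrite /v /d /s /u.
  by move: (normc _) (normc _) (normc _) (normc _) => A B C D; nra.
have s0 : 0 <= s by rewrite divr_ge0 // addr_ge0.
have Su : u `^ p <= u * s `^ (p - 1).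
  rewrite -(mulr_powRB1 u0 p0) ler_wpM2l // ge0_ler_powR ?nnegrE //.
  by rewrite subr_ge0 ltW.
have eS : s `^ p = s * s `^ (p - 1) by rewrite mulr_powRB1.
have h2 : 2^-1 * s `^ p * (s ^+ 2 - u ^+ 2) <= (s `^ p - u `^ p) * s ^+ 2.
  apply: (@le_trans _ _ ((s - u) * s `^ (p - 1) * s ^+ 2)); last first.
    by rewrite ler_wpM2r ?sqr_ge0 // mulrBl -eS lerB.
  rewrite eS; have := powR_ge0 s (p - 1).
  move: (s `^ (p - 1)) => S S0.
  suff : 0 <= (S * s) * ((s - u) * (s - u)) by nra.
  by apply: mulr_ge0; apply: mulr_ge0 => //; rewrite subr_ge0.
set c1 := p * (p - 1) / 18 in h *; set c := Num.min _ _.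
have c1h : c <= c1 by rewrite ge_min lexx orbT.
have c2h : c <= 2^-1 by rewrite ge_min lexx.
have SS := powR_ge0 s p.
rewrite e mulrDr.
have h3 : c * s `^ p * d ^+ 2 <= c1 * s `^ p * d ^+ 2.
  by rewrite ler_wpM2r ?sqr_ge0 // ler_wpM2r.
have h4 : c * s `^ p * (s ^+ 2 - u ^+ 2) <= 2^-1 * s `^ p * (s ^+ 2 - u ^+ 2).
  apply: ler_wpM2r; last by rewrite ler_wpM2r.
  by rewrite subr_ge0 lerXn2r ?nnegrE.
move: (s `^ p) (u `^ p) (_ ^+ 2) (_ ^+ 2) (_ ^+ 2) h h2 h3 h4 => S U D1 S2 U2.
lra.
Qed.

(** This additive form can be summed over the coefficients of a martingale. If [normc (a - b)] is
    small relative to [s], the first term suffices, with [h] such that the [p]-th power of [2 * h]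
    is [e]; otherwise the convexity gap takes over. *)
Lemma powR_normc_uniformly_convex p (e : R) : 1 < p -> 0 < e ->
  exists2 C : R, 0 <= C & forall a b,
    normc (a - b) `^ p <= e * (normc a `^ p + normc b `^ p) +
      C * ((normc a `^ p + normc b `^ p) / 2 - (normc (a + b) / 2) `^ p).
Proof.
move=> p1 e0; have p0 : 0 < p by rewrite (lt_trans _ p1).
pose c := Num.min 2^-1 (p * (p - 1) / 18).
have c0 : 0 < c.
  by rewrite lt_min invr_gt0 ltr0n /= divr_gt0 // mulr_gt0 // subr_gt0.
pose h := e `^ p^-1 / 2.
have h0 : 0 < h by rewrite divr_gt0 // powR_gt0.
have hp : 2 `^ p * h `^ p = e.
  rewrite -powRM ?(ltW h0) // /h mulrCA divff // mulr1 -powRrM mulVf ?gt_eqF //.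
  by rewrite powRr1 // ltW.
pose C := 2 `^ p / (c * h ^+ 2).
have C0 : 0 <= C by rewrite divr_ge0 ?powR_ge0 // mulr_ge0 ?sqr_ge0 // ltW.
exists C => // a b.
have := powR_normc_gap a b p1; rewrite /= -/c.
set s := (_ + _) / 2; set G := (_ + _) / 2 - _; set v := normc (a - b) / 2.
move=> gap.
have s0 : 0 <= s by rewrite divr_ge0 // addr_ge0.
have v0 : 0 <= v by rewrite divr_ge0.
have vs : v <= s.
  rewrite /v /s ler_pM2r ?invr_gt0 //.
  by rewrite (le_trans (le_normcD _ _)) // normcN.
have G0 : 0 <= G.
  rewrite /G subr_ge0 (le_trans _ (powR_mean p1 _ _)) //.
  rewrite ge0_ler_powR ?nnegrE ?divr_ge0 ?addr_ge0 // ?(ltW p0) //.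
  by rewrite ler_pM2r ?invr_gt0 // le_normcD.
have -> : normc (a - b) `^ p = 2 `^ p * v `^ p.
  by rewrite -powRM // /v mulrCA divff // mulr1.
have [vhs|hsv] := leP v (h * s).
  apply: (@le_trans _ _ (e * (normc a `^ p + normc b `^ p))); last first.
    by rewrite lerDl mulr_ge0.
  rewrite -hp -mulrA ler_wpM2l ?powR_ge0 //.
  apply: (@le_trans _ _ ((h * s) `^ p)).
    by apply: ge0_ler_powR; rewrite ?nnegrE ?(ltW p0) //; exact: mulr_ge0 (ltW h0) s0.
  rewrite powRM ?(ltW h0) // ler_wpM2l ?powR_ge0 //.
  apply: (le_trans (powR_mean p1 _ _)) => //.
  rewrite ler_pdivrMr // ler_peMr ?addr_ge0 ?powR_ge0 //.
  by rewrite ler1n.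
apply: (@le_trans _ _ (C * G)); last first.
  by rewrite lerDr mulr_ge0 ?addr_ge0 ?powR_ge0 // ltW.
have sp : 0 < s.
  rewrite lt_neqAle s0 andbT; apply/eqP => se.
  by move: hsv vs; rewrite -se mulr0 => /lt_le_trans h1 /h1; rewrite ltxx.
rewrite /C -!mulrA ler_wpM2l ?powR_ge0 // mulrC ler_pdivlMr; last first.
  by rewrite mulr_gt0 // exprn_gt0.
have vp : v `^ p <= s `^ p by rewrite ge0_ler_powR ?nnegrE // ltW.
rewrite -(ler_pM2r (exprn_gt0 2 sp)); apply: le_trans gap.
rewrite mulrC; apply: (@le_trans _ _ (s ^+ 2 * (s `^ p * (c * h ^+ 2)))).
  by rewrite ler_wpM2l ?sqr_ge0 // ler_wpM2r // mulr_ge0 ?sqr_ge0 // ltW.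
rewrite (_ : s ^+ 2 * _ = c * s `^ p * (h * s) ^+ 2); last by ring.
rewrite ler_wpM2l //; first by rewrite mulr_ge0 ?powR_ge0 // ltW.
rewrite lerXn2r ?nnegrE ?(ltW hsv) //; exact: mulr_ge0 (ltW h0) s0.
Qed.

Lemma powR_normcD p a b : 1 < p ->
  normc (a + b) `^ p <= 2 `^ (p - 1) * (normc a `^ p + normc b `^ p).
Proof.
move=> p1; have p0 : 0 < p by rewrite (lt_trans _ p1).
have := powR_mean p1 (ge0_normc a) (ge0_normc b).
have h : normc (a + b) `^ p <= (normc a + normc b) `^ p.
  by rewrite ge0_ler_powR ?nnegrE ?addr_ge0 ?(ltW p0) // le_normcD.
rewrite powRM ?addr_ge0 // ?invr_ge0 //.
have -> : 2^-1 `^ p = (2 `^ (p - 1))^-1 / 2 :> R.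
  rewrite -{1}(@powR_inv1 R 2) // -powRrM mulN1r powRN.
  by rewrite -(@mulr_powRB1 R 2 p) // invfM mulrC.
rewrite mulrA ler_pM2r // ler_pdivrMr ?powR_gt0 // [X in _ <= X -> _]mulrC.
exact: le_trans.
Qed.

End PowerInequalities.

(** * Bounded sequences and Neumann series *)

Section NormcTheory.
Context {R : realType}.
Implicit Types (x y : R) (a b : R[i]).

Lemma normc_real x : normc x%:C%C = `|x|.
Proof. by rewrite /= expr0n /= addr0 sqrtr_sqr. Qed.

Lemma normc_sum (I : Type) (s : seq I) (P : pred I) (F : I -> R[i]) :
  normc (\sum_(i <- s | P i) F i) <= \sum_(i <- s | P i) normc (F i).
Proof.
elim/big_rec2: _ => [|i x a _ h]; first by rewrite normc0.
by rewrite (le_trans (le_normcD _ _)) // lerD2l.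
Qed.

Lemma normc_distC a b : normc (a - b) = normc (b - a).
Proof. by rewrite -normcN opprB. Qed.

Lemma normc_le_ReIm a :
  normc a <= `|complex.Re a| + `|complex.Im a|.
Proof.
case: a => x y /=; rewrite -ler_sqr ?nnegrE ?sqrtr_ge0 ?addr_ge0 //.
rewrite sqr_sqrtr ?addr_ge0 ?sqr_ge0 // sqrrD !real_normK ?num_real //.
by rewrite lerD2r lerDl mulrn_wge0 // mulr_ge0.
Qed.

Lemma normc_ge_absRe a : `|complex.Re a| <= normc a.
Proof.
case: a => x y /=; rewrite -sqrtr_sqr ler_wsqrtr // lerDl sqr_ge0 //.
Qed.

Lemma normc_ge_absIm a : `|complex.Im a| <= normc a.
Proof.
case: a => x y /=; rewrite -sqrtr_sqr ler_wsqrtr // lerDr sqr_ge0 //.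
Qed.

Lemma normc_phase a : exists2 u : R[i], normc u = 1 & u * a = (normc a)%:C%C.
Proof.
have [->|a0] := eqVneq a 0.
  by exists 1; rewrite ?normc1 // normc0 mulr0.
have na0 : normc a != 0 by apply: contra_neq a0 => /eq0_normc.
exists ((normc a)%:C%C / a); last by rewrite divfK.
by rewrite normcM normcV normc_real ger0_norm ?ge0_normc // divff.
Qed.

End NormcTheory.

Section RnormTheory.
Context {R : realType} {V : normedModType R[i]}.
Implicit Types x y : V.

Lemma rnorm0 : rnorm (0 : V) = 0.
Proof. by rewrite /rnorm normr0. Qed.

Lemma rnormN x : rnorm (- x) = rnorm x.
Proof. by rewrite /rnorm normrN. Qed.

Lemma rnorm_distC x y : rnorm (x - y) = rnorm (y - x).
Proof. by rewrite -rnormN opprB. Qed.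

Lemma rnorm_sum (I : Type) (s : seq I) (P : pred I) (F : I -> V) :
  rnorm (\sum_(i <- s | P i) F i) <= \sum_(i <- s | P i) rnorm (F i).
Proof.
elim/big_rec2: _ => [|i x v _ h]; first by rewrite rnorm0.
by rewrite (le_trans (rnormD _ _)) // lerD2l.
Qed.

Lemma rnormB x y : rnorm (x - y) <= rnorm x + rnorm y.
Proof. by rewrite (le_trans (rnormD _ _)) // rnormN. Qed.

Lemma rnorm_le_eps_eq0 x : (forall e, 0 < e -> rnorm x <= e) -> x = 0.
Proof.
move=> h; apply: rnorm_eq0; apply/le_anti; rewrite rnorm_ge0 andbT.
by apply/ler_addgt0Pr => e e0; rewrite add0r h.
Qed.

(** Stated with the real-valued norm, because the norm of the module takes values in [R[i]]. *)
Definition rcomplete := forall x : nat -> V,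
  (forall e, 0 < e -> exists N, forall m n, (N <= m)%N -> (N <= n)%N ->
     rnorm (x m - x n) <= e) ->
  exists l, forall e, 0 < e -> exists N, forall n, (N <= n)%N ->
     rnorm (x n - l) <= e.

End RnormTheory.
Arguments rcomplete {R} V.

Section LinftyTheory.
Context {R : realType} {V : normedModType R[i]}.
Local Notation W := (linfty V).
Implicit Types w : W.

Lemma linfty_rnormE w : rnorm w = sup [set rnorm (val w n) | n in [set: nat]].
Proof. by []. Qed.

Lemma linfty_ge w n : rnorm (val w n) <= rnorm w.
Proof.
by rewrite linfty_rnormE; apply: ub_le_sup; [exact: (linfty_bounded w).2|exists n].
Qed.

Lemma linfty_le w M : (forall n, rnorm (val w n) <= M) -> rnorm w <= M.
Proof.
move=> wM; rewrite linfty_rnormE.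
by apply: ge_sup; [exact: (linfty_bounded w).1|move=> _ [n _ <-]].
Qed.

Lemma linfty_ext w1 w2 : (forall n, val w1 n = val w2 n) -> w1 = w2.
Proof. by move=> h; apply/val_inj/funext. Qed.

Lemma linfty_valD w1 w2 n : val (w1 + w2) n = val w1 n + val w2 n.
Proof. by []. Qed.

Lemma linfty_valB w1 w2 n : val (w1 - w2) n = val w1 n - val w2 n.
Proof. by []. Qed.

Lemma linfty_valZ a w n : val (a *: w) n = a *: val w n.
Proof. by []. Qed.

Lemma linfty_val_sum (I : Type) (s : seq I) (P : pred I) (F : I -> W) n :
  val (\sum_(i <- s | P i) F i) n = \sum_(i <- s | P i) val (F i) n.
Proof. by elim/big_rec2: _ => // i v w _ <-. Qed.

Lemma linfty_ex (z : nat -> V) M : (forall n, rnorm (z n) <= M) ->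
  exists w : W, val w = z.
Proof.
move=> zM; have zb : z \in @bounded_seq R V.
  by apply/bounded_seqP; exists M => n; rewrite rnormE lecR.
by exists (exist _ z zb).
Qed.

Lemma linfty_complete : rcomplete V -> rcomplete W.
Proof.
move=> cV x xC.
have /choice[l lP] n : exists l : V, forall e, 0 < e -> exists N, forall m,
    (N <= m)%N -> rnorm (val (x m) n - l) <= e.
  apply: cV => e /xC[N NP]; exists N => i j Ni Nj.
  by apply: le_trans (NP _ _ Ni Nj); exact: (linfty_ge (x i - x j) n).
have uni e : 0 < e -> exists N, forall m n, (N <= m)%N ->
    rnorm (val (x m) n - l n) <= e.
  move=> e0; have [N NP] := xC _ e0; exists N => m n Nm.
  apply/ler_addgt0Pr => e' e'0.
  have [N' N'P] := lP n _ e'0.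
  rewrite -[val (x m) n](subrK (val (x (maxn N N')) n)) -addrA.
  apply: (le_trans (rnormD _ _)); apply: lerD.
    apply: le_trans (NP _ _ Nm (leq_maxl N N')).
    exact: (linfty_ge (x m - x _) n).
  by apply: N'P; exact: leq_maxr.
have [N NP] := uni _ ltr01.
have [w wE] : exists w : W, val w = l.
  apply: (@linfty_ex _ (rnorm (x N) + 1)) => n.
  rewrite -[l n](subrK (val (x N) n)) addrC (le_trans (rnormD _ _)) // lerD //.
    exact: linfty_ge.
  by rewrite rnorm_distC NP.
exists w => e /uni[N' N'P]; exists N' => n Nn.
by apply: linfty_le => k /=; rewrite wE; exact: N'P.
Qed.

End LinftyTheory.

Section LinearTheory.
Context {R : realType}.

Lemma linear_ex (V W : normedModType R[i]) (f : V -> W) :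
  linear f -> exists g : {linear V -> W}, forall x, g x = f x.
Proof.
move=> lf; pose m := GRing.isLinear.Build R[i] V W _ f lf.
by exists (HB.pack_for {linear V -> W} f m).
Qed.

Lemma linfty_op (U V : normedModType R[i]) (F : nat -> U -> V) K :
  (forall n, linear (F n)) -> (forall n x, rnorm (F n x) <= K * rnorm x) ->
  exists2 G : {linear U -> linfty V}, forall x n, val (G x) n = F n x &
    forall x, rnorm (G x) <= K * rnorm x.
Proof.
move=> lF bF.
have /choice[G GP] x : exists w : linfty V, val w = fun n => F n x.
  exact: (@linfty_ex _ _ _ (K * rnorm x)).
have [|g gE] := @linear_ex U (linfty V) G.
  by move=> a u v; apply: linfty_ext => n /=; rewrite !GP lF.
exists g => [x n|x]; first by rewrite gE GP.
by rewrite gE; apply: linfty_le => n; rewrite GP.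
Qed.

(** A Neumann series in which the lower bound [low] does all the work: it turns convergence of
    [u w n + S (u w n)] into convergence of [u w n], and it gives uniqueness of the solution, hence
    linearity, as well as the norm bound 2. *)
Lemma half_perturbation_inverse (W : normedModType R[i]) (S : {linear W -> W}) :
  rcomplete W -> (forall w, rnorm (S w) <= 2^-1 * rnorm w) ->
  exists2 K : {linear W -> W}, forall w, K (w + S w) = w &
    forall w, rnorm (K w) <= 2 * rnorm w.
Proof.
move=> cW Sh.
have low w : rnorm w <= 2 * rnorm (w + S w).
  have : rnorm w <= rnorm (w + S w) + rnorm (S w).
    by rewrite -{1}[w](addrK (S w)) rnormB.
  have := Sh w; lra.
pose S' w : W := - S w.
have S'h w : rnorm (S' w) <= 2^-1 * rnorm w by rewrite rnormN.
pose t w n := iter n S' w.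
pose u w n := \sum_(k < n) t w k.
have tB w n : rnorm (t w n) <= 2^-1 ^+ n * rnorm w.
  elim: n => [|n IH]; first by rewrite expr0 mul1r.
  apply: (le_trans (S'h _)); rewrite exprS -mulrA ler_wpM2l // invr_ge0 //.
have uS w n : u w n + S (u w n) = w - t w n.
  elim: n => [|n IH]; first by rewrite /u big_ord0 linear0 addr0 subrr.
  rewrite /u big_ord_recr -/(u w n) linearD addrACA IH.
  have -> : t w n.+1 = - S (t w n) by [].
  by rewrite opprK addrA subrK.
have small (r e : R) : 0 <= r -> 0 < e -> exists N, forall n, (N <= n)%N -> 2^-1 ^+ n * r <= e.
  move=> r0 e0; exists (Num.truncn (r / e)).+1 => n Nn.
  rewrite exprVn mulrC ler_pdivrMr ?exprn_gt0 // -ler_pdivrMl // mulrC.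
  have /ltW h := truncnS_gt (r / e); apply: (le_trans h).
  by rewrite -natrX ler_nat (leq_trans Nn) // ltnW // ltn_expl.
have /choice[K KP] w : exists v, v + S v = w.
  have kB x y : (x - y) + S (x - y) = (x + S x) - (y + S y).
    by rewrite linearB opprD addrACA.
  have [|l lP] := cW (u w).
    move=> e e0.
    have [N NP] := small (4 * rnorm w) e (mulr_ge0 (ler0n _ 4) (rnorm_ge0 w)) e0.
    exists N => m n Nm Nn; apply: (le_trans (low _)).
    rewrite kB !uS opprB addrC addrA subrK.
    have := rnormB (t w n) (t w m); have := tB w n; have := tB w m.
    have := NP _ Nm; have := NP _ Nn; rewrite !(mulrCA _ 4).
    by move: (2^-1 ^+ n * _) (2^-1 ^+ m * _) => *; lra.
  exists l; apply/eqP; rewrite -subr_eq0; apply/eqP/rnorm_le_eps_eq0 => e e0.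
  have e3 : 0 < e / 3 by rewrite divr_gt0.
  have [N NP] := small _ _ (rnorm_ge0 w) e3; have [N' N'P] := lP _ e3.
  pose n := maxn N N'.
  have -> : l + S l - w = (l - u w n) + S (l - u w n) - t w n.
    by rewrite kB uS opprB -[in RHS]addrA [t w n - w - _]addrAC subrr sub0r.
  have := rnormB ((l - u w n) + S (l - u w n)) (t w n).
  have := rnormD (l - u w n) (S (l - u w n)); have := Sh (l - u w n).
  have := N'P n (leq_maxr _ _); rewrite rnorm_distC.
  have := NP n (leq_maxl _ _); have := tB w n.
  move=> *; lra.
have Kb w : rnorm (K w) <= 2 * rnorm w by rewrite -{2}(KP w) low.
have inj v w : v + S v = w + S w -> v = w.
  move=> vw; apply/eqP; rewrite -subr_eq0; apply/eqP/rnorm_eq0/le_anti.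
  by rewrite rnorm_ge0 andbT (le_trans (low _)) // linearB addrACA -opprD vw subrr rnorm0 mulr0.
have [|G GK] := @linear_ex W W K.
  move=> a v w; apply: inj; rewrite KP linearP addrACA -scalerDr.
  by rewrite !KP.
by exists G => w; rewrite GK //; apply: inj; rewrite KP.
Qed.

End LinearTheory.

(** * Ultralimits and dyadic martingales *)

Section Ultralimits.
Context {R : realType} (U : set_system nat) (UF : UltraFilter U).
Hypothesis Ufree : forall n, U [set m | (n <= m)%N].

#[local] Instance Uproper : ProperFilter U.
Proof. exact: ultra_proper. Qed.

Definition is_ulim (z : nat -> R[i]) (c : R[i]) :=
  forall e : R, 0 < e -> U [set n | normc (z n - c) <= e].

(** The limit is the supremum of the levels that [u] attains or exceeds on a set of [U]. A level
    above the supremum is not of this kind, so, [U] being an ultrafilter, [u] stays below it on a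
    set of [U]. *)
Lemma real_ulim_ex (u : nat -> R) K : (forall n, `|u n| <= K) ->
  exists c, forall e, 0 < e -> U [set n | `|u n - c| <= e].
Proof.
move=> uK; pose S := [set r | U [set n | r <= u n]].
have SN : S (- K).
  by apply: filterS (filterT : U setT) => n _ /=; have := uK n; rewrite ler_norml => /andP[].
have SK : ubound S K.
  move=> r Sr; have [n /= rn] := filter_ex Sr.
  by apply: (le_trans rn); have := uK n; rewrite ler_norml => /andP[].
have hS : has_sup S by split; [exists (- K)|exists K].
exists (sup S) => e e0.
have h1 : U [set n | sup S - e <= u n].
  have [r Sr rS] := sup_adherent e0 hS.
  by apply: filterS Sr => n /= /(le_trans (ltW rS)).
have h2 : U [set n | u n <= sup S + e].
  have [Sc|] := @in_ultra_setVsetC _ _ [set n | sup S + e <= u n] UF.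
    by have := ub_le_sup hS.2 Sc; rewrite gerDl leNgt e0.
  by apply: filterS => n /= /negP; rewrite -ltNge => /ltW.
apply: filterS2 h1 h2 => n /= h1 h2.
by rewrite ler_norml; apply/andP; lra.
Qed.

Lemma ulim_ex (z : nat -> R[i]) K : (forall n, normc (z n) <= K) ->
  exists c, is_ulim z c.
Proof.
move=> zK.
have [|a aP] := @real_ulim_ex (fun n => complex.Re (z n)) K.
  by move=> n; rewrite (le_trans (normc_ge_absRe _)).
have [|b bP] := @real_ulim_ex (fun n => complex.Im (z n)) K.
  by move=> n; rewrite (le_trans (normc_ge_absIm _)).
exists (a +i* b)%C => e e0.
have e2 : 0 < e / 2 by rewrite divr_gt0.
apply: filterS2 (aP _ e2) (bP _ e2) => n /= ha hb.
apply: (le_trans (normc_le_ReIm _)); rewrite [leRHS]splitr lerD //.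
  by case: (z n) ha.
by case: (z n) hb.
Qed.

Lemma ulim_uniq z c c' : is_ulim z c -> is_ulim z c' -> c = c'.
Proof.
move=> zc zc'; apply/eqP; rewrite -subr_eq0; apply/eqP/eq0_normc/le_anti.
rewrite ge0_normc andbT; apply/ler_addgt0Pr => e e0; rewrite add0r.
have e2 : 0 < e / 2 by rewrite divr_gt0.
have [n [/= h h']] := filter_ex (filterI (zc _ e2) (zc' _ e2)).
rewrite [leRHS]splitr -(subrKA (z n)) (le_trans (le_normcD _ _)) // lerD //.
by rewrite normc_distC.
Qed.

Lemma ulim_lin a z z' c c' : is_ulim z c -> is_ulim z' c' ->
  is_ulim (fun n => a * z n + z' n) (a * c + c').
Proof.
move=> zc zc' e e0; pose d := e / (normc a + 1).
have a1 : 0 < normc a + 1 by rewrite ltr_wpDl // ge0_normc.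
have d0 : 0 < d by rewrite divr_gt0.
apply: filterS2 (zc _ d0) (zc' _ d0) => n /= h h'.
rewrite opprD addrACA -mulrBr (le_trans (le_normcD _ _)) // normcM.
rewrite (le_trans (lerD (ler_wpM2l (ge0_normc a) h) h')) //.
by rewrite -{2}[d]mul1r -mulrDl /d mulrC divfK // gt_eqF.
Qed.

Lemma ulim_cst c : is_ulim (fun=> c) c.
Proof.
move=> e e0; apply: filterS (filterT : U setT) => n _ /=.
by rewrite subrr normc0 ltW.
Qed.

Lemma ulim_eventually z z' c N : (forall n, (N <= n)%N -> z n = z' n) ->
  is_ulim z c -> is_ulim z' c.
Proof.
move=> zz' zc e e0; apply: filterS2 (zc _ e0) (Ufree N) => n /= h Nn.
by rewrite -zz'.
Qed.

End Ultralimits.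

Lemma free_ultrafilter : exists2 U : set_system nat, UltraFilter U &
  forall n, U [set m | (n <= m)%N].
Proof.
have [U [UU sub]] := @ultraFilterLemma nat \oo _.
by exists U => // n; apply: sub; exact: nbhs_infty_ge.
Qed.

(** * Biorthogonal systems of [l^p] type *)

Section LpSystems.
Context {R : realType} {V : normedModType R[i]} (p : R) (p1 : 1 < p).

(* Biorthogonal vectors and functionals spanning an isometric copy of
   [l^p] that is complemented by a norm-one projection. *)
Record lp_system (I : pred nat) (e : nat -> V) (f : nat -> V -> R[i]) : Prop := {
  lp_scalar : forall i, scalar (f i);
  lp_biorth : forall i j, I i -> f i (e j) = (i == j)%:R;
  lp_bessel : forall s x, uniq s ->
    \sum_(i <- s) normc (f i x) `^ p <= rnorm x `^ p;
  lp_synthesis : forall s v, uniq s ->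
    rnorm (\sum_(i <- s) v i *: e i) `^ p <= \sum_(i <- s) normc (v i) `^ p }.

Let p0 : 0 < p. Proof. by rewrite (lt_trans _ p1). Qed.

Lemma powR_le_cancel (x y : R) : 0 <= x -> 0 <= y -> x `^ p <= y `^ p -> x <= y.
Proof.
move=> x0 y0; apply: contraTT; rewrite -!ltNge => xy.
by apply: gt0_ltr_powR; rewrite ?nnegrE.
Qed.

Lemma le_powR (x y : R) : 0 <= x -> x <= y -> x `^ p <= y `^ p.
Proof.
by move=> x0 xy; apply: ge0_ler_powR; rewrite ?nnegrE ?(ltW p0) // (le_trans x0).
Qed.

Section OneSystem.
Context I e f (L : lp_system I e f).

Lemma lp_linear i x y a : f i (a *: x + y) = a * f i x + f i y.
Proof. exact: (lp_scalar L i a x y). Qed.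

Lemma lp_0 i : f i 0 = 0.
Proof.
by have := lp_linear i 0 0 (-1); rewrite scaler0 addr0 mulN1r addNr.
Qed.

Lemma lp_D i x y : f i (x + y) = f i x + f i y.
Proof. by rewrite -{1}[x]scale1r lp_linear mul1r. Qed.

Lemma lp_Z i a x : f i (a *: x) = a * f i x.
Proof. by rewrite -{1}[a *: x]addr0 lp_linear lp_0 addr0. Qed.

Lemma lp_B i x y : f i (x - y) = f i x - f i y.
Proof. by rewrite lp_D -scaleN1r lp_Z mulN1r. Qed.

Lemma lp_sum (T : Type) (s : seq T) (P : pred T) i (F : T -> V) :
  f i (\sum_(t <- s | P t) F t) = \sum_(t <- s | P t) f i (F t).
Proof. by apply: big_morph; [exact: lp_D|exact: lp_0]. Qed.

Lemma lp_coef_le i x : normc (f i x) <= rnorm x.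
Proof.
apply: powR_le_cancel; rewrite ?ge0_normc ?rnorm_ge0 //.
by have := @lp_bessel _ _ _ L [:: i] x isT; rewrite big_seq1.
Qed.

Lemma lp_unit_le i : rnorm (e i) <= 1.
Proof.
apply: powR_le_cancel; rewrite ?rnorm_ge0 //.
have := @lp_synthesis _ _ _ L [:: i] (fun=> 1) isT.
by rewrite !big_seq1 scale1r normc1.
Qed.

Lemma lp_coef_sum s v i : uniq s -> i \in s -> I i ->
  f i (\sum_(j <- s) v j *: e j) = v i.
Proof.
move=> us si Ii; rewrite lp_sum (bigD1_seq i) //= lp_Z (lp_biorth L) //.
rewrite eqxx mulr1 big1 ?addr0 // => j ji.
by rewrite lp_Z (lp_biorth L) // eq_sym (negbTE ji) mulr0.
Qed.

Lemma lp_comp (g : nat -> nat) (J : pred nat) : injective g -> (forall i, J i -> I (g i)) ->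
  lp_system J (e \o g) (fun i => f (g i)).
Proof.
move=> gI JI; split=> [i||s x us|s v us].
- exact: (lp_scalar L).
- by move=> i j Ji; rewrite /= (lp_biorth L) ?JI // (inj_eq gI).
- rewrite -(big_map g predT (fun j => normc (f j x) `^ p)).
  by apply: (lp_bessel L); rewrite map_inj_uniq.
(* The left inverse of [g] transports the coefficients [v] to the indices [g i], as the synthesis
   inequality requires. *)
have [h hK] : exists h, forall i, h (g i) = i.
  have /choice[h hP] j : exists i, forall k, g k = j -> k = i.
    have [[i gi]|n] := pselect (exists i, g i = j).
      by exists i => k; rewrite -gi => /gI.
    by exists 0%N => k gk; case: n; exists k.
  by exists h => i; rewrite -(hP (g i) i).
have := @lp_synthesis _ _ _ L (map g s) (v \o h).
rewrite map_inj_uniq // => /(_ us); rewrite !big_map.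
by under eq_bigr do rewrite /= hK; under [X in _ <= X -> _]eq_bigr do rewrite /= hK.
Qed.

End OneSystem.

Lemma sum_nat_double (M : nmodType) n (F : nat -> M) :
  \sum_(0 <= i < n.*2) F i = \sum_(0 <= i < n) (F i.*2 + F i.*2.+1).
Proof.
elim: n => [|n IH]; first by rewrite !big_nil.
by rewrite doubleS !big_nat_recr //= IH addrA.
Qed.

Section Dyadic.
(** The model is a dyadic set [A] of measure [m]: [d k a] is its indicator divided by [m ^ (1/p)],
    and [D k a] is integration over [A] multiplied by [m ^ (1/p - 1)]. Halving [A] produces the
    powers of 2 in the two refinement hypotheses. *)
Context (d : nat -> nat -> V) (D : nat -> nat -> V -> R[i]).
Hypothesis dL : forall k, lp_system (fun a => (a < 2 ^ k)%N) (d k) (D k).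
Hypothesis D_refine : forall k a x, (a < 2 ^ k)%N ->
  D k a x = (2 `^ (p^-1 - 1))%:C%C * (D k.+1 a.*2 x + D k.+1 a.*2.+1 x).
Hypothesis d_refine : forall k a, (a < 2 ^ k)%N ->
  d k a = (2 `^ (- p^-1))%:C%C *: (d k.+1 a.*2 + d k.+1 a.*2.+1).
Hypothesis D_total : forall x, (forall k a, (a < 2 ^ k)%N -> D k a x = 0) -> x = 0.
Hypothesis cV : rcomplete V.

Definition dyadic_proj k x := \sum_(0 <= a < 2 ^ k) D k a x *: d k a.

Lemma dyadic_proj_coef k a x : (a < 2 ^ k)%N -> D k a (dyadic_proj k x) = D k a x.
Proof.
move=> ak; rewrite /dyadic_proj (lp_coef_sum (dL k)) ?iota_uniq //.
by rewrite mem_index_iota.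
Qed.

Lemma dyadic_proj_le k x : rnorm (dyadic_proj k x) <= rnorm x.
Proof.
apply: powR_le_cancel; rewrite ?rnorm_ge0 //.
by apply: (le_trans (lp_synthesis (dL k) _ _) (lp_bessel (dL k) _ _));
  exact: iota_uniq.
Qed.

Lemma dyadic_proj_unit k l a : (k <= l)%N -> (a < 2 ^ k)%N ->
  dyadic_proj l (d k a) = d k a.
Proof.
move=> /subnKC <-; move: (l - k)%N => m {l}.
elim: m k a => [|m IH] k a ak.
  rewrite addn0 /dyadic_proj (bigD1_seq a) ?iota_uniq ?mem_index_iota //=.
  rewrite (lp_biorth (dL k)) // eqxx scale1r big1_seq ?addr0 // => b /andP[ba].
  rewrite mem_index_iota => bk.
  by rewrite (lp_biorth (dL k)) // (negbTE ba) scale0r.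
have projD x y : dyadic_proj (k + m.+1) (x + y) =
    dyadic_proj (k + m.+1) x + dyadic_proj (k + m.+1) y.
  rewrite -big_split; apply: eq_bigr => b _.
  by rewrite (lp_D (dL _)) scalerDl.
have projZ c x : dyadic_proj (k + m.+1) (c *: x) = c *: dyadic_proj (k + m.+1) x.
  rewrite /dyadic_proj scaler_sumr; apply: eq_bigr => b _.
  by rewrite (lp_Z (dL _)) scalerA.
have lt1 : (a.*2 < 2 ^ k.+1)%N by rewrite expnS mul2n ltn_double.
have lt2 : (a.*2.+1 < 2 ^ k.+1)%N by rewrite expnS mul2n ltn_Sdouble.
rewrite [in RHS]d_refine // {1}d_refine // projZ projD.
by rewrite addnS -addSn !IH.
Qed.

(** The [p]-th power of the refinement factor cancels the constant in [powR_normcD]. It follows that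
    the energy of the coefficients grows with the level. *)
Lemma D_refine_le k a x : (a < 2 ^ k)%N ->
  normc (D k a x) `^ p <=
  normc (D k.+1 a.*2 x) `^ p + normc (D k.+1 a.*2.+1 x) `^ p.
Proof.
move=> ak; rewrite D_refine // normcM normc_real ger0_norm ?powR_ge0 //.
rewrite powRM ?powR_ge0 ?ge0_normc // -powRrM.
have -> : (p^-1 - 1) * p = - (p - 1) by rewrite mulrBl mulVf ?gt_eqF // mul1r opprB.
by rewrite powRN mulrC ler_pdivrMr ?powR_gt0 // mulrC powR_normcD.
Qed.

Lemma dyadic_energy_le k l x : (k <= l)%N ->
  \sum_(0 <= a < 2 ^ k) normc (D k a x) `^ p <=
  \sum_(0 <= a < 2 ^ l) normc (D l a x) `^ p.
Proof.
move=> /subnKC <-; elim: (l - k)%N => [|m IH]; first by rewrite addn0.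
apply: (le_trans IH); rewrite addnS expnS mul2n sum_nat_double.
rewrite big_nat [leRHS]big_nat; apply: ler_sum => a /= ak.
exact: D_refine_le.
Qed.

Section WeakLimit.
Context (U : set_system nat) (UF : UltraFilter U).
Hypothesis Ufree : forall n, U [set m | (n <= m)%N].
Context (z : nat -> V) (K : R) (zK : forall n, rnorm (z n) <= K).

Let K0 : 0 <= K. Proof. by rewrite (le_trans (rnorm_ge0 (z 0))). Qed.

(* The martingale of the limits of the dyadic coefficients is bounded, hence
   Cauchy by uniform convexity. *)
Lemma dyadic_wlim_ex : exists2 x, rnorm x <= K & forall k a, (a < 2 ^ k)%N ->
  is_ulim U (fun n => D k a (z n)) (D k a x).
Proof.
have UP : ProperFilter U by exact: ultra_proper.
have /choice[al alP] k : exists al, forall a, is_ulim U (fun n => D k a (z n)) (al a).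
  have /choice[al alP] a : exists c, is_ulim U (fun n => D k a (z n)) c.
    by apply: (ulim_ex UF (K := K)) => n; rewrite (le_trans (lp_coef_le (dL k) _ _)).
  by exists al.
pose x k := \sum_(0 <= a < 2 ^ k) al k a *: d k a.
have Dx k a : (a < 2 ^ k)%N -> D k a (x k) = al k a.
  by move=> ak; rewrite (lp_coef_sum (dL k)) ?iota_uniq ?mem_index_iota.
have al_refine k a : (a < 2 ^ k)%N ->
    al k a = (2 `^ (p^-1 - 1))%:C%C * (al k.+1 a.*2 + al k.+1 a.*2.+1).
  move=> ak; apply: (ulim_uniq UF (alP k a)).
  pose c := (2 `^ (p^-1 - 1))%:C%C : R[i].
  have h := ulim_lin UF c (alP k.+1 a.*2) (ulim_cst UF 0).
  have := ulim_lin UF c (alP k.+1 a.*2.+1) h; rewrite addr0 addrC -mulrDr.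
  apply: (ulim_eventually UF Ufree (N := 0%N)) => n _.
  by rewrite [in RHS]D_refine // addr0 addrC -mulrDr.
have Dxl k l a : (k <= l)%N -> (a < 2 ^ k)%N -> D k a (x l) = al k a.
  move=> /subnKC <-; move: (l - k)%N => m {l}.
  elim: m k a => [|m IH] k a ak; first by rewrite addn0 Dx.
  have lt1 : (a.*2 < 2 ^ k.+1)%N by rewrite expnS mul2n ltn_double.
  have lt2 : (a.*2.+1 < 2 ^ k.+1)%N by rewrite expnS mul2n ltn_Sdouble.
  by rewrite D_refine // addnS -addSn !IH // -al_refine.
have xK k : rnorm (x k) <= K.
  apply/ler_addgt0Pr => e e0; pose c := e / (2 ^ k)%:R.
  have c0 : 0 < c by rewrite divr_gt0 // ltr0n expn_gt0.
  (* Only finitely many limits [al k a] occur at level [k], so a single [n] approximates all of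
     them, and [x k] is close to a projection of [z n]. *)
  have : U [set n | forall a, (a < 2 ^ k)%N -> normc (D k a (z n) - al k a) <= c].
    elim: (2 ^ k)%N => [|m IH]; first by apply: filterS (filterT : U setT).
    apply: filterS2 IH (alP k m _ c0) => n /= h1 h2 a.
    by rewrite ltnS leq_eqVlt => /predU1P[->|/h1].
  move=> /filter_ex[n /= hn].
  have -> : x k = dyadic_proj k (z n) + (x k - dyadic_proj k (z n)).
    by rewrite addrC subrK.
  apply: (le_trans (rnormD _ _)); apply: lerD.
    by rewrite (le_trans (dyadic_proj_le _ _)).
  rewrite -sumrB; apply: (le_trans (rnorm_sum _ _ _)).
  apply: (@le_trans _ _ (\sum_(0 <= a < 2 ^ k) c)).
    rewrite big_nat [leRHS]big_nat; apply: ler_sum => a /= /hn han.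
    rewrite -scalerBl rnormZ -[leRHS]mulr1; apply: ler_pM; rewrite ?ge0_normc ?rnorm_ge0 //.
      by rewrite normc_distC.
    exact: lp_unit_le (dL k) a.
  by rewrite sumr_const_nat subn0 -(mulr_natr c) /c divfK // gt_eqF // ltr0n expn_gt0.
pose N k := \sum_(0 <= a < 2 ^ k) normc (al k a) `^ p.
have NE k l : (k <= l)%N -> \sum_(0 <= a < 2 ^ k) normc (D k a (x l)) `^ p = N k.
  by move=> kl; apply: eq_big_nat => a /= ak; rewrite Dxl.
have NK k : N k <= K `^ p.
  rewrite -(NE k k) // (le_trans (lp_bessel (dL k) _ _)) ?iota_uniq //.
  by apply: le_powR; rewrite ?rnorm_ge0.
have Nmono k l : (k <= l)%N -> N k <= N l.
  by move=> kl; rewrite -(NE k l kl) -(NE l l (leqnn _)) dyadic_energy_le.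
have xE k l : (k <= l)%N -> dyadic_proj l (x k) = x k.
  move=> kl; rewrite {1}/dyadic_proj.
  under eq_bigr do rewrite (lp_sum (dL l)) scaler_suml.
  rewrite exchange_big; apply: eq_big_nat => a /= ak.
  under eq_bigr do rewrite (lp_Z (dL l)) -scalerA.
  by rewrite -scaler_sumr -/(dyadic_proj l (d k a)) dyadic_proj_unit.
have xB k l : (k <= l)%N -> rnorm (x k - x l) `^ p <=
    \sum_(0 <= a < 2 ^ l) normc (D l a (x k) - al l a) `^ p.
  move=> kl.
  have -> : x k - x l = \sum_(0 <= a < 2 ^ l) (D l a (x k) - al l a) *: d l a.
    rewrite -{1}(xE k l kl) /dyadic_proj -sumrB.
    by apply: eq_bigr => a _; rewrite scalerBl.
  by apply: (lp_synthesis (dL l)); exact: iota_uniq.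
have mid k l : (k <= l)%N ->
    N k <= \sum_(0 <= a < 2 ^ l) (normc (D l a (x k) + al l a) / 2) `^ p.
  (* [x k] and [x l] have the same coefficients of level [k], and so has their midpoint [y]; passing
     to level [l] only increases its energy. *)
  move=> kl; pose y := (2^-1 : R)%:C%C *: (x k + x l).
  have -> : N k = \sum_(0 <= a < 2 ^ k) normc (D k a y) `^ p.
    apply: eq_big_nat => a /= ak; rewrite (lp_Z (dL k)) (lp_D (dL k)) !Dxl //.
    rewrite normcM normc_real ger0_norm ?invr_ge0 // -mulr2n normcMn.
    by rewrite -(mulr_natl (normc _)) mulrA mulVf // mul1r.
  apply: (le_trans (dyadic_energy_le y kl)).
  rewrite big_nat [leRHS]big_nat; apply: ler_sum => a /= al'.
  rewrite (lp_Z (dL l)) (lp_D (dL l)) (Dx l) // normcM normc_real.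
  by rewrite ger0_norm ?invr_ge0 // mulrC.
have xC e : 0 < e -> exists k0, forall k l, (k0 <= k)%N -> (k0 <= l)%N ->
    rnorm (x k - x l) <= e.
  move=> e0.
  have Kp0 : 0 < K `^ p + 1 by rewrite ltr_wpDl // powR_ge0.
  have ep0 : 0 < e `^ p by rewrite powR_gt0.
  (* [h] bounds the first term of the uniform convexity inequality by half of the [p]-th power of
     [e], and [g] bounds the second by a quarter of it. *)
  pose h := e `^ p / 4 / (K `^ p + 1).
  have h0 : 0 < h by rewrite !divr_gt0.
  have [C C0 uc] := @powR_normc_uniformly_convex R p h p1 h0.
  pose g := e `^ p / (2 * (C + 1)).
  have C1 : 0 < C + 1 by rewrite ltr_wpDl.
  have g0 : 0 < g by rewrite divr_gt0 // mulr_gt0.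
  have [k0 k0P] : exists k0, forall l, (k0 <= l)%N -> N l - N k0 <= g.
    have hS : has_sup (range N).
      by split; [exists (N 0%N), 0%N|exists (K `^ p) => _ [k _ <-]].
    have [_ [k0 _ <-] hk] := sup_adherent g0 hS.
    exists k0 => l k0l; have := ub_le_sup hS.2 (ex_intro2 _ _ l I erefl); lra.
  have key k l : (k0 <= k)%N -> (k <= l)%N -> rnorm (x k - x l) <= e.
    move=> k0k kl; apply: powR_le_cancel; rewrite ?rnorm_ge0 ?(ltW e0) //.
    apply: (le_trans (xB _ _ kl)).
    apply: (@le_trans _ _ (h * (N k + N l) + C * ((N k + N l) / 2 - N k))).
      pose B := \sum_(0 <= a < 2 ^ l) normc (D l a (x k)) `^ p.
      have BN : B <= N k.
        apply: (le_trans (lp_bessel (dL l) _ _)); rewrite ?iota_uniq //.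
        by apply: (lp_synthesis (dL k)); exact: iota_uniq.
      pose M := \sum_(0 <= a < 2 ^ l) (normc (D l a (x k) + al l a) / 2) `^ p.
      apply: (@le_trans _ _ (h * (B + N l) + C * ((B + N l) / 2 - M))).
        rewrite /B /N /M -big_split /= mulr_sumr mulr_suml -sumrB mulr_sumr -big_split /=.
        by apply: ler_sum => a _; exact: uc.
      apply: lerD; first by rewrite ler_wpM2l ?(ltW h0) // lerD2r.
      by rewrite ler_wpM2l // lerB ?mid // ler_pM2r ?invr_gt0 // lerD2r.
    have Nkl := k0P _ (leq_trans k0k kl); have Nk0 := Nmono _ _ k0k.
    apply: (@le_trans _ _ (h * (2 * (K `^ p + 1)) + C * (g / 2))).
      apply: lerD; first by rewrite ler_wpM2l ?(ltW h0) //; have := NK k; have := NK l; lra.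
      by rewrite ler_wpM2l //; lra.
    have -> : h * (2 * (K `^ p + 1)) = e `^ p / 2.
      by rewrite /h mulrCA -!mulrA mulVf ?gt_eqF // mulr1; lra.
    have : C * (g / 2) <= (C + 1) * (g / 2).
      by rewrite ler_wpM2r ?lerDl // divr_ge0 // ltW.
    have -> : (C + 1) * (g / 2) = e `^ p / 4.
      by rewrite /g; field; rewrite gt_eqF.
    by move: ep0; lra.
  exists k0 => k l k0k k0l; have [kl|/ltnW lk] := leqP k l; first exact: key.
  by rewrite rnorm_distC key.
have [lim limP] := cV xC.
exists lim.
  apply/ler_addgt0Pr => e /limP[k0 /(_ _ (leqnn _))]; rewrite rnorm_distC => h.
  by rewrite -[lim](subrK (x k0)) addrC (le_trans (rnormD _ _)) // lerD.
move=> k a ak; have -> : D k a lim = al k a; last exact: alP.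
apply/eqP; rewrite -subr_eq0; apply/eqP/eq0_normc/le_anti.
rewrite ge0_normc andbT; apply/ler_addgt0Pr => e e0; rewrite add0r.
have [k0 /(_ _ (leq_maxl k0 k))] := limP _ e0; rewrite rnorm_distC.
apply: le_trans; rewrite -(Dxl k (maxn k0 k)) ?leq_maxr // -(lp_B (dL k)).
exact: lp_coef_le (dL k) _ _.
Qed.

End WeakLimit.
End Dyadic.
End LpSystems.

(** * Selection of coordinates *)

Section Selection.
Context {R : realType} {V : normedModType R[i]} (p : R) (p1 : 1 < p).
Context (U : set_system nat) (UF : UltraFilter U).
Hypothesis Ufree : forall n, U [set m | (n <= m)%N].
Context (e : nat -> V) (f : nat -> V -> R[i]).
Hypothesis eL : lp_system p xpredT e f.

Let p0 : 0 < p. Proof. by rewrite (lt_trans _ p1). Qed.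

#[local] Instance Uproper' : ProperFilter U.
Proof. exact: ultra_proper. Qed.

Lemma free_set_seq (A : set nat) n : U A ->
  exists s, [/\ uniq s, size s = n & forall a, a \in s -> A a].
Proof.
move=> UA; elim: n => [|n [s [us sn sA]]]; first by exists [::].
have [a [Aa /= na]] := filter_ex (filterI UA (Ufree (\max_(b <- s) b).+1)).
exists (a :: s); split=> [||b]; rewrite /= ?sn // ?us ?andbT.
  apply/negP => sa; have := @leq_bigmax_seq nat s xpredT id a sa isT.
  by rewrite leqNgt na.
by rewrite inE => /predU1P[->|/sA].
Qed.

(** Otherwise the complement belongs to [U], and a set of a free ultrafilter contains [n] distinct
    indices for every [n]. *)
Lemma ultra_le_of_bounded_count (g : nat -> R) (d : R) (n : nat) :
  (forall s, uniq s -> size s = n -> (forall a, a \in s -> d < g a) -> False) ->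
  U [set a | g a <= d].
Proof.
move=> h; have [//|Uc] := @in_ultra_setVsetC _ _ [set a | g a <= d] UF.
have [s [us sn sA]] := free_set_seq n Uc.
by case: (h s us sn) => a /sA /= /negP; rewrite -ltNge.
Qed.

(** By Bessel's inequality, the number of coefficients above [d] is at most the [p]-th power of
    [rnorm x / d]. *)
Lemma coef_small x d : 0 < d -> U [set a | normc (f a x) <= d].
Proof.
move=> d0; pose r := rnorm x `^ p / d `^ p.
apply: (@ultra_le_of_bounded_count _ _ (Num.truncn r).+1) => s us sn sd.
have dp : 0 < d `^ p by rewrite powR_gt0.
have := lp_bessel eL x us; apply/negP; rewrite -ltNge.
apply: (@lt_le_trans _ _ (\sum_(i <- s) d `^ p)).
  rewrite big_const_seq count_predT sn iter_addr_0 -(mulr_natl (_ `^ _)) -ltr_pdivrMr //.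
  exact: truncnS_gt.
rewrite big_seq [leRHS]big_seq; apply: ler_sum => a /sd h.
by apply: (le_powR p1); exact: ltW.
Qed.

(** If [n] unit vectors had values above [d], their sum [x], with phases aligned, would satisfy
    [n * d <= (B + 1) * rnorm x], while [rnorm x] is at most the [p]-th root of [n]. This bounds
    [n ^ (p - 1)], and here [1 < p] enters. *)
Lemma functional_small (phi : V -> R[i]) B d : scalar phi ->
  (forall x, normc (phi x) <= B * rnorm x) -> 0 < d ->
  U [set b | normc (phi (e b)) <= d].
Proof.
move=> lphi phiB d0; have [g gE] : exists g : {scalar V}, forall x, g x = phi x.
  pose m := GRing.isLinear.Build R[i] V R[i] _ phi lphi.
  by exists (HB.pack_for {scalar V} phi m).
have B0 : 0 <= B + 1.
  have := phiB (e 0); have := lp_biorth eL (i := 0) 0 isT; rewrite eqxx => fe.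
  have : 1 <= rnorm (e 0).
    by have := lp_coef_le p1 eL 0 (e 0); rewrite fe normc1.
  have := ge0_normc (phi (e 0)); nra.
pose r := ((B + 1) / d) `^ p.
pose n := (Num.truncn (r `^ (p - 1)^-1)).+1.
apply: (@ultra_le_of_bounded_count _ _ n) => s us sn sd.
have /choice[u uP] b : exists u, normc u = 1 /\ u * phi (e b) = (normc (phi (e b)))%:C%C.
  by have [u] := normc_phase (phi (e b)); exists u.
pose x := \sum_(b <- s) u b *: e b.
have n0 : 0 < n%:R :> R by rewrite ltr0n.
have xn : rnorm x `^ p <= n%:R.
  apply: (le_trans (lp_synthesis eL u us)).
  under eq_bigr do rewrite (uP _).1 powR1.
  by rewrite big_const_seq count_predT sn iter_addr_0.
have low : n%:R * d <= (B + 1) * rnorm x.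
  apply: (@le_trans _ _ (normc (phi x))); last first.
    by rewrite (le_trans (phiB _)) // ler_wpM2r ?rnorm_ge0 // lerDl.
  rewrite -gE linear_sum /=; under eq_bigr do rewrite linearZ /= gE (uP _).2.
  rewrite -rmorph_sum normc_real ger0_norm ?sumr_ge0 // => [|b _]; last exact: ge0_normc.
  rewrite mulr_natl -sn -(count_predT s) -iter_addr_0 -big_const_seq.
  by rewrite big_seq [leRHS]big_seq; apply: ler_sum => b /sd /ltW.
have : n%:R `^ p <= r * n%:R.
  apply: (@le_trans _ _ (((B + 1) / d * rnorm x) `^ p)).
    apply: (le_powR p1); first exact: ltW.
    by rewrite mulrAC ler_pdivlMr.
  rewrite powRM ?rnorm_ge0 //; last by rewrite divr_ge0 // ltW.
  by rewrite ler_wpM2l ?powR_ge0.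
rewrite -(mulr_powRB1 (ltW n0) p0) mulrC ler_pM2r //; apply/negP; rewrite -ltNge.
have p10 : 0 < p - 1 by rewrite subr_gt0.
rewrite -[r]powRr1 ?powR_ge0 // -[X in r `^ X](mulVf (lt0r_neq0 p10)) powRrM.
by apply: gt0_ltr_powR; rewrite ?nnegrE ?powR_ge0 // truncnS_gt.
Qed.

(* Weak nullity of the unit vectors makes the matrix of [T] small off the
   diagonal along a subsequence. *)
Lemma diagonal_subsequence (T : V -> V) B c (hs : seq V) d :
  linear T -> (forall x, rnorm (T x) <= B * rnorm x) ->
  is_ulim U (fun a => f a (T (e a))) c -> 0 < d ->
  exists i : nat -> nat, [/\ injective i,
    forall a b, normc (f (i a) (T (e (i b))) - c * (a == b)%:R) <= d &
    forall a h, h \in hs -> normc (f (i a) h) <= d].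
Proof.
move=> lT TB cP d0.
pose good (s : seq nat) a := [/\ a \notin s,
  normc (f a (T (e a)) - c) <= d,
  forall b, b \in s -> normc (f a (T (e b))) <= d /\ normc (f b (T (e a))) <= d &
  forall h, h \in hs -> normc (f a h) <= d].
have all_small (I : eqType) (s : seq I) (P : I -> set nat) :
    (forall b, b \in s -> U (P b)) -> U [set a | forall b, b \in s -> P b a].
  elim: s => [|b s IH] sP; first by apply: filterS (filterT : U setT).
  have h1 := sP b (mem_head _ _).
  have h2 := IH (fun b' sb' => sP b' (@mem_behead _ (b :: s) b' sb')).
  apply: filterS2 h1 h2 => a /= h1 h2 b'.
  by rewrite inE => /predU1P[->|/h2].
(* Each requirement on [a] holds on a set of [U]: the entries [f a (T (e b))] are small by
   [coef_small], the entries [f b (T (e a))] by [functional_small] applied to the composite of [f b]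
   and [T], and the diagonal entry is near [c] by the choice of [c]. *)
have /choice[F FP] s : exists a, good s a.
  have h1 := Ufree (\max_(b <- s) b).+1.
  have h2 : U [set a | forall b, b \in s ->
      normc (f a (T (e b))) <= d /\ normc (f b (T (e a))) <= d].
    apply: all_small => b _; apply: filterI; first exact: coef_small.
    apply: (@functional_small (fun x => f b (T x)) B) => //.
      by move=> k x y; rewrite lT (lp_scalar eL).
    by move=> x; rewrite (le_trans (lp_coef_le p1 eL _ _)).
  have h3 := all_small _ hs _ (fun h _ => coef_small h d0).
  have [a [[/= na h] [sa hsa]]] := filter_ex (filterI (filterI h1 (cP _ d0)) (filterI h2 h3)).
  exists a; split => //; apply/negP => ha.
  have := @leq_bigmax_seq nat s xpredT id a ha isT.
  by rewrite leqNgt na.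
pose st k := iter k (fun s => rcons s (F s)) [::].
pose i k := F (st k).
have stE k : st k = mkseq i k.
  elim: k => [//|k IH].
  by rewrite /st iterS -/(st k) -/(i k) /mkseq -addn1 iotaD map_cat cats1 IH.
have lt_in a b : (a < b)%N -> i a \in st b.
  by move=> ab; rewrite stE; apply/mapP; exists a; rewrite ?mem_iota.
exists i; split.
- have lt_neq a b : (a < b)%N -> i a != i b.
    move=> /lt_in ab; apply/eqP => iab; have [+ _ _ _] := FP (st b).
    by rewrite -/(i b) -iab ab.
  move=> a b iab; apply/eqP; have [/lt_neq|/lt_neq|//] := ltngtP a b.
    by rewrite iab eqxx.
  by rewrite iab eqxx.
- move=> a b; have [ab|ba|<-] := ltngtP a b.
  + have [_ _ /(_ _ (lt_in _ _ ab))[_ h] _] := FP (st b).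
    by rewrite mulr0 subr0.
  + have [_ _ /(_ _ (lt_in _ _ ba))[h _] _] := FP (st a).
    by rewrite mulr0 subr0.
  + by have [_ h _ _] := FP (st a); rewrite mulr1.
- by move=> a h hh; have [_ _ _ /(_ _ hh)] := FP (st a).
Qed.

End Selection.

(** * Functionals on bounded sequences, restricted to subsets of coordinates *)

Section Shrinking.
Context {R : realType} {V : normedModType R[i]}.
Local Notation W := (linfty V).

Definition increasing_seqn (g : nat -> nat) := forall a b, (a < b)%N -> (g a < g b)%N.

Lemma increasing_seqn_inj g : increasing_seqn g -> injective g.
Proof.
move=> gi a b gab; apply/eqP.
by have [/gi|/gi|//] := ltngtP a b; rewrite gab ltnn.
Qed.

Lemma increasing_seqn_comp g h : increasing_seqn g -> increasing_seqn h ->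
  increasing_seqn (g \o h).
Proof. by move=> gi hi a b /hi/gi. Qed.

Lemma increasing_seqn_ge g a : increasing_seqn g -> (a <= g a)%N.
Proof.
move=> gi; elim: a => [//|a IH].
by apply: leq_ltn_trans IH _; exact: gi.
Qed.

Definition supported_on (s : nat -> nat) (w : W) :=
  forall n, (forall k, s k <> n) -> val w n = 0.

Lemma supported_on_comp s g w : supported_on (s \o g) w -> supported_on s w.
Proof. by move=> sw n sn; apply: sw => k; exact: sn. Qed.

(** If neither the even nor the odd part of [s] worked, there would be unit vectors [w1] and [w2]
    supported on them with real values [phi w1] and [phi w2] above [K / 2]. Their supports are
    disjoint, so [w1 + w2] has norm at most 1, but its value exceeds [K]. *)
Lemma functional_halving (phi : W -> R[i]) s (K : R) : scalar phi -> injective s ->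
  (forall w, supported_on s w -> normc (phi w) <= K * rnorm w) ->
  exists2 g, increasing_seqn g & forall w, supported_on (s \o g) w ->
    normc (phi w) <= K / 2 * rnorm w.
Proof.
move=> lphi sI phiK.
have [//|noE] := pselect (exists2 g, increasing_seqn g & forall w,
  supported_on (s \o g) w -> normc (phi w) <= K / 2 * rnorm w).
have phi0 : phi 0 = 0.
  by have := lphi (-1) 0 0; rewrite scaler0 addr0 mulN1r addNr.
have phiZ a w : phi (a *: w) = a * phi w.
  by have := lphi a w 0; rewrite !addr0 phi0 addr0.
have wit g : increasing_seqn g -> exists w, [/\ supported_on (s \o g) w,
    rnorm w = 1, phi w = (normc (phi w))%:C%C & K / 2 < normc (phi w)].
  move=> gi; have [w [sw hw]] : exists w, supported_on (s \o g) w /\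
      K / 2 * rnorm w < normc (phi w).
    apply: contrapT => h; apply: noE; exists g => // w sw.
    by rewrite leNgt; apply/negP => hw; apply: h; exists w.
  have w0 : 0 < rnorm w.
    rewrite lt_neqAle rnorm_ge0 andbT eq_sym; apply/eqP => /rnorm_eq0 w0.
    by move: hw; rewrite w0 rnorm0 mulr0 phi0 normc0 ltxx.
  have [u u1 uP] := normc_phase (phi w).
  pose r := (rnorm w)^-1%:C%C : R[i].
  have nr : normc r = (rnorm w)^-1.
    by rewrite normc_real ger0_norm // invr_ge0 ltW.
  have nphi : normc (phi (r * u *: w)) = (rnorm w)^-1 * normc (phi w).
    by rewrite phiZ !normcM nr u1 mulr1.
  exists (r * u *: w); split.
  - by move=> n sn; rewrite linfty_valZ sw // scaler0.
  - by rewrite rnormZ normcM nr u1 mulr1 mulVf // gt_eqF.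
  - by rewrite nphi phiZ -mulrA uP -rmorphM.
  - by rewrite nphi [_^-1 * normc _]mulrC ltr_pdivlMr.
have [|w1 [sw1 n1 r1 h1]] := wit double; first by move=> a b; rewrite ltn_double.
have [|w2 [sw2 n2 r2 h2]] := wit (fun k => k.*2.+1).
  by move=> a b; rewrite ltnS ltn_double.
have sw12 : supported_on s (w1 + w2).
  move=> n sn; rewrite linfty_valD (supported_on_comp sw1) // (supported_on_comp sw2) //.
  by rewrite addr0.
have n12 : rnorm (w1 + w2) <= 1.
  apply: linfty_le => n; rewrite linfty_valD.
  have [[k kn]|h] := pselect (exists k, s k.*2 = n).
    rewrite sw2 ?addr0 ?(le_trans (linfty_ge _ _)) ?n1 // => l /=.
    by rewrite -kn => /sI/(congr1 odd); rewrite /= !odd_double.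
  rewrite sw1 ?add0r ?(le_trans (linfty_ge _ _)) ?n2 // => l /= ln.
  by apply: h; exists l.
have K0 : 0 <= K.
  have := phiK w1 (supported_on_comp sw1); rewrite n1 mulr1.
  exact: le_trans (ge0_normc _).
have := phiK _ sw12.
have -> : phi (w1 + w2) = phi w1 + phi w2 by have := lphi 1 w1 w2; rewrite scale1r mul1r.
rewrite r1 r2 -rmorphD normc_real ger0_norm ?addr_ge0 ?ge0_normc // => h12.
have := ler_wpM2l K0 n12; rewrite mulr1 => /(le_trans h12).
lra.
Qed.

Lemma functional_shrinking (phi : W -> R[i]) s (K d : R) : scalar phi -> injective s ->
  (forall w, normc (phi w) <= K * rnorm w) -> 0 < d ->
  exists2 g, increasing_seqn g & forall w, supported_on (s \o g) w ->
    normc (phi w) <= d * rnorm w.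
Proof.
move=> lphi sI phiK d0.
have iterh n : exists2 g, increasing_seqn g & forall w, supported_on (s \o g) w ->
    normc (phi w) <= K / 2 ^+ n * rnorm w.
  elim: n => [|n [g gi gP]]; first by exists id => // w _; rewrite expr0 divr1.
  have sgI : injective (s \o g) by exact: inj_comp sI (increasing_seqn_inj gi).
  have [h hi hP] := functional_halving lphi sgI gP.
  exists (g \o h); first exact: increasing_seqn_comp.
  by move=> w sw; rewrite exprSr invfM mulrA hP.
have [g gi gP] := iterh (Num.truncn (`|K| / d)).+1.
exists g => // w /gP /le_trans; apply; rewrite ler_wpM2r ?rnorm_ge0 //.
rewrite ler_pdivrMr ?exprn_gt0 // (le_trans (ler_norm _)) // mulrC -ler_pdivrMr //.
rewrite (le_trans (ltW (truncnS_gt _))) // -natrX ler_nat ltnW // ltn_expl //.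
Qed.

Lemma functionals_shrinking (phi : nat -> W -> R[i]) M s (K d : R) :
  (forall a, scalar (phi a)) -> injective s ->
  (forall a w, normc (phi a w) <= K * rnorm w) -> 0 < d ->
  exists2 g, increasing_seqn g & forall a w, (a < M)%N -> supported_on (s \o g) w ->
    normc (phi a w) <= d * rnorm w.
Proof.
move=> lphi sI phiK d0; elim: M => [|M [g gi gP]]; first by exists id.
have sgI : injective (s \o g) by exact: inj_comp sI (increasing_seqn_inj gi).
have [h hi hP] := functional_shrinking (lphi M) sgI (phiK M) d0.
exists (g \o h); first exact: increasing_seqn_comp.
move=> a w; rewrite ltnS leq_eqVlt => /predU1P[->|aM] sw; first exact: hP.
by apply: gP => //; exact: (@supported_on_comp (s \o g) h).
Qed.

End Shrinking.

Lemma linfty_single (R : realType) (V : normedModType R[i]) :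
  exists2 iota : nat -> {linear V -> linfty V},
    forall s x n, val (iota s x) n = if n == s then x else 0 &
    forall s x, rnorm (iota s x) <= rnorm x.
Proof.
have /choice[io ioP] s : exists G : {linear V -> linfty V},
    (forall x n, val (G x) n = if n == s then x else 0) /\
    (forall x, rnorm (G x) <= rnorm x).
  have [||G GE Gb] := @linfty_op R V V (fun n x => if n == s then x else 0) 1.
  - by move=> n a x y; case: eqP => // _; rewrite scaler0 addr0.
  - by move=> n x; rewrite mul1r; case: eqP => // _; rewrite rnorm0 rnorm_ge0.
  by exists G; split => // x; rewrite -[leRHS]mul1r.
by exists io => s; have [] := ioP s.
Qed.

(** * Inductive choice of coordinates and blocks *)

Section Localization.
Context {R : realType} {V : normedModType R[i]} (p : R) (p1 : 1 < p).
Local Notation W := (linfty V).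
Context (U : set_system nat) (UF : UltraFilter U).
Hypothesis Ufree : forall n, U [set m | (n <= m)%N].
Context (e : nat -> V) (f : nat -> V -> R[i]).
Hypothesis eL : lp_system p xpredT e f.
Context (iota : nat -> {linear V -> W}).
Hypothesis iotaE : forall s x n, val (iota s x) n = if n == s then x else 0.
Hypothesis iota_le : forall s x, rnorm (iota s x) <= rnorm x.
Context (H : {linear W -> W}) (B : R).
Hypothesis HB : forall w, rnorm (H w) <= B * rnorm w.
Context (c : nat -> R[i]).
Hypothesis cP : forall s, is_ulim U (fun a => f a (val (H (iota s (e a))) s)) (c s).
Context (s0 : nat -> nat) (M : nat -> nat) (d : nat -> R).
Hypothesis s0_incr : increasing_seqn s0.
Hypothesis d_gt0 : forall j, 0 < d j.

Local Notation coef s i a w := (f (i a) (val (H w) s)).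

(** One step of the induction. Block [j] is placed on the coordinate [t 0], [i] selects its unit
    vectors, [hist] contains the vectors of the earlier blocks, and [t'] lists the coordinates left
    for the later ones; the [S] in [step_sub] drops [t 0]. *)
Record block_step (j : nat) (hist : seq W) (t : nat -> nat)
    (i : nat -> nat) (t' : nat -> nat) : Prop := {
  step_inj : injective i;
  step_diag : forall a b, normc (coef (t 0%N) i a (iota (t 0%N) (e (i b))) -
    c (t 0%N) * (a == b)%:R) <= d j;
  step_hist : forall a h, h \in hist -> normc (coef (t 0%N) i a h) <= d j;
  step_sub : exists2 g, increasing_seqn g & t' = t \o S \o g;
  step_tail : forall a w, (a < M j)%N -> supported_on t' w ->
    normc (coef (t 0%N) i a w) <= d j * rnorm w }.

Lemma coef_scalar s a : scalar (fun w => f a (val (H w) s)).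
Proof. by move=> k x y; rewrite linearP (lp_scalar eL). Qed.

Lemma coef_bound s a w : normc (f a (val (H w) s)) <= B * rnorm w.
Proof. by rewrite (le_trans (lp_coef_le p1 eL _ _)) // (le_trans (linfty_ge _ _)). Qed.

Lemma block_step_ex j hist t : increasing_seqn t ->
  exists i t', block_step j hist t i t'.
Proof.
move=> ti; set s := t 0%N.
have B0 : 0 <= B.
  have := HB (iota 0%N (e 0%N)); move/(le_trans (rnorm_ge0 _)).
  have /(lt_le_trans ltr01) : 1 <= rnorm (iota 0%N (e 0%N)).
    have := linfty_ge (iota 0%N (e 0%N)) 0; rewrite iotaE eqxx; apply: le_trans.
    by have := lp_coef_le p1 eL 0 (e 0%N); rewrite (lp_biorth eL) // eqxx normc1.
  by move=> h; rewrite pmulr_lge0.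
have [||||i [iI id ih]] := @diagonal_subsequence R V p p1 U UF Ufree e f eL
    (fun x => val (H (iota s x)) s) B (c s) [seq val (H h) s | h <- hist] (d j).
- by move=> k x y; rewrite !linearP.
- move=> x; rewrite (le_trans (linfty_ge _ _)) // (le_trans (HB _)) //.
  by rewrite ler_wpM2l.
- exact: cP.
- exact: d_gt0.
have tSI : injective (t \o S).
  by apply: increasing_seqn_inj; apply: increasing_seqn_comp => // a b; rewrite ltnS.
have [g gi gP] := @functionals_shrinking R V (fun a w => f (i a) (val (H w) s))
  (M j) (t \o S) B (d j) (fun a => coef_scalar s (i a)) tSI
  (fun a => coef_bound s (i a)) (d_gt0 j).
exists i, (t \o S \o g); split => //.
- by move=> a h hh; apply: ih; apply: map_f.
- by exists g.
Qed.

(** The two interaction bounds differ in kind. [loc_before] concerns the finitely many unit vectors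
    of earlier blocks, whereas [loc_after] is stated for every bounded sequence on the later
    coordinates, which in general is not a norm limit of finite sums. *)
Record localized (s : nat -> nat) (i : nat -> nat -> nat) : Prop := {
  loc_incr : increasing_seqn s;
  loc_sub : forall j, exists k, s j = s0 k;
  loc_inj : forall j, injective (i j);
  loc_diag : forall j a b, normc (coef (s j) (i j) a (iota (s j) (e (i j b))) -
    c (s j) * (a == b)%:R) <= d j;
  loc_before : forall l j a b, (l < j)%N -> (b < M l)%N ->
    normc (coef (s j) (i j) a (iota (s l) (e (i l b)))) <= d j;
  loc_after : forall j a w, (a < M j)%N ->
    (forall n, (forall k, (j < k)%N -> s k <> n) -> val w n = 0) ->
    normc (coef (s j) (i j) a w) <= d j * rnorm w }.

Lemma localized_ex : exists s i, localized s i.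
Proof.
have /choice[nxt nxtP] (st : nat * seq W * (nat -> nat)) :
    exists it : (nat -> nat) * (nat -> nat), increasing_seqn st.2 ->
      block_step st.1.1 st.1.2 st.2 it.1 it.2.
  have [ti|nti] := pselect (increasing_seqn st.2); last by exists (id, id).
  by have [i [t' h]] := block_step_ex st.1.1 st.1.2 ti; exists (i, t').
pose upd (st : nat * seq W * (nat -> nat)) :=
  (st.1.1.+1, st.1.2 ++ [seq iota (st.2 0%N) (e ((nxt st).1 b)) | b <- seq.iota 0 (M st.1.1)],
   (nxt st).2).
pose st j := iter j upd (0%N, [::], s0).
have stj j : (st j).1.1 = j by elim: j => [//|j IH]; rewrite /st iterS /= -/(st j) IH.
have sti j : increasing_seqn (st j).2.
  elim: j => [//|j IH]; rewrite /st iterS -/(st j) /=.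
  have [_ _ _ [g gi ->] _] := nxtP _ IH.
  by do 2?apply: increasing_seqn_comp => // a b; rewrite ltnS.
have stP j := nxtP (st j) (sti j).
pose s j := (st j).2 0%N; pose i j := (nxt (st j)).1.
have sub_step j : exists2 g, increasing_seqn g & (st j.+1).2 = (st j).2 \o S \o g.
  by have [_ _ _ h _] := stP j.
have sub_all j m n : exists k, (st (j + m)%N).2 n = (st j).2 k.
  elim: m n => [|m IH] n; first by exists n; rewrite addn0.
  have [g _ gE] := sub_step (j + m)%N.
  by rewrite addnS gE; have := IH (g n).+1.
have hist_in l j b : (l < j)%N -> (b < M l)%N -> iota (s l) (e (i l b)) \in (st j).1.2.
  move=> /subnKC <- bM; elim: (j - l.+1)%N => [|m IH].
    rewrite addn0 /st iterS -/(st l) /= mem_cat; apply/orP; right.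
    by apply/mapP; exists b; rewrite ?stj ?mem_iota.
  by rewrite addnS /st iterS -/(st (l.+1 + m)%N) /= mem_cat IH.
exists s, i; split.
- have lts j : (s j < s j.+1)%N.
    by have [g _ gE] := sub_step j; rewrite /s gE /=; exact: sti.
  move=> a b; exact: (homo_ltn ltn_trans lts).
- by move=> j; have [k] := sub_all 0%N j 0%N; rewrite add0n; exists k.
- by move=> j; exact: (step_inj (stP j)).
- by move=> j a b; have := step_diag (stP j) a b; rewrite stj.
- move=> l j a b lj bM.
  by have := step_hist (stP j) a (hist_in _ _ _ lj bM); rewrite stj.
- move=> j a w aM sw; have := @step_tail _ _ _ _ _ (stP j) a w; rewrite stj; apply => //.
  move=> n nn; apply: sw => k jk ks; have [k'] := sub_all j.+1 (k - j.+1)%N 0%N.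
  by rewrite subnKC // => E; apply: (nn k'); rewrite -ks /s E.
Qed.

End Localization.

(** * Factorization of the identity *)

Section Factorization.
Context {R : realType} {V : normedModType R[i]} (p : R) (p1 : 1 < p).
Local Notation W := (linfty V).
Context (e : nat -> V) (f : nat -> V -> R[i]).
Hypothesis eL : lp_system p xpredT e f.
Context (d : nat -> nat -> V) (D : nat -> nat -> V -> R[i]).
Hypothesis dL : forall k, lp_system p (fun a => (a < 2 ^ k)%N) (d k) (D k).
Hypothesis D_refine : forall k a x, (a < 2 ^ k)%N ->
  D k a x = (2 `^ (p^-1 - 1))%:C%C * (D k.+1 a.*2 x + D k.+1 a.*2.+1 x).
Hypothesis d_refine : forall k a, (a < 2 ^ k)%N ->
  d k a = (2 `^ (- p^-1))%:C%C *: (d k.+1 a.*2 + d k.+1 a.*2.+1).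
Hypothesis D_total : forall x, (forall k a, (a < 2 ^ k)%N -> D k a x = 0) -> x = 0.
Hypothesis cV : rcomplete V.

Let p0 : 0 < p. Proof. by rewrite (lt_trans _ p1). Qed.

Lemma dyadic_coef_proj k l a x : (k <= l)%N -> (a < 2 ^ k)%N ->
  D k a (dyadic_proj d D l x) = D k a x.
Proof.
move=> /subnKC <-; move: (l - k)%N => m {l}.
elim: m k a => [|m IH] k a ak; first by rewrite addn0 (dyadic_proj_coef dL).
have lt1 : (a.*2 < 2 ^ k.+1)%N by rewrite expnS mul2n ltn_double.
have lt2 : (a.*2.+1 < 2 ^ k.+1)%N by rewrite expnS mul2n ltn_Sdouble.
by rewrite D_refine // [in RHS]D_refine // addnS -addSn !IH.
Qed.

Lemma dyadic_proj_linear k : linear (dyadic_proj d D k).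
Proof.
move=> c x y; rewrite /dyadic_proj scaler_sumr -big_split; apply: eq_bigr => b _.
by rewrite (lp_linear (dL _)) scalerDl scalerA.
Qed.

Lemma sum_pow2 n : \sum_(0 <= l < n) (2 ^ l)%:R + 1 = (2 ^ n)%:R :> R.
Proof.
elim: n => [|n IH]; first by rewrite big_nil add0r.
by rewrite big_nat_recr //= addrAC IH expnS mul2n -addnn natrD.
Qed.

(** Every [k] has infinitely many preimages under [m]. Coordinate [k] is going to be repeated at all
    of them, so that its conditional expectations of arbitrarily high level are recorded. *)
Lemma nat_pairing : exists (m : nat -> nat) (j : nat -> nat -> nat),
  (forall k n, m (j k n) = k) /\ (forall k n, (n <= j k n)%N).
Proof.
exists (logn 2), (fun k n => 2 ^ k * n.*2.+1)%N; split=> k n.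
  rewrite lognM ?expn_gt0 // pfactorK // logn_coprime ?addn0 //.
  by rewrite coprime2n /= odd_double.
rewrite (leq_trans _ (leq_pmull _ _)) ?expn_gt0 // -addnn.
by rewrite (leq_trans (leq_addr n n)).
Qed.

Section Assembly.
Context (H : {linear W -> W}) (c : nat -> R[i]).
Context (iota : nat -> {linear V -> W}).
Hypothesis iotaE : forall s x n, val (iota s x) n = if n == s then x else 0.
Context (s0 s : nat -> nat) (i : nat -> nat -> nat).
Hypothesis c_large : forall j, 2^-1 <= normc (c (s j)).
(** The [2 ^ j.+1 - 1] vectors of the blocks up to [j], plus one share for the tail, turn this into
    [(4 * 2 ^ j)^-1]. Dividing by the diagonal value costs a factor 2, and summing over the [2 ^ j]
    coefficients of the block leaves 1/2 for the Neumann series. *)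
Let tol (j : nat) : R := (8 * (2 ^ j)%:R * (2 ^ j)%:R)^-1.
Hypothesis loc : localized e f iota H c s0 (expn 2) tol s i.

Let s_inj : injective s.
Proof. exact: increasing_seqn_inj (loc_incr loc). Qed.

Let eiL j : lp_system p xpredT (e \o i j) (fun a => f (i j a)).
Proof. exact: (lp_comp eL (loc_inj loc (j := j))). Qed.

(** The image of the level-[j] conditional expectation of [val w j] in the copy of [l^p_(2^j)]
    spanned by the [e (i j b)]; it will sit at coordinate [s j]. *)
Definition block j (w : W) : V := \sum_(0 <= b < 2 ^ j) D j b (val w j) *: e (i j b).

Lemma block_le j w : rnorm (block j w) <= rnorm w.
Proof.
apply: (powR_le_cancel p1); rewrite ?rnorm_ge0 //.
apply: (le_trans (lp_synthesis (eiL j) _ _)); rewrite ?iota_uniq //.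
apply: (le_trans (lp_bessel (dL j) _ _)); rewrite ?iota_uniq //.
by apply: (le_powR p1); rewrite ?rnorm_ge0 ?linfty_ge.
Qed.

Lemma block_linear j : linear (block j).
Proof.
move=> k x y; rewrite /block scaler_sumr -big_split; apply: eq_bigr => b _.
by rewrite linfty_valD linfty_valZ (lp_linear (dL j)) scalerDl scalerA.
Qed.

Lemma sum_index_inj (T : nmodType) (F : nat -> T) N j : (j < N)%N ->
  \sum_(0 <= l < N) (if s j == s l then F l else 0) = F j.
Proof.
move=> jN; rewrite (bigD1_seq j) ?iota_uniq ?mem_index_iota //= eqxx.
by rewrite big1 ?addr0 // => l lj; rewrite (inj_eq s_inj) eq_sym (negbTE lj).
Qed.

Lemma block_embedding : exists A : {linear W -> W},
  [/\ forall w j, val (A w) (s j) = block j w,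
    forall w n, (forall j, s j <> n) -> val (A w) n = 0 &
    forall w, rnorm (A w) <= rnorm w].
Proof.
(* The sum searches for the index [l] with [s l = n]; as [s] is increasing, [l <= n]. *)
pose F n (w : W) : V := \sum_(0 <= l < n.+1) (if n == s l then block l w else 0).
have Fs j w : F (s j) w = block j w.
  by rewrite /F sum_index_inj // ltnS increasing_seqn_ge //; exact: loc_incr loc.
have Fo n w : (forall j, s j <> n) -> F n w = 0.
  move=> sn; rewrite /F big1 // => l _; case: eqP => // nl.
  by case: (sn l).
have [||A AE Ab] := @linfty_op R W V F 1.
- move=> n k x y; rewrite /F scaler_sumr -big_split; apply: eq_bigr => l _ /=.
  by case: eqP => _; rewrite ?block_linear // scaler0 addr0.
- move=> n w; rewrite mul1r.
  have [[j <-]|nj] := pselect (exists j, s j = n); first by rewrite Fs block_le.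
  by rewrite Fo ?rnorm0 ?rnorm_ge0 // => j jn; apply: nj; exists j.
exists A; split => [w j|w n sn|w]; rewrite ?AE ?Fs ?Fo //.
by rewrite -[leRHS]mul1r.
Qed.

Context (A : {linear W -> W}).
Hypothesis A_in : forall w j, val (A w) (s j) = block j w.
Hypothesis A_out : forall w n, (forall j, s j <> n) -> val (A w) n = 0.

(** [A w] is split into the blocks up to [j], collected in [head], and the later ones. Each unit
    vector in [head] contributes an error of at most [tol j * rnorm w] by [loc_diag] or
    [loc_before], and [loc_after] bounds the whole tail by one further such term. *)
Lemma coef_block_embedding j a w : (a < 2 ^ j)%N ->
  normc (f (i j a) (val (H (A w)) (s j)) - c (s j) * D j a (val w j)) <=
  (4 * (2 ^ j)%:R)^-1 * rnorm w.
Proof.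
move=> aj; pose phi (w : W) := f (i j a) (val (H w) (s j)).
have phiD x y : phi (x + y) = phi x + phi y.
  by rewrite /phi linearD linfty_valD (lp_D eL).
have phi0 : phi 0 = 0 by rewrite /phi linear0 (lp_0 eL).
have phiZ k x : phi (k *: x) = k * phi x.
  by rewrite /phi linearZ linfty_valZ (lp_Z eL).
pose head := \sum_(0 <= l < j.+1) \sum_(0 <= b < 2 ^ l)
  D l b (val w l) *: iota (s l) (e (i l b)).
have headE n : val head n =
    \sum_(0 <= l < j.+1) (if n == s l then block l w else 0).
  rewrite linfty_val_sum; apply: eq_bigr => l _; rewrite linfty_val_sum.
  case: eqP => nl; last first.
    rewrite big1 // => b _; rewrite linfty_valZ iotaE.
    by case: eqP nl => // _ _; rewrite scaler0.
  by apply: eq_bigr => b _; rewrite linfty_valZ iotaE nl eqxx.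
have head_out n : (forall l, s l <> n) -> val head n = 0.
  move=> sn; rewrite headE big1 // => l _; case: eqP => // nl.
  by case: (sn l).
pose tail := A w - head.
have tail_supp n : (forall k, (j < k)%N -> s k <> n) -> val tail n = 0.
  move=> sn; rewrite linfty_valB.
  have [[k kn]|nk] := pselect (exists k, s k = n); last first.
    by rewrite A_out ?head_out ?subrr // => l ln; apply: nk; exists l.
  rewrite -kn A_in headE sum_index_inj ?subrr // ltnS leqNgt.
  by apply/negP => /sn.
have tail_le : rnorm tail <= rnorm w.
  apply: linfty_le => n.
  have [[k [jk kn]]|nk] := pselect (exists k, (j < k)%N /\ s k = n); last first.
    by rewrite tail_supp ?rnorm0 ?rnorm_ge0 // => k jk kn; apply: nk; exists k.
  rewrite linfty_valB -kn A_in headE big1_seq ?subr0 ?block_le // => l.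
  rewrite mem_index_iota /= ltnS => lj; case: eqP => // /s_inj kl.
  by move: jk; rewrite kl ltnNge lj.
pose tau l b := if l == j then c (s j) * (a == b)%:R else 0.
have near_tau l b : (l <= j)%N -> (b < 2 ^ l)%N ->
    normc (phi (iota (s l) (e (i l b))) - tau l b) <= tol j.
  rewrite /tau; case: eqP => [-> _ _|/eqP lj llj bl]; first exact: (loc_diag loc).
  by rewrite subr0; apply: (loc_before loc) => //; rewrite ltn_neqAle lj.
have -> : f (i j a) (val (H (A w)) (s j)) = phi head + phi tail.
  by rewrite -phiD /tail addrC subrK.
have phi_head : phi head = \sum_(0 <= l < j.+1) \sum_(0 <= b < 2 ^ l)
    D l b (val w l) * phi (iota (s l) (e (i l b))).
  rewrite /head (big_morph phi phiD phi0); apply: eq_bigr => l _.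
  by rewrite (big_morph phi phiD phi0); apply: eq_bigr => b _; rewrite phiZ.
have tauE : c (s j) * D j a (val w j) = \sum_(0 <= l < j.+1) \sum_(0 <= b < 2 ^ l)
    D l b (val w l) * tau l b.
  rewrite big_nat_recr //= big1_seq ?add0r => [|l]; last first.
    rewrite mem_index_iota /= => lj; rewrite big1 // => b _.
    by rewrite /tau ltn_eqF // mulr0.
  rewrite (bigD1_seq a) ?iota_uniq ?mem_index_iota //= /tau !eqxx mulr1 mulrC.
  by rewrite big1 ?addr0 // => b ba; rewrite eq_sym (negbTE ba) !mulr0.
have D_le l b : normc (D l b (val w l)) <= rnorm w.
  by rewrite (le_trans (lp_coef_le p1 (dL l) _ _)) // linfty_ge.
have head_near : normc (phi head - c (s j) * D j a (val w j)) <=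
    (\sum_(0 <= l < j.+1) (2 ^ l)%:R) * (tol j * rnorm w).
  rewrite phi_head tauE -sumrB mulr_suml (le_trans (normc_sum _ _ _)) //.
  rewrite big_nat [leRHS]big_nat; apply: ler_sum => l /=; rewrite ltnS => lj.
  rewrite -sumrB (le_trans (normc_sum _ _ _)) //.
  rewrite (_ : _ * _ = \sum_(0 <= b < 2 ^ l) (tol j * rnorm w)); last first.
    by rewrite sumr_const_nat subn0 mulr_natl.
  rewrite big_nat [leRHS]big_nat; apply: ler_sum => b /= bl.
  rewrite -mulrBr normcM mulrC ler_pM ?ge0_normc //; exact: near_tau.
rewrite addrAC (le_trans (le_normcD _ _)) //.
have tail_small : normc (phi tail) <= tol j * rnorm w.
  rewrite (le_trans (loc_after loc aj tail_supp)) // ler_wpM2l //.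
  by rewrite invr_ge0 !mulr_ge0.
apply: (le_trans (lerD head_near tail_small)).
rewrite -{2}[tol j * _]mul1r -mulrDl sum_pow2 mulrA ler_wpM2r ?rnorm_ge0 //.
rewrite /tol expnS natrM le_eqVlt; apply/orP; left; apply/eqP.
by field; rewrite pnatr_eq0 expn_eq0.
Qed.

(** An approximate inverse of [H] on the blocks: the coefficients at coordinate [s j] are divided by
    the diagonal value, and [c_large] yields the norm 2. *)
Lemma block_coef_map : exists2 G : {linear W -> W},
  forall w j, val (G w) j =
    \sum_(0 <= a < 2 ^ j) ((c (s j))^-1 * f (i j a) (val w (s j))) *: d j a &
  forall w, rnorm (G w) <= 2 * rnorm w.
Proof.
pose F j (w : W) : V := \sum_(0 <= a < 2 ^ j) ((c (s j))^-1 * f (i j a) (val w (s j))) *: d j a.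
have [||G GE Gb] := @linfty_op R W V F 2; last by exists G.
- move=> j k x y; rewrite /F scaler_sumr -big_split; apply: eq_bigr => b _.
  rewrite linfty_valD linfty_valZ (lp_linear eL) /= scalerA -scalerDl.
  by congr (_ *: _); ring.
- move=> j w; apply: (powR_le_cancel p1); rewrite ?rnorm_ge0 ?mulr_ge0 ?rnorm_ge0 //.
  apply: (le_trans (lp_synthesis (dL j) _ _)); rewrite ?iota_uniq //.
  rewrite powRM ?rnorm_ge0 //.
  apply: (@le_trans _ _ (2 `^ p * \sum_(0 <= a < 2 ^ j) normc (f (i j a) (val w (s j))) `^ p)).
    rewrite mulr_sumr; apply: ler_sum => a _.
    rewrite normcM powRM ?ge0_normc // ler_wpM2r ?powR_ge0 //.
    apply: (le_powR p1); rewrite ?ge0_normc // normcV -[leRHS]invrK lef_pV2 ?posrE ?invr_gt0 //.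
    by apply: lt_le_trans (c_large j); rewrite invr_gt0.
  rewrite ler_wpM2l ?powR_ge0 //.
  apply: (le_trans (lp_bessel (eiL j) _ _)); rewrite ?iota_uniq //.
  by apply: (le_powR p1); rewrite ?rnorm_ge0 ?linfty_ge.
Qed.

End Assembly.

Section Factor.
Context (U : set_system nat) (UF : UltraFilter U).
Hypothesis Ufree : forall n, U [set m | (n <= m)%N].

(* Identifies the space with a complemented subspace of the [l^infty]-sum of
   the dyadic step functions. *)
Lemma dyadic_reassembly : exists J Q : {linear W -> W},
  [/\ forall w, rnorm (J w) <= rnorm w, forall w, rnorm (Q w) <= rnorm w &
    forall x y, (forall j, val y j = dyadic_proj d D j (val (J x) j)) -> Q y = x].
Proof.
have [m [j [mj jn]]] := nat_pairing.
have [||J JE Jb] := @linfty_op R W V (fun n w => val w (m n)) 1.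
- by [].
- by move=> n w; rewrite mul1r linfty_ge.
have /choice[q qP] (kw : nat * W) : exists x, rnorm x <= rnorm kw.2 /\
    forall k a, (a < 2 ^ k)%N ->
      is_ulim U (fun n => D k a (val kw.2 (j kw.1 n))) (D k a x).
  have [x x1 x2] := dyadic_wlim_ex p1 dL D_refine d_refine cV UF Ufree
    (fun n => linfty_ge kw.2 (j kw.1 n)).
  by exists x.
(* By [D_total] the weak limit is determined by its dyadic coefficients. Both the linearity of [Q]
   and the identity [Q y = x] follow from this. *)
have quniq k w x : (forall l a, (a < 2 ^ l)%N ->
    is_ulim U (fun n => D l a (val w (j k n))) (D l a x)) -> q (k, w) = x.
  move=> h; apply/eqP; rewrite -subr_eq0; apply/eqP/D_total => l a al.
  rewrite (lp_B (dL l)); apply/eqP; rewrite subr_eq0; apply/eqP.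
  exact: (ulim_uniq UF ((qP (k, w)).2 l a al) (h l a al)).
have [||Q QE Qb] := @linfty_op R W V (fun k w => q (k, w)) 1.
- move=> k r x y; apply: quniq => l a al.
  rewrite (lp_linear (dL l)).
  have := ulim_lin UF r ((qP (k, x)).2 l a al) ((qP (k, y)).2 l a al).
  apply: (ulim_eventually UF Ufree (N := 0%N)) => n _.
  by rewrite linfty_valD linfty_valZ (lp_linear (dL l)).
- by move=> k w; rewrite mul1r; exact: (qP (k, w)).1.
exists J, Q; split=> [w|w|x y yE]; [by rewrite -[leRHS]mul1r..|].
apply: linfty_ext => k; rewrite QE; apply: quniq => l a al.
(* For [n >= l] the level [j k n] is at least [l], so the projection of that level preserves the
   coefficients of level [l], and the sequence is eventually constant. *)
apply: (ulim_eventually UF Ufree (N := l) _ (ulim_cst UF (D l a (val x k)))) => n ln.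
by rewrite yE JE mj dyadic_coef_proj // (leq_trans ln).
Qed.

Lemma factor_large_diagonal (H : {linear W -> W}) B (c : nat -> R[i])
    (iota : nat -> {linear V -> W}) s0 :
  (forall w, rnorm (H w) <= B * rnorm w) ->
  (forall s x n, val (iota s x) n = if n == s then x else 0) ->
  (forall s x, rnorm (iota s x) <= rnorm x) ->
  (forall s, is_ulim U (fun a => f a (val (H (iota s (e a))) s)) (c s)) ->
  increasing_seqn s0 -> (forall k, 2^-1 <= normc (c (s0 k))) ->
  exists E P : {linear W -> W}, [/\ forall w, rnorm (E w) <= rnorm w,
    forall w, rnorm (P w) <= 4 * rnorm w & forall w, P (H (E w)) = w].
Proof.
move=> HB iotaE iota_le cP s0i c0.
pose tol (j : nat) : R := (8 * (2 ^ j)%:R * (2 ^ j)%:R)^-1.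
have tol0 j : 0 < tol j by rewrite invr_gt0 !mulr_gt0 // ltr0n expn_gt0.
have [s [i loc]] := localized_ex p1 UF Ufree eL iotaE iota_le HB cP (expn 2) s0i tol0.
have c_large j : 2^-1 <= normc (c (s j)) by have [k ->] := loc_sub loc j.
have [A [A_in A_out A_le]] := block_embedding loc.
have [G GE G_le] := block_coef_map c_large loc.
(* [G \o H \o A] is compared with the coordinatewise conditional expectation, not with the identity;
   [w + S w] equals [G (H (A w))] when [w] is fixed by that expectation. *)
have [||S SE S_le] := @linfty_op R W V
    (fun j w => val (G (H (A w))) j - dyadic_proj d D j (val w j)) 2^-1.
- move=> j k x y; rewrite (linearP A) (linearP H) (linearP G) !linfty_valD !linfty_valZ.
  by rewrite dyadic_proj_linear scalerBr opprD addrACA.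
- move=> j w; rewrite GE /dyadic_proj -sumrB (le_trans (rnorm_sum _ _ _)) //.
  apply: (@le_trans _ _ (\sum_(0 <= a < 2 ^ j) ((2 * (2 ^ j)%:R)^-1 * rnorm w))).
    rewrite big_nat [leRHS]big_nat; apply: ler_sum => a /= aj.
    have h := coef_block_embedding iotaE loc A_in A_out w aj.
    have cs : c (s j) != 0.
      by apply: contraTneq (c_large j) => ->; rewrite normc0 -ltNge invr_gt0.
    have c2 : (normc (c (s j)))^-1 <= 2.
      rewrite -[leRHS]invrK lef_pV2 ?posrE ?invr_gt0 //.
      by apply: lt_le_trans (c_large j); rewrite invr_gt0.
    rewrite -scalerBl rnormZ -[leRHS]mulr1.
    apply: ler_pM; rewrite ?ge0_normc ?rnorm_ge0 ?(lp_unit_le p1 (dL j)) //.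
    rewrite -[D j a _](mulKf cs) -mulrBr normcM normcV.
    apply: (@le_trans _ _ (2 * ((4 * (2 ^ j)%:R)^-1 * rnorm w))).
      by apply: ler_pM; rewrite ?invr_ge0 ?ge0_normc.
    rewrite le_eqVlt; apply/orP; left; apply/eqP; field.
    by rewrite pnatr_eq0 expn_eq0.
  rewrite sumr_const_nat subn0 -mulr_natl le_eqVlt; apply/orP; left; apply/eqP; field.
  by rewrite pnatr_eq0 expn_eq0.
have [K KS K_le] := half_perturbation_inverse (linfty_complete cV) S_le.
have [J [Q [J_le Q_le JQ]]] := dyadic_reassembly.
exists [the {linear W -> W} of A \o J], [the {linear W -> W} of Q \o (K \o G)].
split=> w.
- by rewrite (le_trans (A_le _)).
- rewrite (le_trans (Q_le _)) // (le_trans (K_le _)) //.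
  by have := G_le w; lra.
have [EE EEE _] : exists2 EE : {linear W -> W}, forall w j,
    val (EE w) j = dyadic_proj d D j (val w j) & True.
  have [||EE EEE _] := @linfty_op R W V (fun j w => dyadic_proj d D j (val w j)) 1.
  - by move=> j k x y; rewrite linfty_valD linfty_valZ dyadic_proj_linear.
  - by move=> j x; rewrite mul1r (le_trans (dyadic_proj_le p1 dL _ _)) // linfty_ge.
  by exists EE.
apply: JQ => j; rewrite /= -EEE; congr (val _ j).
(* [A] uses only the dyadic coefficients that [EE] retains. Hence [G (H (A w))] is
   [EE w + S (EE w)], which [K] sends to [EE w]; for [w] in the range of [J], [Q] recovers the
   original sequence from it. *)
have A_EE x : A x = A (EE x).
  apply: linfty_ext => n.
  have [[k <-]|nk] := pselect (exists k, s k = n); last first.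
    by rewrite !A_out // => k kn; apply: nk; exists k.
  rewrite !A_in /block; apply: eq_big_nat => b /= bk.
  by rewrite EEE (dyadic_proj_coef dL).
have EE_EE x : EE (EE x) = EE x.
  apply: linfty_ext => n; rewrite !EEE; apply: eq_big_nat => b /= bk.
  by rewrite (dyadic_proj_coef dL).
rewrite -[RHS]KS; congr (K _); apply: linfty_ext => n.
by rewrite linfty_valD SE -A_EE -EEE EE_EE addrCA subrr addr0.
Qed.

Lemma increasing_enumeration (A : set nat) : U A ->
  exists2 s, increasing_seqn s & forall k, A (s k).
Proof.
move=> UA; have UP : ProperFilter U by exact: ultra_proper.
have /choice[nx nxP] n : exists m, A m /\ (n < m)%N.
  by have [m [Am nm]] := filter_ex (filterI UA (Ufree n.+1)); exists m.
pose s k := iter k nx (nx 0%N).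
exists s => [a b|[|k]].
- by apply: (homo_ltn ltn_trans) => k; exact: (nxP _).2.
- exact: (nxP _).1.
- exact: (nxP _).1.
Qed.

End Factor.

Theorem factor_contraction (T : {linear W -> W}) :
  (forall w, rnorm (T w) <= rnorm w) ->
  exists2 H : W -> W, H = T \/ H = (fun w => w - T w) &
    exists E P : {linear W -> W}, [/\ forall w, rnorm (E w) <= rnorm w,
      forall w, rnorm (P w) <= 4 * rnorm w & forall w, P (H (E w)) = w].
Proof.
move=> T_le; have [U UF Ufree] := free_ultrafilter.
have UP : ProperFilter U by exact: ultra_proper.
have [iota iotaE iota_le] := @linfty_single R V.
have /choice[c cP] s : exists c, is_ulim U (fun a => f a (val (T (iota s (e a))) s)) c.
  apply: (ulim_ex UF (K := 1)) => a.
  rewrite (le_trans (lp_coef_le p1 eL _ _)) // (le_trans (linfty_ge _ _)) //.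
  by rewrite (le_trans (T_le _)) // (le_trans (iota_le _ _)) // (lp_unit_le p1 eL).
(* The ultrafilter used inside each coordinate also splits the set of coordinates; as it is free,
   the part that belongs to it is infinite. The diagonal limits of [w - T w] are [1 - c s]. *)
have [large|small] := @in_ultra_setVsetC _ _ [set s | 2^-1 <= normc (c s)] UF.
  have [s0 s0i s0P] := increasing_enumeration UF Ufree large.
  have [|E [P EP]] := @factor_large_diagonal U UF Ufree T 1 c iota s0 _ iotaE iota_le cP s0i s0P.
    by move=> w; rewrite mul1r.
  by exists T; [left|exists E, P].
have [s0 s0i s0P] := increasing_enumeration UF Ufree small.
have [|T' T'E] := @linear_ex R W W (fun w => w - T w).
  by move=> k x y; rewrite linearP scalerBr opprD addrACA.
have [|||E [P EP]] := @factor_large_diagonal U UF Ufree T' 2 (fun s => 1 - c s) iota s0 _ iotaE iota_le _ s0i _.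
- by move=> w; rewrite T'E (le_trans (rnormB _ _)) // mulr_natl mulr2n lerD.
- move=> s; have := ulim_lin UF (-1) (cP s) (ulim_cst UF 1).
  rewrite mulN1r addrC; apply: (ulim_eventually UF Ufree (N := 0%N)) => a _.
  rewrite T'E linfty_valB iotaE eqxx (lp_B eL) (lp_biorth eL) // eqxx.
  by rewrite mulN1r addrC.
- move=> k; have := s0P k => /= /negP; rewrite -ltNge => h.
  have := le_normcD (1 - c (s0 k)) (c (s0 k)); rewrite subrK normc1; lra.
- exists (fun w => w - T w); first by right.
  by exists E, P; have [h1 h2 h3] := EP; split => // w; rewrite -T'E.
Qed.

End Factorization.

(** * Complex L^p spaces over a finite measure *)

Section ComplexLpIntegrals.
Context d (T : measurableType d) (R : realType).
Context (mu : {measure set T -> \bar R}) (p : R) (p_gt1 : 1 < p).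
Hypothesis mu_fin : (mu [set: T] < +oo)%E.

Local Notation X := (cLp mu (ltW p_gt1)).
Local Notation fun_p := (cLfun mu (ltW p_gt1)).
Local Open Scope quotient_scope.

Let p0 : 0 < p. Proof. by rewrite (lt_trans _ p_gt1). Qed.
Let pn0 : p != 0. Proof. by rewrite gt_eqF. Qed.

Implicit Types (f g : fun_p) (A : set T).

Lemma cLp_pi_ex (x : X) : exists f : fun_p, x = \pi_X f.
Proof. by exists (repr x); rewrite reprK. Qed.

Lemma measurable_normc_powR (h : T -> R[i]) : cmeasurable h ->
  measurable_fun setT (fun t => normc (h t) `^ p).
Proof.
move=> mh; apply: (measurableT_comp (measurable_powR p)).
exact: measurable_normc.
Qed.

Lemma cLnorm_powR (h : T -> R[i]) :
  (cLnorm mu p h `^ p = \int[mu]_t (normc (h t) `^ p)%:E)%E.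
Proof.
rewrite /cLnorm (powR_Lnorm _ _ pn0); apply: eq_integral => t _.
by rewrite /comp abse_EFin poweR_EFin ger0_norm /cabs ?ge0_normc.
Qed.

Lemma rnorm_pi_powR f :
  ((rnorm (\pi_X f) `^ p)%:E = \int[mu]_t (normc (f t) `^ p)%:E)%E.
Proof.
rewrite -cLnorm_powR -(cLnorm_fine f) poweR_EFin; congr (_ `^ _)%:E.
by rewrite /rnorm [X in complex.Re X]cLp_norm_pi.
Qed.

Lemma cLfun_of_integral (h : T -> R[i]) : cmeasurable h ->
  (\int[mu]_t (normc (h t) `^ p)%:E < +oo)%E -> exists f : fun_p, f =1 h.
Proof.
move=> mh; rewrite -cLnorm_powR => hoo.
have hn : (cLnorm mu p h < +oo)%E.
  have := poweR_lty p^-1 hoo; rewrite -poweRrM mulfV // poweRe1 //.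
  exact: Lnorm_ge0.
by exists (CLfun _ mh hn).
Qed.

Lemma cLfun_normc_powR_lty f : (\int[mu]_t (normc (f t) `^ p)%:E < +oo)%E.
Proof. by rewrite -rnorm_pi_powR ltry. Qed.

Lemma integrable_normc_powR f A : measurable A ->
  mu.-integrable A (fun t => (normc (f t) `^ p)%:E).
Proof.
move=> mA; apply: (integrableS measurableT) => //; apply/integrableP; split.
  by apply/measurable_EFinP/measurable_normc_powR; exact: cLfun_measurable.
under eq_integral do rewrite gee0_abs ?lee_fin ?powR_ge0 //.
exact: cLfun_normc_powR_lty.
Qed.

Lemma mu_lty A : measurable A -> (mu A < +oo)%E.
Proof.
by move=> mA; apply: le_lt_trans mu_fin; apply: le_measure; rewrite ?inE.
Qed.

Lemma integrable_cst_fin A (r : R) : measurable A ->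
  mu.-integrable A (fun=> r%:E).
Proof.
move=> mA; apply/integrableP; split; first exact: measurable_cst.
by rewrite /= integral_cst // lte_mul_pinfty // ?lee_fin ?mu_lty.
Qed.

Lemma integrable_EFinZ A (r : R) (h : T -> R) : measurable A ->
  mu.-integrable A (EFin \o h) -> mu.-integrable A (EFin \o (fun t => r * h t)).
Proof.
by move=> mA ih; have := integrableZl mA r ih; under eq_fun do rewrite -EFinM.
Qed.

Lemma integrable_EFinD A (h k : T -> R) : measurable A ->
  mu.-integrable A (EFin \o h) -> mu.-integrable A (EFin \o k) ->
  mu.-integrable A (EFin \o (fun t => h t + k t)).
Proof.
by move=> mA ih ik; have := integrableD mA ih ik; under eq_fun do rewrite -EFinD.
Qed.

Lemma integrable_normc f A : measurable A ->
  mu.-integrable A (fun t => (normc (f t))%:E).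
Proof.
move=> mA; apply: (@le_integrable _ _ _ mu A mA _
    (fun t => (1 + normc (f t) `^ p)%:E)).
- apply/measurable_EFinP/measurable_funTS.
  by apply: measurable_normc; exact: cLfun_measurable.
- move=> t _; rewrite /= !lee_fin ger0_norm ?ge0_normc // ger0_norm ?addr_ge0 ?powR_ge0 //.
  have [f1|/ltW f1] := leP (normc (f t)) 1; first by rewrite (le_trans f1) // lerDl powR_ge0.
  by rewrite (le_trans (le1r_powR f1 (ltW p_gt1))) // lerDr.
- under eq_fun do rewrite EFinD.
  apply: integrableD => //; last exact: integrable_normc_powR.
  by exact: integrable_cst_fin.
Qed.

Lemma integrable_Re f A : measurable A ->
  mu.-integrable A (fun t => (complex.Re (f t))%:E).
Proof.
move=> mA; apply: (le_integrable mA _ _ (integrable_normc f mA)).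
  by apply/measurable_EFinP/measurable_funTS; exact: (cLfun_measurable f).1.
by move=> t _ /=; rewrite lee_fin [leRHS]ger0_norm ?ge0_normc ?normc_ge_absRe.
Qed.

Lemma integrable_Im f A : measurable A ->
  mu.-integrable A (fun t => (complex.Im (f t))%:E).
Proof.
move=> mA; apply: (le_integrable mA _ _ (integrable_normc f mA)).
  by apply/measurable_EFinP/measurable_funTS; exact: (cLfun_measurable f).2.
by move=> t _ /=; rewrite lee_fin [leRHS]ger0_norm ?ge0_normc ?normc_ge_absIm.
Qed.

Definition cint A (h : T -> R[i]) : R[i] :=
  (\int[mu]_(t in A) complex.Re (h t) +i* \int[mu]_(t in A) complex.Im (h t))%C.

Lemma cint_linear A (a : R[i]) f g : measurable A ->
  cint A (fun t => a * f t + g t) = a * cint A f + cint A g.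
Proof.
move=> mA; have := integrable_Re f mA; have := integrable_Im f mA.
have := integrable_Re g mA; have := integrable_Im g mA.
case: a => a b ig rg i_f rf; rewrite /cint.
have -> : (fun t => complex.Re ((a +i* b)%C * f t + g t)) =
    (fun t => (a * complex.Re (f t) + (- b) * complex.Im (f t)) + complex.Re (g t)).
  by apply/funext => t; case: (f t) (g t) => [? ?] [? ?] /=; rewrite mulNr.
have -> : (fun t => complex.Im ((a +i* b)%C * f t + g t)) =
    (fun t => (a * complex.Im (f t) + b * complex.Re (f t)) + complex.Im (g t)).
  by apply/funext => t; case: (f t) (g t) => [? ?] [? ?].
rewrite !RintegralD ?RintegralZl //; try by (do ?[apply: integrable_EFinD|apply: integrable_EFinZ]).
by apply/eqP; rewrite eq_complex /= mulNr !eqxx.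
Qed.

(** Multiplying [f] by a phase makes the integral real and non-negative, so it equals the integral
    of a real part, which the modulus dominates. *)
Lemma normc_cint_le A f : measurable A ->
  normc (cint A f) <= \int[mu]_(t in A) normc (f t).
Proof.
move=> mA; have [u u1 uf] := normc_phase (cint A f).
have uE : cint A (cLfunZ u f) = (normc (cint A f))%:C%C.
  rewrite -uf -[RHS]addr0 -[X in _ = _ + X](_ : cint A (cLfun0 mu (ltW p_gt1)) = 0).
    rewrite -cint_linear //; congr cint; apply/funext => t /=.
    by rewrite addr0.
  by rewrite /cint /=; under eq_Rintegral do rewrite /=; rewrite !Rintegral_cst // mul0r.
have -> : normc (cint A f) = \int[mu]_(t in A) complex.Re (cLfunZ u f t).
  by have /(congr1 (@complex.Re R)) /= := uE.
apply: le_Rintegral => //; first exact: integrable_Re.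
  exact: integrable_normc.
move=> t _ /=; apply: (le_trans (ler_norm _)).
by rewrite (le_trans (normc_ge_absRe _)) // normcM u1 mul1r.
Qed.

(* Jensen's inequality, from the tangent line of the power function. *)
Lemma Rintegral_normc_powR_le A f : measurable A ->
  (\int[mu]_(t in A) normc (f t)) `^ p <=
  fine (mu A) `^ (p - 1) * \int[mu]_(t in A) (normc (f t) `^ p).
Proof.
move=> mA; set m := fine (mu A).
have m0 : 0 <= m by rewrite fine_ge0.
set I := \int[mu]_(t in A) normc (f t).
have I0 : 0 <= I by apply: Rintegral_ge0 => t _; exact: ge0_normc.
have Jp0 : 0 <= \int[mu]_(t in A) (normc (f t) `^ p).
  by apply: Rintegral_ge0 => t _; exact: powR_ge0.
have [I_eq0|/eqP I_neq0] := eqVneq I 0.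
  by rewrite I_eq0 powR0 // mulr_ge0 ?powR_ge0.
have [m_eq0|m_neq0] := eqVneq m 0.
  case: I_neq0; rewrite /I /Rintegral.
  rewrite (null_set_integral mA) //; last by rewrite -[LHS]fineK ?ge0_fin_numE ?mu_lty // -/m m_eq0.
  by have /measurable_int := integrable_normc f mA.
have mp : 0 < m by rewrite lt_neqAle eq_sym m_neq0.
have Ip : 0 < I by rewrite lt_neqAle I0 eq_sym andbT; exact/eqP.
pose s := I / m; have s0 : 0 < s by rewrite divr_gt0.
have tangent u : 0 <= u -> s `^ p * (1 - p) + s `^ p * p / s * u <= u `^ p.
  move=> u0; have us0 : 0 <= u / s by rewrite divr_ge0 // ltW.
  have := bernoulli_powR p_gt1 us0.
  rewrite -(ler_pM2l (powR_gt0 p s0)) -powRM ?(ltW s0) //.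
  rewrite [s * (u / s)]mulrC divfK ?gt_eqF //; apply: le_trans.
  by rewrite le_eqVlt; apply/orP; left; apply/eqP; field; rewrite gt_eqF.
have : \int[mu]_(t in A) (s `^ p * (1 - p) + s `^ p * p / s * normc (f t)) <=
    \int[mu]_(t in A) (normc (f t) `^ p).
  apply: le_Rintegral => //; last by move=> t _; apply: tangent; exact: ge0_normc.
    apply: integrable_EFinD => //; first exact: integrable_cst_fin.
    by apply: integrable_EFinZ => //; exact: integrable_normc.
  exact: integrable_normc_powR.
rewrite RintegralD //; last 2 first.
- exact: integrable_cst_fin.
- by apply: integrable_EFinZ => //; exact: integrable_normc.
rewrite Rintegral_cst // RintegralZl //; last exact: integrable_normc.
rewrite -/m -/I.
have -> : s `^ p * (1 - p) * m + s `^ p * p / s * I = s `^ p * m.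
  by rewrite /s; field; rewrite !gt_eqF.
move=> h; rewrite mulrC -ler_pdivrMr ?powR_gt0 //; apply: le_trans h.
rewrite /s powRM ?invr_ge0 // -mulrA ler_wpM2l ?powR_ge0 //.
have -> : m^-1 `^ p = (m `^ p)^-1.
  by rewrite -(powR_inv1 m0) -powRrM mulN1r powRN.
by rewrite -(mulr_powRB1 m0 p0) invfM mulrAC mulVf ?mul1r // gt_eqF.
Qed.

Lemma normc_cint_powR_le A f : measurable A ->
  normc (cint A f) `^ p <=
  fine (mu A) `^ (p - 1) * \int[mu]_(t in A) (normc (f t) `^ p).
Proof.
move=> mA; apply: le_trans (Rintegral_normc_powR_le f mA).
by apply: (le_powR p_gt1); rewrite ?ge0_normc ?normc_cint_le.
Qed.

End ComplexLpIntegrals.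

(** * Normalized indicators of disjoint sets *)

Section DisjointSystems.
Context d (T : measurableType d) (R : realType).
Context (mu : {measure set T -> \bar R}) (p : R) (p_gt1 : 1 < p).
Hypothesis mu_fin : (mu [set: T] < +oo)%E.

Local Notation X := (cLp mu (ltW p_gt1)).
Local Notation fun_p := (cLfun mu (ltW p_gt1)).
Local Open Scope quotient_scope.

Let p0 : 0 < p. Proof. by rewrite (lt_trans _ p_gt1). Qed.
Let pn0 : p != 0. Proof. by rewrite gt_eqF. Qed.

Implicit Types (f g : fun_p) (A : set T).

Lemma cint_repr A f : measurable A -> cint mu A (repr (\pi_X f)) = cint mu A f.
Proof.
move=> mA; have fE := cLp_reprP f.
have mf := cLfun_measurable f; have mr := cLfun_measurable (repr (\pi_X f)).
congr (_ +i* _)%C; congr fine; apply: ae_eq_integral => //.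
- by apply/measurable_EFinP/measurable_funTS; exact: mr.1.
- by apply/measurable_EFinP/measurable_funTS; exact: mf.1.
- by apply: filterS fE => t /(_ I) /= -> _.
- by apply/measurable_EFinP/measurable_funTS; exact: mr.2.
- by apply/measurable_EFinP/measurable_funTS; exact: mf.2.
- by apply: filterS fE => t /(_ I) /= -> _.
Qed.

Lemma cLp_piD f g : \pi_X f + \pi_X g = \pi_X (cLfunD f g).
Proof. exact: cLp_add_pi. Qed.

Lemma cLp_piZ a f : a *: \pi_X f = \pi_X (cLfunZ a f).
Proof. exact: cLp_scale_pi. Qed.

(* This is 0 when [A] is null, because [0 `^ x = 0] for [x != 0]. *)
Definition nindic A (t : T) : R[i] := (fine (mu A) `^ (- p^-1) * \1_A t)%:C%C.

(** Choosing with [xget] avoids a proof of measurability as an argument; [lp_unit_repr] identifies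
    the choice for measurable [A]. *)
Definition lp_unit A : X :=
  \pi_X (xget (cLfun0 mu (ltW p_gt1)) [set f : fun_p | f =1 nindic A]).

(** The exponent is minus the reciprocal of the conjugate exponent of [p]: for [A] of positive
    measure this is the norm-one functional taking the value 1 at [lp_unit A]. *)
Definition lp_coef A (x : X) : R[i] :=
  (fine (mu A) `^ (p^-1 - 1))%:C%C * cint mu A (repr x).

Lemma mu_fine A : measurable A -> (fine (mu A))%:E = mu A.
Proof. by move=> mA; rewrite fineK // ge0_fin_numE // (mu_lty mu_fin). Qed.

Lemma nindic_cLfun A : measurable A -> exists f : fun_p, f =1 nindic A.
Proof.
move=> mA; apply: cLfun_of_integral.
  split; last exact: measurable_cst.
  apply: measurable_funM; [exact: measurable_cst|exact: measurable_indic].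
pose c := fine (mu A) `^ (- p^-1).
apply: (@le_lt_trans _ _ (\int[mu]_t (cst (c `^ p)%:E t))%E).
  apply: ge0_le_integral => //.
  - by move=> t _; rewrite lee_fin powR_ge0.
  - apply/measurable_EFinP/measurable_normc_powR; split; last exact: measurable_cst.
    by apply: measurable_funM; [exact: measurable_cst|exact: measurable_indic].
  - move=> t _; rewrite lee_fin; apply: (le_powR p_gt1); first exact: ge0_normc.
    rewrite normc_real normrM ger0_norm ?powR_ge0 // indicE.
    by case: (_ \in _); rewrite /= ?normr1 ?normr0 ?mulr1 // mulr0 powR_ge0.
by rewrite integral_cst // lte_mul_pinfty // lee_fin powR_ge0.
Qed.

Lemma lp_unit_repr A : measurable A -> exists2 f : fun_p, f =1 nindic A & lp_unit A = \pi_X f.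
Proof.
move=> /nindic_cLfun[f fA]; rewrite /lp_unit; case: xgetP => [g _ gA|/(_ f)//].
by exists g.
Qed.

Lemma lp_coef_scalar A : measurable A -> scalar (lp_coef A).
Proof.
move=> mA a x y; have [f ->] := cLp_pi_ex x; have [g ->] := cLp_pi_ex y.
rewrite cLp_piZ cLp_piD /lp_coef !cint_repr //.
have -> : cint mu A (cLfunD (cLfunZ a f) g) = a * cint mu A f + cint mu A g.
  by rewrite -cint_linear.
by rewrite mulrDr mulrCA.
Qed.

(** The normalization cancels the factor of Jensen's inequality. On a null set the normalizing power
    is a non-zero power of 0, thus 0, and so is the left-hand side. *)
Lemma normc_lp_coef_powR A f : measurable A ->
  normc (lp_coef A (\pi_X f)) `^ p <= \int[mu]_(t in A) (normc (f t) `^ p).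
Proof.
move=> mA; rewrite /lp_coef cint_repr // normcM normc_real.
rewrite ger0_norm ?powR_ge0 // powRM ?powR_ge0 ?ge0_normc // -powRrM.
have -> : (p^-1 - 1) * p = - (p - 1) by rewrite mulrBl mulVf // mul1r opprB.
have Jp0 : 0 <= \int[mu]_(t in A) (normc (f t) `^ p).
  by apply: Rintegral_ge0 => t _; exact: powR_ge0.
have [->|m0] := eqVneq (fine (mu A)) 0.
  by rewrite powR0 ?mul0r // oppr_eq0 subr_eq0 gt_eqF.
have m_gt0 : 0 < fine (mu A) by rewrite lt_neqAle eq_sym m0 fine_ge0.
rewrite powRN mulrC ler_pdivrMr ?powR_gt0 // mulrC.
exact: normc_cint_powR_le.
Qed.

Context (A : nat -> set T) (I : pred nat).
Hypothesis mA : forall i, measurable (A i).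
Hypothesis tA : trivIset setT A.
Hypothesis A_gt0 : forall i, I i -> (0 < mu (A i))%E.

Lemma disjoint_mem i j t : A i t -> A j t -> i = j.
Proof. by move=> it jt; apply: tA => //; exists t. Qed.

Lemma normc_sum_nindic (s : seq nat) (v : nat -> R[i]) t : uniq s ->
  normc (\sum_(i <- s) v i * nindic (A i) t) `^ p =
  \sum_(i <- s) normc (v i) `^ p * (fine (mu (A i)) `^ (- p^-1)) `^ p * \1_(A i) t.
Proof.
move=> us; have [[i [si Ait]]|none] := pselect (exists i, i \in s /\ A i t).
  have out j : j != i -> \1_(A j) t = 0 :> R.
    move=> ji; rewrite indicE memNset // => Ajt.
    by move: ji; rewrite (disjoint_mem Ajt Ait) eqxx.
  rewrite (bigD1_seq i) //= [in RHS](bigD1_seq i) //= !big1 ?addr0.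
  - rewrite /nindic indicE mem_set // !mulr1 normcM normc_real ger0_norm ?powR_ge0 //.
    by rewrite powRM ?ge0_normc ?powR_ge0.
  - by move=> j ji; rewrite out // mulr0.
  - by move=> j ji; rewrite /nindic out // mulr0 mulr0.
have out j : j \in s -> \1_(A j) t = 0 :> R.
  by move=> sj; rewrite indicE memNset // => Ajt; apply: none; exists j.
rewrite big1_seq ?normc0 ?powR0 // => [|j /andP[_ sj]]; last first.
  by rewrite /nindic out // mulr0 mulr0.
by rewrite big1_seq // => j /andP[_ sj]; rewrite out // mulr0.
Qed.

Lemma sum_lp_unit_repr (s : seq nat) (v : nat -> R[i]) :
  exists2 g : fun_p, (forall t, g t = \sum_(i <- s) v i * nindic (A i) t) &
    \sum_(i <- s) v i *: lp_unit (A i) = \pi_X g.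
Proof.
elim: s => [|i s [g gE gs]].
  by exists (cLfun0 mu (ltW p_gt1)); rewrite ?big_nil // => t; rewrite big_nil.
have [f fE fA] := lp_unit_repr (mA i).
exists (cLfunD (cLfunZ (v i) f) g) => [t|]; last by rewrite big_cons gs fA cLp_piZ cLp_piD.
by rewrite big_cons /= fE gE.
Qed.
 
(** Bessel's inequality is Jensen's inequality on each [A i], added up over disjoint sets. For the
    synthesis, at most one indicator is non-zero at each point, so [p]-th powers add pointwise and
    are integrated term by term. *)
Lemma disjoint_lp_system : lp_system p I (fun i => lp_unit (A i)) (fun i => lp_coef (A i)).
Proof.
split=> [i|i j Ii|s x us|s v us].
- exact: lp_coef_scalar.
- have [f fE ->] := lp_unit_repr (mA j); rewrite /lp_coef cint_repr //.
  have -> : cint mu (A i) f = cint mu (A i) (nindic (A j)).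
    by congr cint; apply/funext.
  rewrite /cint /= Rintegral_cst // mul0r.
  have mi : mu.-integrable (A i) (EFin \o (\1_(A j) : T -> R)).
    apply: (le_integrable (mA i) _ _ (integrable_cst_fin mu_fin 1 (mA i))).
      by apply/measurable_EFinP/measurable_funTS; exact: measurable_indic.
    by move=> t _; rewrite /= lee_fin normr1 indicE; case: (_ \in _); rewrite ?normr1 ?normr0.
  rewrite (RintegralZl _ (mA i) mi).
  have -> : \int[mu]_(t in A i) (\1_(A j) t : R) = fine (mu (A j `&` A i)).
    by rewrite /Rintegral integral_indic.
  have [<-|ij] := eqVneq i j; last first.
    rewrite (_ : A j `&` A i = set0) ?measure0 ?mulr0 ?mulr0 //.
    rewrite -subset0 => t [jt it]; move: ij; rewrite (disjoint_mem it jt) eqxx //.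
  rewrite setIid; set m := fine _.
  have m0 : 0 < m by rewrite -lte_fin mu_fine // A_gt0.
  have -> : (m `^ (- p^-1) * m +i* 0)%C = (m `^ (- p^-1) * m)%:C%C by [].
  have mn0 : m != 0 by rewrite gt_eqF.
  rewrite -rmorphM /= -{3}(powRr1 (ltW m0)) -!powRD ?mn0 ?implybT //.
  by rewrite (_ : p^-1 - 1 + (- p^-1 + 1) = 0) ?powRr0 //; ring.
- have [f ->] := cLp_pi_ex x.
  apply: (@le_trans _ _ (\sum_(i <- s) \int[mu]_(t in A i) (normc (f t) `^ p))).
    by apply: ler_sum => i _; exact: normc_lp_coef_powR.
  rewrite -lee_fin rnorm_pi_powR -sumEFin.
  have mf : measurable_fun setT (fun t => (normc (f t) `^ p)%:E).
    by apply/measurable_EFinP/measurable_normc_powR; exact: cLfun_measurable.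
  apply: (@le_trans _ _ (\int[mu]_(t in \big[setU/set0]_(i <- s) A i) (normc (f t) `^ p)%:E)%E).
    rewrite ge0_integral_bigsetU //.
    + rewrite le_eqVlt; apply/orP; left; apply/eqP; apply: eq_bigr => i _.
      rewrite /Rintegral fineK //; apply: integrable_fin_num => //.
      exact: (integrable_normc_powR f).
    + exact: sub_trivIset tA.
    + exact: measurable_funTS.
    + by move=> t _; rewrite lee_fin powR_ge0.
  apply: ge0_subset_integral => //; first exact: bigsetU_measurable.
  by move=> t _; rewrite lee_fin powR_ge0.
- have [g gE ->] := sum_lp_unit_repr s v.
  rewrite -lee_fin rnorm_pi_powR.
  under eq_integral do rewrite gE normc_sum_nindic // -sumEFin.
  rewrite ge0_integral_sum //; last 2 first.
  + by move=> i; apply/measurable_EFinP/measurable_funM => //; exact: measurable_indic.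
  + by move=> i t _; rewrite lee_fin !mulr_ge0 ?powR_ge0.
  rewrite -sumEFin; apply: lee_sum => i _.
  under eq_integral do rewrite EFinM.
  rewrite ge0_integralZl //; last 2 first.
  + by apply/measurable_EFinP; exact: measurable_indic.
  + by rewrite lee_fin mulr_ge0 ?powR_ge0.
  rewrite integral_indic // setIT -mu_fine // -EFinM lee_fin -powRrM mulNr mulVf //.
  rewrite -mulrA ler_piMr ?powR_ge0 //.
  have [->|m0] := eqVneq (fine (mu (A i))) 0; first by rewrite mulr0.
  by rewrite powR_inv1 ?fine_ge0 // mulVf.
Qed.

End DisjointSystems.

(** * Completeness of complex [L^p] (Riesz-Fischer) *)

Section Completeness.
Context d (T : measurableType d) (R : realType).
Context (mu : {measure set T -> \bar R}) (p : R) (p_gt1 : 1 < p).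
Hypothesis mu_fin : (mu [set: T] < +oo)%E.

Local Notation X := (cLp mu (ltW p_gt1)).
Local Notation fun_p := (cLfun mu (ltW p_gt1)).
Local Open Scope quotient_scope.

Let p0 : 0 < p. Proof. by rewrite (lt_trans _ p_gt1). Qed.
Let pn0 : p != 0. Proof. by rewrite gt_eqF. Qed.

Definition normc_cvg (z : nat -> R[i]) (l : R[i]) :=
  forall e, 0 < e -> exists N, forall n, (N <= n)%N -> normc (z n - l) <= e.

Lemma real_cauchy_series_ex (u h : nat -> R) M : (forall k, `|u k.+1 - u k| <= h k) ->
  (forall n, \sum_(0 <= k < n) h k <= M) -> cvgn u.
Proof.
move=> uh hM; have h0 k : 0 <= h k by rewrite (le_trans _ (uh k)).
have cn : cvgn [normed series (telescope u)].
  apply: (@series_le_cvg _ _ h) => [n|//|n|]; [exact: normr_ge0|exact: uh|].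
  apply: nondecreasing_is_cvgn; first exact: nondecreasing_series.
  by exists M => _ [n _ <-]; rewrite seriesEnat /=.
have := normed_cvg cn; rewrite telescopeK => c.
have -> : u = (fun n => (u n - u 0%N) + u 0%N) by apply/funext => n; rewrite subrK.
by apply: is_cvgD => //; exact: is_cvg_cst.
Qed.

Lemma cvgn_eps (u : nat -> R) e : cvgn u -> 0 < e ->
  exists N, forall n, (N <= n)%N -> `|u n - limn u| <= e.
Proof.
move=> cu e0; have /cvgrPdist_le/(_ _ e0)[N _ NP] := cu.
by exists N => n Nn; rewrite distrC NP.
Qed.

(* The increments are summable in [L^1], hence almost everywhere. *)
Lemma geometric_ae_limit (g : nat -> fun_p) :
  (forall k, rnorm (\pi_X (g k.+1) - \pi_X (g k)) <= 2^-1 ^+ k) ->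
  exists2 f : T -> R[i], cmeasurable f &
    {ae mu, forall t, normc_cvg (fun k => g k t) (f t)}.
Proof.
move=> gg; pose q k := cLfunD (g k.+1) (cLfunZ (-1) (g k)).
have qE k : \pi_X (q k) = \pi_X (g k.+1) - \pi_X (g k).
  by rewrite -scaleN1r cLp_piZ cLp_piD.
pose h k t := normc (g k.+1 t - g k t).
have hq k t : h k t = normc (q k t) by rewrite /h /= mulN1r.
pose m := fine (mu [set: T]).
(* By Jensen's inequality [c] bounds the inclusion of [L^p] into [L^1]. *)
pose c := (m `^ (p - 1)) `^ p^-1.
have int_h k : \int[mu]_t h k t <= c * 2^-1 ^+ k.
  apply: (powR_le_cancel p_gt1).
  - by apply: Rintegral_ge0 => t _; exact: ge0_normc.
  - by rewrite mulr_ge0 ?powR_ge0 // exprn_ge0.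
  rewrite (_ : \int[mu]_t h k t = \int[mu]_t normc (q k t)); last first.
    by apply: eq_Rintegral => t _; exact: hq.
  apply: (le_trans (Rintegral_normc_powR_le mu_fin (q k) measurableT)).
  rewrite powRM ?powR_ge0 ?exprn_ge0 // /c -powRrM mulVf // powRr1 ?powR_ge0 //.
  rewrite ler_wpM2l ?powR_ge0 //.
  have -> : \int[mu]_t (normc (q k t) `^ p) = rnorm (\pi_X (q k)) `^ p.
    by rewrite /Rintegral -rnorm_pi_powR.
  by apply: (le_powR p_gt1); rewrite ?rnorm_ge0 // qE.
have mh k : measurable_fun setT (fun t => (h k t)%:E).
  apply/measurable_EFinP.
  rewrite (_ : h k = fun t => normc (q k t)); last by apply/funext => t; exact: hq.
  by apply: measurable_normc; exact: cLfun_measurable.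
have h0 k t : (0 <= (h k t)%:E)%E by rewrite lee_fin ge0_normc.
pose S t := (\sum_(0 <= k <oo) (h k t)%:E)%E.
have mS : measurable_fun setT S.
  by apply: ge0_emeasurable_sum => // k t _ _; exact: h0.
have S0 t : (0 <= S t)%E by apply: nneseries_ge0 => k _ _; exact: h0.
have int_S : (\int[mu]_t S t <= (c * 2)%:E)%E.
  rewrite /S integral_nneseries //.
  apply: lime_le.
    by apply: is_cvg_nneseries => k _ _; apply: integral_ge0 => t _; exact: h0.
  apply: nearW => n.
  apply: (@le_trans _ _ (\sum_(0 <= k < n) (c * 2^-1 ^+ k)%:E)%E).
    apply: lee_sum => k _.
    have ih : mu.-integrable setT (fun t => (h k t)%:E).
      by under eq_fun do rewrite hq; apply: integrable_normc.
    by rewrite -(fineK (integrable_fin_num measurableT ih)) lee_fin int_h.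
  rewrite sumEFin lee_fin -mulr_sumr ler_wpM2l ?powR_ge0 //.
  suff -> : \sum_(0 <= k < n) 2^-1 ^+ k = 2 - 2 * 2^-1 ^+ n :> R.
    by rewrite gerBl mulr_ge0 // exprn_ge0.
  elim: n => [|n IH]; first by rewrite big_nil expr0 mulr1 subrr.
  by rewrite big_nat_recr //= IH exprS; field.
have S_fin : {ae mu, forall t, S t \is a fin_num}.
  have iS : mu.-integrable setT S.
    apply/integrableP; split => //.
    under eq_integral do rewrite gee0_abs //.
    exact: le_lt_trans int_S (ltry _).
  by apply: filterS (integrable_ae measurableT iS) => t; apply.
pose E := [set t | S t \is a fin_num].
have mE : measurable E.
  by have := emeasurable_fin_num measurableT mS; rewrite setTI.
have part (pr : R[i] -> R) : (forall z, `|pr z| <= normc z) ->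
    (forall z w, pr (z - w) = pr z - pr w) ->
    (forall k, measurable_fun setT (fun t => pr (g k t))) ->
    exists2 f : T -> R, measurable_fun setT f & forall t e, E t -> 0 < e ->
      exists N, forall n, (N <= n)%N -> `|pr (g n t) - f t| <= e.
  move=> pr_le prB mpr; pose a n t := pr (g n t) * \1_E t.
  have aE t : E t -> a^~ t = (fun n => pr (g n t)).
    by move=> Et; apply/funext => n; rewrite /a indicE mem_set // mulr1.
  have ca t : cvgn (a^~ t).
    have [Et|nEt] := pselect (E t).
      rewrite aE //; apply: (@real_cauchy_series_ex _ (h^~ t) (fine (S t))) => [k|n].
        by rewrite -prB pr_le.
      rewrite -lee_fin fineK // -sumEFin.
      by apply: nneseries_lim_ge => k _ _; exact: h0.
    have -> : a^~ t = cst 0 by apply/funext => n; rewrite /a indicE memNset // mulr0.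
    exact: is_cvg_cst.
  exists (fun t => limn (a^~ t)).
    apply: (measurable_fun_cvg (h := a)) => [n|t _]; last exact: ca.
    by apply: measurable_funM => //; exact: measurable_indic.
  move=> t e Et e0; have [N NP] := cvgn_eps (ca t) e0.
  by exists N => n /NP; rewrite {1}/a indicE mem_set // mulr1.
have [|||fr mfr frP] := part (@complex.Re R).
- exact: normc_ge_absRe.
- by move=> [? ?] [? ?].
- by move=> k; exact: (cLfun_measurable (g k)).1.
have [|||fi mfi fiP] := part (@complex.Im R).
- exact: normc_ge_absIm.
- by move=> [? ?] [? ?].
- by move=> k; exact: (cLfun_measurable (g k)).2.
exists (fun t => fr t +i* fi t)%C; first by split.
apply: filterS S_fin => t St e e0; have e2 : 0 < e / 2 by rewrite divr_gt0.
have [N NP] := frP _ _ St e2; have [N' N'P] := fiP _ _ St e2.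
exists (maxn N N') => n; rewrite geq_max => /andP[/NP hr /N'P hi].
apply: (le_trans (normc_le_ReIm _)); rewrite [leRHS]splitr.
by move: hr hi; case: (g n t) => ? ? /= hr hi; exact: lerD.
Qed.

(** Lower semicontinuity of the [p]-th power, in the form suited to Fatou's lemma; it is read off
    the tangent at [normc l], whose slope is [k]. *)
Lemma normc_powR_liminf (z : nat -> R[i]) l : normc_cvg z l ->
  ((normc l `^ p)%:E <= limn_einf (fun n => (normc (z n) `^ p)%:E))%E.
Proof.
move=> zl; apply/lee_subgt0Pr => e e0.
have [N NP] : exists N, forall n, (N <= n)%N -> normc l `^ p - e <= normc (z n) `^ p.
  have [l0|l0] := leP (normc l) 0.
    exists 0%N => n _; have -> : normc l = 0 by apply/le_anti; rewrite l0 ge0_normc.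
    by rewrite powR0 // sub0r (le_trans _ (powR_ge0 _ _)) // oppr_le0 ltW.
  pose k := p * normc l `^ p / normc l.
  have k0 : 0 < k by rewrite divr_gt0 // mulr_gt0 // powR_gt0.
  have [N NP] := zl _ (divr_gt0 e0 k0).
  exists N => n /NP zn.
  have zl0 : 0 <= normc (z n) / normc l by rewrite divr_ge0 ?ge0_normc.
  have := bernoulli_powR p_gt1 zl0.
  rewrite -(ler_pM2l (powR_gt0 p l0)) -powRM ?ge0_normc //.
  rewrite [normc l * (_ / _)]mulrC divfK ?gt_eqF //; apply: le_trans.
  have dist : normc l - normc (z n) <= e / k.
    rewrite lerBlDl; apply: le_trans (lerD (lexx _) zn).
    by rewrite -{1}[l](subKr (z n)) (le_trans (le_normcD _ _)) // normcN.
  rewrite (_ : _ * (1 + _) = normc l `^ p - k * (normc l - normc (z n))); last first.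
    by rewrite /k; field; rewrite gt_eqF.
  by rewrite lerD2l lerN2 mulrC -ler_pdivlMr.
rewrite limn_einf_lim; apply: lime_ge; first exact: is_cvg_einfs.
exists N => // n /= Nn; apply: le_ereal_inf_tmp => _ [k /= nk <-].
by rewrite -EFinB lee_fin NP // (leq_trans Nn).
Qed.

(** Used twice for completeness: it shows that the almost everywhere limit belongs to [L^p], and,
    applied to differences, that the convergence holds in norm. *)
Lemma fatou_cLp (g : nat -> fun_p) (f : T -> R[i]) (K : R) : cmeasurable f ->
  {ae mu, forall t, normc_cvg (fun k => g k t) (f t)} ->
  (forall k, rnorm (\pi_X (g k)) <= K) ->
  (\int[mu]_t (normc (f t) `^ p)%:E <= (K `^ p)%:E)%E.
Proof.
move=> mf gf gK.
have mg k : measurable_fun setT (fun t => (normc (g k t) `^ p)%:E).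
  by apply/measurable_EFinP/measurable_normc_powR; exact: cLfun_measurable.
have g0 k t : (0 <= (normc (g k t) `^ p)%:E)%E by rewrite lee_fin powR_ge0.
apply: (@le_trans _ _ (\int[mu]_t limn_einf (fun k => (normc (g k t) `^ p)%:E))%E).
  apply: ae_ge0_le_integral => //.
  - by move=> t _; rewrite lee_fin powR_ge0.
  - exact/measurable_EFinP/measurable_normc_powR.
  - move=> t _; rewrite limn_einf_lim; apply: lime_ge; first exact: is_cvg_einfs.
    by apply: nearW => n; apply: le_ereal_inf_tmp => _ [k _ <-].
  - under eq_fun do rewrite limn_einf_lim.
    apply: (@emeasurable_fun_cvg _ _ _ _ (fun n t => einfs (fun k => (normc (g k t) `^ p)%:E) n)).
      by move=> n; exact: measurable_fun_einfs.
    by move=> t _; exact: is_cvg_einfs.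
  - by apply: filterS gf => t gt _; exact: normc_powR_liminf.
apply: (le_trans (fatou mu measurableT mg (fun k t _ => g0 k t))).
rewrite limn_einf_lim; apply: lime_le; first exact: is_cvg_einfs.
apply: nearW => n; apply: (@le_trans _ _ (\int[mu]_t (normc (g n t) `^ p)%:E)%E).
  by apply: ereal_inf_lbound; exists n => /=.
by rewrite -rnorm_pi_powR lee_fin; apply: (le_powR p_gt1); rewrite ?rnorm_ge0.
Qed.

Theorem cLp_complete : rcomplete X.
Proof.
move=> x xC.
have /choice[N NP] k : exists N, forall i j, (N <= i)%N -> (N <= j)%N ->
    rnorm (x i - x j) <= 2^-1 ^+ k.
  by apply: xC; rewrite exprn_gt0 // invr_gt0.
(* The running maximum places [K n] beyond [N k] for all [n >= k], so the whole tail of the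
   subsequence obeys the estimate of index [k]. *)
pose K k := \max_(j < k.+1) N j.
have NK k j : (j <= k)%N -> (N j <= K k)%N.
  by move=> jk; have := @leq_bigmax _ (fun j : 'I_k.+1 => N j) (Ordinal (jk : (j < k.+1)%N)).
have KK k : (K k <= K k.+1)%N.
  by rewrite /K [leqRHS]big_ord_recr /= leq_maxl.
pose g k := repr (x (K k)).
have gE k : \pi_X (g k) = x (K k) by rewrite reprK.
have step k : rnorm (\pi_X (g k.+1) - \pi_X (g k)) <= 2^-1 ^+ k.
  by rewrite !gE; apply: NP; rewrite NK.
have [f mf fP] := geometric_ae_limit step.
have tail k n : (k <= n)%N -> rnorm (\pi_X (g n) - \pi_X (g k)) <= 2^-1 ^+ k.
  by move=> kn; rewrite !gE; apply: NP; rewrite NK.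
have [F FE] : exists F : fun_p, F =1 f.
  apply: cLfun_of_integral => //.
  apply: (@le_lt_trans _ _ (((rnorm (\pi_X (g 0%N)) + 1) `^ p)%:E)); last exact: ltry.
  apply: (fatou_cLp mf fP) => k.
  rewrite -[\pi_X (g k)](subrK (\pi_X (g 0%N))) addrC (le_trans (rnormD _ _)) //.
  by rewrite lerD2l (le_trans (tail 0%N k _)) // expr0.
have close k : rnorm (x (K k) - \pi_X F) <= 2^-1 ^+ k.
  rewrite -gE rnorm_distC.
  pose q n := cLfunD (g (n + k)%N) (cLfunZ (-1) (g k)).
  pose r := cLfunD F (cLfunZ (-1) (g k)).
  have -> : \pi_X F - \pi_X (g k) = \pi_X r by rewrite -scaleN1r cLp_piZ cLp_piD.
  apply: (powR_le_cancel p_gt1); rewrite ?rnorm_ge0 ?exprn_ge0 //.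
  rewrite -lee_fin rnorm_pi_powR; apply: (fatou_cLp (g := q)).
  - exact: cLfun_measurable.
  - apply: filterS fP => t ft e /ft[M MP]; exists M => n Mn.
    rewrite /q /r /= FE !mulN1r opprD addrACA opprK addNr addr0.
    by apply: MP; rewrite (leq_trans Mn) // leq_addr.
  - move=> n; have -> : \pi_X (q n) = \pi_X (g (n + k)%N) - \pi_X (g k).
      by rewrite -scaleN1r cLp_piZ cLp_piD.
    by apply: tail; exact: leq_addl.
exists (\pi_X F) => e e0.
have [k ke] : exists k, 2 * 2^-1 ^+ k <= e :> R.
  exists (Num.truncn (2 / e)).+1.
  rewrite exprVn ler_pdivrMr ?exprn_gt0 // mulrC -ler_pdivrMr //.
  rewrite (le_trans (ltW (truncnS_gt _))) // -natrX ler_nat ltnW // ltn_expl //.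
exists (K k) => n Kn.
rewrite -[x n](subrK (x (K k))) -addrA (le_trans (rnormD _ _)) // (le_trans _ ke) //.
rewrite mulr_natl mulr2n lerD ?close // NP // ?NK //.
by rewrite (leq_trans _ Kn) // NK.
Qed.

End Completeness.

(** * Dyadic arcs of the circle *)

Section Refinement.
Context d (T : measurableType d) (R : realType).
Context (mu : {measure set T -> \bar R}) (p : R) (p_gt1 : 1 < p).
Hypothesis mu_fin : (mu [set: T] < +oo)%E.
Local Notation X := (cLp mu (ltW p_gt1)).
Local Open Scope quotient_scope.
Context (A B : set T) (mA : measurable A) (mB : measurable B).
Hypothesis AB : A `&` B = set0.
Hypothesis mu_AB : mu A = mu B.

Let fine_AB : fine (mu (A `|` B)) = 2 * fine (mu A).
Proof.
have fA : mu A \is a fin_num by rewrite ge0_fin_numE // (mu_lty mu_fin).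
have -> : mu (A `|` B) = (mu A + mu A)%E by rewrite {2}mu_AB measureU.
by rewrite fineD // mulr_natl mulr2n.
Qed.

Lemma lp_coef_setU (x : X) : lp_coef (A `|` B) x =
  (2 `^ (p^-1 - 1))%:C%C * (lp_coef A x + lp_coef B x).
Proof.
have [f ->] := cLp_pi_ex x; rewrite /lp_coef !cint_repr //; last exact: measurableU.
have -> : cint mu (A `|` B) f = cint mu A f + cint mu B f.
  have mAB : measurable (A `|` B) by exact: measurableU.
  have dAB : [disjoint A & B] by rewrite disj_set2E AB.
  have iRe := integrable_Re mu_fin f mAB; have iIm := integrable_Im mu_fin f mAB.
  by rewrite /cint (Rintegral_setU mA mB iRe dAB) (Rintegral_setU mA mB iIm dAB).
by rewrite fine_AB powRM ?fine_ge0 // rmorphM -mu_AB /=; ring.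
Qed.

Lemma lp_unit_setU : lp_unit mu p_gt1 (A `|` B) =
  (2 `^ (- p^-1))%:C%C *: (lp_unit mu p_gt1 A + lp_unit mu p_gt1 B).
Proof.
have [f fE ->] := lp_unit_repr p_gt1 mu_fin mA.
have [g gE ->] := lp_unit_repr p_gt1 mu_fin mB.
have [h hE ->] := lp_unit_repr p_gt1 mu_fin (measurableU _ _ mA mB).
rewrite cLp_piD cLp_piZ; apply/cLp_eqP/nearW => t _ /=.
rewrite fE gE hE /nindic -rmorphD -rmorphM; congr (_%:C)%C.
rewrite fine_AB -mu_AB powRM ?fine_ge0 // -mulrA -mulrDr; congr (_ * (_ * _)).
rewrite !indicE in_setU; case: (boolP (t \in A)) => tA; last by rewrite add0r.
case: (boolP (t \in B)) => [tB|_]; last by rewrite addr0.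
by have : (A `&` B) t by [split; exact/set_mem]; rewrite AB.
Qed.

End Refinement.

(** * Arguments and arcs on the circle *)

Section Angle.
Context {R : realType}.
Local Notation T := (circle R).
Local Notation pi := (@trigo.pi R).

Definition circle_Re (z : T) : R := complex.Re (val z).
Definition circle_Im (z : T) : R := complex.Im (val z).

Lemma measurable_circle_coord : measurable_fun setT (@circle_coord R).
Proof. by move=> _ B mB; exists B. Qed.

Lemma measurable_circle_Re : measurable_fun setT circle_Re.
Proof. exact: (measurableT_comp measurable_fst measurable_circle_coord). Qed.

Lemma measurable_circle_Im : measurable_fun setT circle_Im.
Proof. exact: (measurableT_comp measurable_snd measurable_circle_coord). Qed.

(** The principal argument, with value [pi] at the point -1; accordingly all arcs are open on the
    left and closed on the right. *)
Definition angle (z : T) : R :=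
  if 0 <= circle_Im z then acos (circle_Re z) else - acos (circle_Re z).

Lemma acos_nonincreasing (x y : R) : -1 <= x <= 1 -> -1 <= y <= 1 -> x <= y ->
  acos y <= acos x.
Proof.
move=> hx hy; apply: contraTT; rewrite -!ltNge => xy.
have h z : -1 <= z <= 1 -> acos z \in `[0, pi].
  by move=> hz; rewrite in_itv /= acos_ge0 // acos_lepi.
by move: xy; rewrite -(ltr_cos (h x hx) (h y hy)) !acosK ?in_itv.
Qed.

Lemma measurable_angle : measurable_fun setT angle.
Proof.
(* Clamping to [[-1, 1]] extends [acos] to a monotone, hence measurable, function on the line; real
   parts of points of the circle are not affected. *)
pose ac (x : R) := acos (Num.max (-1) (Num.min 1 x)).
have clamp (x : R) : -1 <= Num.max (-1) (Num.min 1 x) <= 1.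
  by rewrite le_max lexx /= ge_max ge_min lexx /= andbT; lra.
have mac : measurable_fun setT ac.
  apply: nonincreasing_measurable => // x y xy; apply: acos_nonincreasing => //.
  by rewrite ge_max !le_max lexx /= le_min !ge_min lexx xy !orbT.
have acE z : acos (circle_Re z) = ac (circle_Re z).
  have z1 : normc (val z) = 1.
    by have /eqP := valP z; rewrite normc_def => /(congr1 (@complex.Re R)) /=; case: (val z).
  have := normc_ge_absRe (val z); rewrite z1 ler_norml => /andP[h1 h2].
  by rewrite /ac (min_idPr h2) (max_idPr h1).
have mcRe : measurable_fun setT (fun z => acos (circle_Re z)).
  rewrite (_ : (fun z => _) = ac \o circle_Re); last by apply/funext => z; exact: acE.
  exact: measurableT_comp mac measurable_circle_Re.
apply: measurable_fun_ifT => //; last exact: measurableT_comp.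
by apply: measurable_fun_ler; [exact: measurable_cst|exact: measurable_circle_Im].
Qed.

Lemma angle_expi t : - pi < t <= pi -> angle (expi t) = t.
Proof.
move=> /andP[t1 t2]; rewrite /angle /circle_Im /circle_Re /=.
have [t0|t0] := leP 0 t; first by rewrite sin_ge0_pi ?t0 // cosK // in_itv /= t0.
have : 0 < sin (- t) by apply: sin_gt0_pi; rewrite oppr_gt0 t0 /= ltrNl.
rewrite sinN oppr_gt0 => st; rewrite leNgt st /= cosKN ?opprK //.
by rewrite !ltW.
Qed.

(** The interval is taken open at [- pi], so that [angle_expi] applies at each of its points. *)
Lemma arc_length_integral (phi : T -> \bar R) : measurable_fun setT phi ->
  (forall z, 0 <= phi z)%E ->
  (\int[arc_length R]_z phi z =
   ((pi - - pi)^-1)%:E * \int[lebesgue_measure]_(t in `](- pi)%R, pi]) phi (expi t))%E.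
Proof.
move=> mphi phi0; rewrite /arc_length /distribution.
have me := @measurable_expi R.
rewrite ge0_integral_pushforward //.
have mc : measurable_fun setT (phi \o @expi R) by exact: measurableT_comp.
rewrite preimage_setT (integral_uniform _ mc) => [|t]; last exact: phi0.
by rewrite integral_itv_obnd_cbnd //; exact: measurable_funTS.
Qed.

Lemma arc_length_setT : (arc_length R [set: T] = 1)%E.
Proof. exact: (probability_setT (uniform_prob (ltNpi_pi R))). Qed.

(** [pi - - pi] is [2 * pi], in the form that the density of [uniform_prob] produces. *)
Definition dyadic_pt (n a : nat) : R := - pi + (pi - - pi) * (a%:R / 2 ^+ n).

Definition circle_arc (x y : R) : set T := angle @^-1` `]x, y].

Lemma measurable_circle_arc (x y : R) : measurable (circle_arc x y).
Proof. by rewrite /circle_arc -[_ @^-1` _]setTI; exact: measurable_angle. Qed.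

Lemma arc_length_arc (x y : R) : - pi <= x -> x <= y -> y <= pi ->
  (arc_length R (circle_arc x y) = ((pi - - pi)^-1 * (y - x))%:E)%E.
Proof.
move=> x0 xy y0; have ma := measurable_circle_arc x y.
rewrite -[circle_arc x y]setIT -integral_indic //.
have mi : measurable_fun setT (fun z => (\1_(circle_arc x y) z)%:E : \bar R).
  by apply/measurable_EFinP; exact: measurable_indic.
rewrite (arc_length_integral mi) => [|z]; last by rewrite lee_fin.
rewrite [X in (_ * X)%E](_ : _ = (\int[lebesgue_measure]_(t in `](- pi)%R, pi])
    (\1_[set` `]x, y]] t)%:E)%E); last first.
  apply: eq_integral => t; rewrite inE /= in_itv /= => tpi.
  rewrite !indicE; suff -> : (expi t \in circle_arc x y) = (t \in [set` `]x, y]]) by [].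
  by apply/idP/idP; rewrite !inE /circle_arc /= angle_expi.
rewrite integral_indic // setIidl.
  rewrite [X in (_ * X)%E](lebesgue_measure_itv `]x, y]) /= lte_fin EFinM.
  case: ltP => // yx; rewrite (_ : y - x = 0) //.
  by apply/eqP; rewrite subr_eq0 eq_le xy yx.
move=> t /=; rewrite !in_itv /= => /andP[h1 h2].
by rewrite (le_lt_trans x0) // (le_trans h2).
Qed.

End Angle.

(** The change of variables is available for non-negative integrands; this reduces a signed
    integrand to two such functions of its values. *)
Lemma integral_maxe d (T : measurableType d) (R : realType)
    (mu : {measure set T -> \bar R}) (D : set T) (f : T -> \bar R) :
  (\int[mu]_(t in D) f t =
   \int[mu]_(t in D) maxe (f t) 0 - \int[mu]_(t in D) maxe (- f t) 0)%E.
Proof.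
rewrite integralE; congr (_ - _)%E; apply: eq_integral => t _.
  exact: funeposE.
exact: funenegE.
Qed.

(** * Functions with vanishing integrals over dyadic arcs *)

Section ArcTotality.
Context {R : realType}.
Local Notation T := (circle R).
Local Notation pi := (@trigo.pi R).
Local Notation L := (pi - - pi).
Local Notation leb := (@lebesgue_measure R).

Let L0 : 0 < L. Proof. by rewrite opprK addr_gt0 ?pi_gt0. Qed.

Lemma arc_length_integral_arc (phi : T -> \bar R) (x y : R) :
  measurable_fun setT phi -> (forall z, 0 <= phi z)%E ->
  - pi <= x -> y <= pi ->
  (\int[arc_length R]_(z in circle_arc x y) phi z =
   (L^-1)%:E * \int[leb]_(t in [set` `]x, y]]) phi (expi t))%E.
Proof.
move=> mphi phi0 x0 y0; have ma := measurable_circle_arc x y.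
rewrite integral_mkcond arc_length_integral; first last.
- by move=> z; rewrite patchE; case: ifP.
- by apply/(measurable_restrictT _ ma); exact: measurable_funTS.
congr (_ * _)%E.
rewrite (_ : [set` `]x, y]] = [set` `](- pi)%R, pi]] `&` [set` `]x, y]]); last first.
  apply/seteqP; split=> t /=; last by case.
  rewrite !in_itv /= => /andP[h1 h2]; split; last by rewrite h1.
  by rewrite (le_lt_trans x0) // (le_trans h2).
rewrite integral_mkcondr; apply: eq_integral => t; rewrite inE /= in_itv /= => tpi.
rewrite !patchE; suff -> : (expi t \in circle_arc x y) = (t \in [set` `]x, y]]) by [].
by apply/idP/idP; rewrite !inE /circle_arc /= angle_expi.
Qed.

Context (h : T -> R) (ih : (arc_length R).-integrable setT (EFin \o h)).
Hypothesis h_arcs : forall n a, (a < 2 ^ n)%N ->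
  \int[arc_length R]_(z in circle_arc (dyadic_pt n a) (dyadic_pt n a.+1)) h z = 0.

(** The pull-back of [h] extended by zero, which brings the problem to the line and to the Lebesgue
    differentiation theorem. *)
Let G : R -> R := (fun t => h (expi t)) \_ [set` `](- pi)%R, pi]].

Let mh : measurable_fun setT h.
Proof. by have /measurable_int/measurable_EFinP := ih. Qed.

Let mhe : measurable_fun setT (fun t : R => h (expi t)).
Proof. exact: (measurableT_comp mh (@measurable_expi R)). Qed.

Let mG : measurable_fun setT G.
Proof.
by apply/(measurable_restrictT _ (measurable_itv _)); exact: measurable_funTS.
Qed.

Let GE t : - pi < t <= pi -> G t = h (expi t).
Proof. by move=> tpi; rewrite /G patchE mem_set //= in_itv. Qed.

Let int_absG : (\int[leb]_t `|(G t)%:E| = L%:E * \int[arc_length R]_z `|(h z)%:E|)%E.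
Proof.
rewrite arc_length_integral; first last.
- by move=> z; exact: abse_ge0.
- by apply: measurableT_comp => //; exact/measurable_EFinP.
rewrite muleA -EFinM divff ?gt_eqF // mul1e [in RHS]integral_mkcond.
apply: eq_integral => t _; rewrite /G !patchE; case: ifP => // _.
by rewrite abse0.
Qed.

Let iG : leb.-integrable setT (EFin \o G).
Proof.
apply/integrableP; split; first exact/measurable_EFinP.
rewrite [X in (X < _)%E]int_absG lte_mul_pinfty ?lee_fin ?(ltW L0) //.
by have /integrableP[] := ih.
Qed.

Let dyadic_pt_ge n a : - pi <= dyadic_pt n a.
Proof. by rewrite lerDl mulr_ge0 ?(ltW L0) // divr_ge0 // exprn_ge0. Qed.

Let dyadic_pt_le n a : (a <= 2 ^ n)%N -> dyadic_pt n a <= pi.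
Proof.
move=> an; rewrite /dyadic_pt -lerBrDl ler_piMr ?(ltW L0) //.
by rewrite ler_pdivrMr ?exprn_gt0 // mul1r -natrX ler_nat.
Qed.

Let G_arcs n a : (a < 2 ^ n)%N ->
  (\int[leb]_(t in [set` `]dyadic_pt n a, dyadic_pt n a.+1]]) (G t)%:E = 0)%E.
Proof.
move=> an; set x := dyadic_pt n a; set y := dyadic_pt n a.+1.
have x0 : - pi <= x by exact: dyadic_pt_ge.
have y0 : y <= pi by exact: dyadic_pt_le.
have ma := measurable_circle_arc x y.
have iha : (arc_length R).-integrable (circle_arc x y) (EFin \o h).
  exact: integrableS ih.
have : (\int[arc_length R]_(z in circle_arc x y) (h z)%:E = 0)%E.
  have /fineK <- := integrable_fin_num ma iha.
  by congr (_%:E); exact: h_arcs.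
have part (f : \bar R -> \bar R) : measurable_fun setT (fun t => f (h t)%:E) ->
    (forall z, 0 <= f z)%E ->
    (\int[leb]_(t in [set` `]x, y]]) f (G t)%:E =
     L%:E * \int[arc_length R]_(z in circle_arc x y) f (h z)%:E)%E.
  move=> mf f0; rewrite arc_length_integral_arc // muleA -EFinM divff ?gt_eqF // mul1e.
  apply: eq_integral => t; rewrite inE /= in_itv /= => /andP[h1 h2].
  by rewrite GE // (le_lt_trans x0) // (le_trans h2).
have mp : measurable_fun setT (fun z => maxe (h z)%:E 0%E : \bar R).
  by apply: measurable_maxe; [exact/measurable_EFinP|exact: measurable_cst].
have mn : measurable_fun setT (fun z => maxe (- (h z)%:E)%E 0%E : \bar R).
  apply: measurable_maxe; last exact: measurable_cst.
  by apply: measurableT_comp => //; exact/measurable_EFinP.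
rewrite integral_maxe [in X in _ -> X]integral_maxe.
rewrite (part (fun u => maxe u 0)%E) => [|//|z]; last by rewrite le_max lexx orbT.
rewrite (part (fun u => maxe (- u) 0)%E) => [|//|z]; last by rewrite le_max lexx orbT.
move=> eq0.
have /fineK fp : (\int[arc_length R]_(z in circle_arc x y) (maxe (h z)%:E 0) \is a fin_num)%E.
  have := integrable_pos_fin_num ma iha.
  by under eq_integral do rewrite funeposE.
have /fineK fn : (\int[arc_length R]_(z in circle_arc x y) (maxe (- (h z)%:E) 0) \is a fin_num)%E.
  have := integrable_neg_fin_num ma iha.
  by under eq_integral do rewrite funenegE.
move: eq0; rewrite -fp -fn -!EFinM -!EFinB => -[eq0].
by rewrite -mulrBr eq0 mulr0.
Qed.

(** The left endpoint of the level-[n] cell around [x], for the dyadic grid continued to the whole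
    line. *)
Let cell (x : R) (n : nat) : R := - pi + L * ((Num.floor ((x + pi) / L * 2 ^+ n))%:~R / 2 ^+ n).

Let cell_bounds x n : cell x n <= x < cell x n + L / 2 ^+ n.
Proof.
rewrite /cell; set y := (x + pi) / L * 2 ^+ n; set k := Num.floor y.
have n2 : 0 < 2 ^+ n :> R by rewrite exprn_gt0.
have xE : x = - pi + L * (y / 2 ^+ n).
  by rewrite /y mulfK ?gt_eqF // mulrC divfK ?gt_eqF // addrC addrK.
have /andP[k1 k2] : k%:~R <= y < (k + 1)%:~R by exact: floor_itv.
apply/andP; split; rewrite {1}xE.
  by rewrite lerD2l ler_pM2l // ler_pM2r ?invr_gt0.
rewrite -(addrA (- pi)) (ltrD2l (- pi)) -(mulrDr L) ltr_pM2l // -[X in _ < _ + X]mul1r -mulrDl.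
by rewrite ltr_pM2r ?invr_gt0 // -intrD1.
Qed.

(** Almost every value of [G] is the limit of its averages over the shrinking dyadic cells, and all
    these averages vanish. *)
Lemma arc_total : {ae arc_length R, forall z, h z = 0}.
Proof.
pose E x n := [set` `]cell x n, cell x n + L / 2 ^+ n]].
have len0 n : 0 < L / 2 ^+ n by rewrite divr_gt0 // exprn_gt0.
(* [E x n] is closed on the right like the arcs, while [cell_bounds] is closed on the left; [x] may
   thus be missing from [E x n], which a nicely shrinking family permits. The ball whose radius is
   twice the length of the cell has 4 times its measure. *)
have hE x : nicely_shrinking x (E x).
  split=> [n|]; first exact: measurable_itv.
  pose r n : {posnum R} := PosNum (mulr_gt0 (ltr0n _ 2) (len0 n)).
  exists (4, r); split => //=.
  - rewrite (_ : (fun n => _) = geometric (2 * L) 2^-1); last first.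
      by apply/funext => n; rewrite /geometric /= exprVn mulrA.
    by apply: cvg_geometric; rewrite ger0_norm ?invr_ge0 // invf_lt1 // ltr1n.
  - move=> n t; rewrite /E /= in_itv /= => /andP[t1 t2].
    have /andP[x1 x2] := cell_bounds x n.
    have := len0 n; rewrite /ball /= ltr_norml => ?; apply/andP; lra.
  - move=> n; have r0 : 0 <= 2 * (L / 2 ^+ n) by rewrite pmulr_rge0 // ltW.
    rewrite (lebesgue_measure_ball _ r0) /E lebesgue_measure_itv /= lte_fin ltrDl len0 -EFinB -EFinM lee_fin.
    have -> : cell x n + L / 2 ^+ n - cell x n = L / 2 ^+ n by rewrite addrC addKr.
    by move: (len0 n) => /=; move: (L / _) => l l0; lra.
have E0 x n : (\int[leb]_(t in E x n) (G t)%:E = 0)%E.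
  rewrite /E /cell; set k := Num.floor _.
  have n2 : 0 < 2 ^+ n :> R by rewrite exprn_gt0.
  have endE : - pi + L * (k%:~R / 2 ^+ n) + L / 2 ^+ n = - pi + L * ((k + 1)%:~R / 2 ^+ n).
    by rewrite -(addrA (- pi)) -(mulrDr L) -{2}[(2 ^+ n)^-1]mul1r -mulrDl intrD1.
  have out t : (t \notin `](- pi)%R, pi]) -> G t = 0.
    by move=> tn; rewrite /G patchE memNset //=; exact/negP.
  (* A cell lies to the left of the interval where [G] lives, or to its right, or corresponds to one
     of the [2 ^ n] arcs. *)
  have [k0|k0] := ltP k 0.
    apply: integral0_eq => t /=; rewrite in_itv /= endE => /andP[_ t2].
    rewrite out // in_itv /= negb_and -leNgt; apply/orP; left.
    rewrite (le_trans t2) // gerDl pmulr_rle0 // pmulr_lle0 ?invr_gt0 // lerz0.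
    by rewrite lezD1.
  have [kn|kn] := ltP k (2 ^ n)%:Z.
    case: k k0 kn endE => // a _; rewrite ltz_nat => an endE.
    have := G_arcs an; rewrite /dyadic_pt.
    have aE : (a%:Z + 1)%:~R = a.+1%:R :> R by rewrite intrD1 -natr1.
    by rewrite endE aE.
  apply: integral0_eq => t /=; rewrite in_itv /= => /andP[t1 _].
  rewrite out // in_itv /= negb_and orbC -ltNge; apply/orP; left.
  apply: le_lt_trans t1; rewrite -lerBlDl ler_peMr ?(ltW L0) //.
  by rewrite ler_pdivlMr // mul1r -natrX -[(2 ^ n)%:R]/((2 ^ n)%:Z%:~R) ler_int.
have locG : locally_integrable setT G by apply: open_integrable_locally => //; exact: openT.
have aeG : {ae leb, forall t, setT t -> (EFin \o G) t = 0%E}.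
  have := lebesgue_differentiation locG.
  apply: filterS; first exact: (ae_filter_ringOfSetsType leb).
  move=> t Gt _.
  have := nice_lebesgue_differentiation hE locG Gt.
  under eq_fun do rewrite E0 mule0.
  move=> c0; have /= <- := cvg_lim (@ereal_hausdorff R) c0.
  exact: lim_cst.
have : (\int[arc_length R]_z `|(EFin \o h) z| = 0)%E.
  have := int_absG.
  have -> : (\int[leb]_t `|(G t)%:E| = 0)%E.
    by apply/(ae_eq_integral_abs leb measurableT) => //; exact/measurable_EFinP.
  move/esym/eqP; rewrite mule_eq0 => /orP[|/eqP//].
  by rewrite eqe gt_eqF.
move/(ae_eq_integral_abs _ measurableT) => /(_ (measurable_int _ ih)).
by apply: filterS => z /(_ I) [].
Qed.

End ArcTotality.

Section DyadicArcs.
Context {R : realType} (p : R) (p_gt1 : 1 < p).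
Local Notation T := (circle R).
Local Notation pi := (@trigo.pi R).
Local Notation L := (pi - - pi).
Local Notation mu := (arc_length R).

Let L0 : 0 < L. Proof. by rewrite opprK addr_gt0 ?pi_gt0. Qed.

Let mu_fin : (mu [set: T] < +oo)%E.
Proof. by rewrite arc_length_setT ltry. Qed.

Definition dyadic_arc k a : set T := circle_arc (dyadic_pt k a) (dyadic_pt k a.+1).

Lemma measurable_dyadic_arc k a : measurable (dyadic_arc k a).
Proof. exact: measurable_circle_arc. Qed.

Lemma dyadic_pt_mono k a b : (a <= b)%N -> dyadic_pt k a <= dyadic_pt k b :> R.
Proof.
move=> ab; rewrite lerD2l ler_pM2l // ler_pM2r ?invr_gt0 ?exprn_gt0 //.
by rewrite ler_nat.
Qed.

Lemma dyadic_pt_double k a : dyadic_pt k.+1 a.*2 = dyadic_pt k a :> R.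
Proof.
rewrite /dyadic_pt exprS -mul2n natrM; congr (_ + _ * _).
by rewrite invfM mulrACA divff ?mul1r.
Qed.

Lemma circle_arc_disjoint (x y x' y' : R) : y <= x' ->
  circle_arc x y `&` circle_arc x' y' = set0.
Proof.
move=> yx'; rewrite -subset0 /circle_arc => z [] /=; rewrite !in_itv /=.
by move=> /andP[_ h1] /andP[h2 _]; have := le_lt_trans (le_trans h1 yx') h2; rewrite ltxx.
Qed.

Lemma dyadic_arc_trivIset k : trivIset setT (dyadic_arc k).
Proof.
apply: ltn_trivIset => b a ab.
by apply: circle_arc_disjoint; exact: dyadic_pt_mono.
Qed.

Lemma dyadic_arc_refine k a :
  dyadic_arc k a = dyadic_arc k.+1 a.*2 `|` dyadic_arc k.+1 a.*2.+1.
Proof.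
rewrite /dyadic_arc -(dyadic_pt_double k a) -(dyadic_pt_double k a.+1) doubleS.
have h1 := dyadic_pt_mono k.+1 (leqnSn a.*2).
have h2 := dyadic_pt_mono k.+1 (leqnSn a.*2.+1).
apply/seteqP; split=> z; rewrite /circle_arc /= !in_itv /=.
  move=> /andP[z1 z2]; have [zm|mz] := leP (angle z) (dyadic_pt k.+1 a.*2.+1).
    by left; rewrite z1.
  by right; rewrite z2.
move=> [] /andP[z1 z2]; first by rewrite z1 (le_trans z2).
by rewrite z2 (le_lt_trans h1).
Qed.

Lemma arc_length_dyadic_arc k a : (a < 2 ^ k)%N ->
  mu (dyadic_arc k a) = (2 ^- k)%:E.
Proof.
move=> ak; have k2 : 0 < 2 ^+ k :> R by rewrite exprn_gt0.
have h0 : - pi <= dyadic_pt k a.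
  by rewrite lerDl mulr_ge0 ?(ltW L0) // divr_ge0 // ltW.
have h1 : dyadic_pt k a.+1 <= pi.
  rewrite /dyadic_pt -lerBrDl ler_piMr ?(ltW L0) // ler_pdivrMr // mul1r.
  by rewrite -natrX ler_nat.
rewrite /dyadic_arc arc_length_arc // ?dyadic_pt_mono //.
congr (_%:E); rewrite /dyadic_pt -natr1; move: L0; move: L => l l0.
by field; rewrite !gt_eqF.
Qed.

Definition dyadic_unit k a : LpT p_gt1 := lp_unit mu p_gt1 (dyadic_arc k a).
Definition dyadic_coef k a (x : LpT p_gt1) : R[i] := lp_coef (dyadic_arc k a) x.

(** For [a >= 2 ^ k] the arc is empty and its vector is 0, so biorthogonality is asserted below
    [2 ^ k]. *)
Lemma dyadic_arc_lp_system k :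
  lp_system p (fun a => (a < 2 ^ k)%N) (dyadic_unit k) (dyadic_coef k).
Proof.
apply: disjoint_lp_system => //.
- exact: measurable_dyadic_arc.
- exact: dyadic_arc_trivIset.
- by move=> a ak; rewrite arc_length_dyadic_arc // lte_fin invr_gt0 exprn_gt0.
Qed.

Lemma dyadic_arc_halves k a : (a < 2 ^ k)%N ->
  dyadic_arc k.+1 a.*2 `&` dyadic_arc k.+1 a.*2.+1 = set0 /\
  mu (dyadic_arc k.+1 a.*2) = mu (dyadic_arc k.+1 a.*2.+1).
Proof.
move=> ak; split; first exact: circle_arc_disjoint.
by rewrite !arc_length_dyadic_arc // expnS mul2n ?ltn_double ?ltn_Sdouble.
Qed.

Lemma dyadic_coef_refine k a x : (a < 2 ^ k)%N -> dyadic_coef k a x =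
  (2 `^ (p^-1 - 1))%:C%C * (dyadic_coef k.+1 a.*2 x + dyadic_coef k.+1 a.*2.+1 x).
Proof.
move=> /dyadic_arc_halves[h1 h2]; rewrite /dyadic_coef dyadic_arc_refine.
by apply: lp_coef_setU => //; exact: measurable_dyadic_arc.
Qed.

Lemma dyadic_unit_refine k a : (a < 2 ^ k)%N -> dyadic_unit k a =
  (2 `^ (- p^-1))%:C%C *: (dyadic_unit k.+1 a.*2 + dyadic_unit k.+1 a.*2.+1).
Proof.
move=> /dyadic_arc_halves[h1 h2]; rewrite /dyadic_unit dyadic_arc_refine.
by apply: lp_unit_setU => //; exact: measurable_dyadic_arc.
Qed.

Lemma dyadic_coef_total x : (forall k a, (a < 2 ^ k)%N -> dyadic_coef k a x = 0) ->
  x = 0.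
Proof.
have [f ->] := cLp_pi_ex x => f0.
have fc k a : (a < 2 ^ k)%N -> cint mu (dyadic_arc k a) f = 0.
  move=> ak; have := f0 k a ak; rewrite /dyadic_coef /lp_coef.
  rewrite (cint_repr f (measurable_dyadic_arc k a)) arc_length_dyadic_arc //=.
  move/eqP; rewrite mulf_eq0 => /orP[|/eqP//].
  rewrite eq_complex /= => /andP[/eqP h _].
  have : 0 < (2 ^- k : R) `^ (p^-1 - 1) by rewrite powR_gt0 // invr_gt0 exprn_gt0.
  by rewrite h ltxx.
have re0 := arc_total (integrable_Re mu_fin f measurableT)
  (fun k a ak => congr1 (@complex.Re R) (fc k a ak)).
have im0 := arc_total (integrable_Im mu_fin f measurableT)
  (fun k a ak => congr1 (@complex.Im R) (fc k a ak)).
apply/cLp_eqP; apply: filterS2 re0 im0 => z + + _ /=.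
by case: (f z) => ? ? /= -> ->.
Qed.

(** [A i] is the right half of the first arc of level [i]; these arcs are disjoint, of positive
    length, and accumulate at the angle [- pi]. *)
Lemma disjoint_arcs_lp_system : exists (e : nat -> LpT p_gt1) (f : nat -> LpT p_gt1 -> R[i]),
  lp_system p xpredT e f.
Proof.
pose A i := dyadic_arc i.+1 1.
have half1 i : (1 < 2 ^ i.+1)%N by rewrite -{1}(expn0 2) ltn_exp2l.
exists (fun i => lp_unit mu p_gt1 (A i)), (fun i => lp_coef (A i)).
apply: disjoint_lp_system => //.
- by move=> i; exact: measurable_dyadic_arc.
- apply: ltn_trivIset => j i ij; rewrite setIC; apply: circle_arc_disjoint.
  rewrite (dyadic_pt_double j 1) /dyadic_pt lerD2l ler_pM2l // !mul1r.
  by rewrite lef_pV2 ?posrE ?exprn_gt0 // ler_weXn2l // ler1n.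
- by move=> i _; rewrite arc_length_dyadic_arc // lte_fin invr_gt0 exprn_gt0.
Qed.

End DyadicArcs.

(** * Operator norms and the factorization theorem *)

Section OperatorNorm.
Context {R : realType} {V W : normedModType R[i]}.

Lemma rnorm_le_opnorm (T : {linear V -> W}) x : bounded_op T ->
  rnorm (T x) <= opnorm T * rnorm x.
Proof.
move=> [M TM]; have [x0|x0] := eqVneq (rnorm x) 0.
  by rewrite (rnorm_eq0 x0) linear0 !rnorm0 mulr0.
have xp : 0 < rnorm x by rewrite lt_neqAle eq_sym x0 rnorm_ge0.
pose c : R[i] := (rnorm x)^-1%:C%C.
have nc : normc c = (rnorm x)^-1 by rewrite normc_real ger0_norm // invr_ge0 ltW.
rewrite -ler_pdivrMr // mulrC -nc -rnormZ -linearZ /opnorm.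
apply: ub_le_sup.
  exists `|M| => _ [y y1 <-]; rewrite (le_trans (TM y)) //.
  rewrite (le_trans (ler_wpM2r (rnorm_ge0 y) (ler_norm M))) //.
  by rewrite ler_piMr.
by exists (c *: x) => //=; rewrite rnormZ nc mulVf.
Qed.

Lemma opnorm_le (f : V -> W) M : 0 <= M -> (forall x, rnorm (f x) <= M * rnorm x) ->
  opnorm f <= M.
Proof.
move=> M0 fM; apply: ge_sup; first by exists (rnorm (f 0)), 0; rewrite //= rnorm0.
move=> _ [x x1 <-]; apply: (le_trans (fM x)).
by rewrite -[leRHS]mulr1 ler_wpM2l.
Qed.

Lemma opnorm_ge0 (f : V -> W) : bounded_op f -> 0 <= opnorm f.
Proof.
move=> [M fM]; apply: (le_trans (rnorm_ge0 (f 0))); apply: ub_le_sup.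
  exists `|M| => _ [y y1 <-]; rewrite (le_trans (fM y)) //.
  rewrite (le_trans (ler_wpM2r (rnorm_ge0 y) (ler_norm M))) //.
  by rewrite ler_piMr.
by exists 0; rewrite //= rnorm0.
Qed.

Lemma lipschitz_rnorm_continuous (f : V -> W) M : 0 <= M ->
  (forall x y, rnorm (f x - f y) <= M * rnorm (x - y)) -> continuous f.
Proof.
move=> M0 fM x; apply/cvgrPdist_le => e e0.
have M1 : 0 < (M + 1)%:C%C :> R[i] by rewrite ltcR ltr_wpDl.
have eM : 0 < e / (M + 1)%:C%C by rewrite divr_gt0.
near=> y.
rewrite rnormE (@le_trans _ _ ((M + 1)%:C%C * `|x - y|)) //.
  rewrite rnormE -rmorphM lecR (le_trans (fM x y)) // ler_wpM2r ?rnorm_ge0 //.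
  by rewrite lerDl.
rewrite mulrC -ler_pdivlMr //.
Unshelve. all: by end_near. Qed.

End OperatorNorm.

Lemma subrACA (V : zmodType) (a b c d : V) : a - b - (c - d) = a - c - (b - d).
Proof. by rewrite !opprD !opprK addrACA. Qed.

Theorem theorem4p1 (R : realType) (p : R) (p_gt1 : 1 < p) :
  exists C : R,
    forall T : {linear linfty (LpT p_gt1) -> linfty (LpT p_gt1)},
      bounded_op T -> opnorm T <= 1 ->
      exists2 H : linfty (LpT p_gt1) -> linfty (LpT p_gt1),
        H = T \/ H = (fun x => x - T x) &
        exists E P : {linear linfty (LpT p_gt1) -> linfty (LpT p_gt1)},
          [/\ embedding E, projection P, P \o H \o E = id &
              opnorm E * opnorm P <= C].
Proof.
exists 4 => T Tb T1.
have T_le w : rnorm (T w) <= rnorm w.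
  apply: (le_trans (rnorm_le_opnorm w Tb)).
  by rewrite -[leRHS]mul1r ler_wpM2r ?rnorm_ge0.
have [e [f eL]] := disjoint_arcs_lp_system p_gt1.
have mu_fin : (arc_length R [set: circle R] < +oo)%E.
  by rewrite arc_length_setT ltry.
have [H HT [E [P [E_le P_le PHE]]]] := factor_contraction p_gt1 eL
  (@dyadic_arc_lp_system R p p_gt1) (@dyadic_coef_refine R p p_gt1)
  (@dyadic_unit_refine R p p_gt1) (@dyadic_coef_total R p p_gt1)
  (cLp_complete (p_gt1 := p_gt1) mu_fin) T_le.
exists H => //; exists E, P.
have H_lip x y : rnorm (H x - H y) <= 2 * rnorm (x - y).
  case: HT => ->; first by rewrite -linearB (le_trans (T_le _)) // ler_peMl ?rnorm_ge0 // ler1n.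
  have -> : x - T x - (y - T y) = (x - y) - T (x - y).
    by rewrite (linearB T) subrACA.
  by rewrite (le_trans (rnormB _ _)) // mulr_natl mulr2n lerD2l.
have Eb : bounded_op E by exists 1 => x; rewrite mul1r.
have Pb : bounded_op P by exists 4.
split.
(* [P \o H] is a left inverse of [E] on the whole space, Lipschitz with constant [4 * 2]. *)
- split => //; exists (P \o H) => //.
  apply: continuous_subspaceT; apply: (@lipschitz_rnorm_continuous _ _ _ _ 8) => // x y.
  rewrite /= -linearB (le_trans (P_le _)) //.
  by have := H_lip x y; lra.
- by split => //; apply/seteqP; split => // y _; exists (H (E y)).
- by apply/funext => x; exact: PHE.
- rewrite -[leRHS]mul1r; apply: ler_pM; rewrite ?opnorm_ge0 //.
    by apply: opnorm_le => // x; rewrite mul1r.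
  exact: opnorm_le.
Qed.
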